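(* For each $K\in\{1,0,-1\}$ there are Einstein (almost regular) Finsler metrics $F$ on $S^3$ with $\mathrm{Ric}=2KF^2$. These metrics take the form $F=\alpha\,\phi(\beta/\alpha)$, where $\alpha=\sqrt{a_{ij}(x)y^iy^j}$ is a Riemannian metric on $S^3$ and $\beta=b_i(x)y^i$ is a Killing $1$-form of constant length $b$ (with respect to $\alpha$) on $S^3$ satisfying $$\overline{\mathrm{Ric}}=2\alpha^2-4(b^2\alpha^2-\beta^2),\qquad s_{0m}s^m_{\ 0}=-(b^2\alpha^2-\beta^2),\qquad s^m_{\ 0;m}=2\beta,$$ and $\phi=\phi(s)$ satisfies the ordinary differential equation $$(b^2-s^2)\big[(1+sQ)Q_s-Q^2+2\big]-\big[2sQ+b^2Q^2+1\big]+K\phi^2=0,\qquad Q:=\frac{\phi'}{\phi-s\phi'}.$$ These metrics are not of constant flag curvature in general: for each $K\in\{1,0,-1\}$ there are metrics of this form with $\mathrm{Ric}=2KF^2$ that are not of constant flag curvature. The exception is the case $K=1$ and $\phi=1+s$, in which $F=\alpha+\beta$ is of constant flag curvature.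
   Context: Einstein metrics: for a Finsler metric $F$ on an $n$-manifold with geodesic coefficients $G^i=\frac14 g^{il}\{[F^2]_{x^ky^l}y^k-[F^2]_{x^l}\}$, $g_{ij}=\frac12[F^2]_{y^iy^j}$, the Riemann curvature is $R^i_{\ k}=2\frac{\partial G^i}{\partial x^k}-\frac{\partial^2G^i}{\partial x^m\partial y^k}y^m+2G^m\frac{\partial^2G^i}{\partial y^m\partial y^k}-\frac{\partial G^i}{\partial y^m}\frac{\partial G^m}{\partial y^k}$, and $\mathrm{Ric}=R^m_{\ m}$. $F$ is Einstein if $\mathrm{Ric}=(n-1)KF^2$ for a scalar function $K=K(x)$. $F$ is of constant flag curvature $c$ if $R^i_{\ k}=c\,(F^2\delta^i_k-F F_{y^k}y^i)$ with $c$ constant. An $(\alpha,\beta)$-metric is $F=\alpha\phi(s)$, $s=\beta/\alpha$, where $\alpha$ is a Riemannian metric and $\beta$ a $1$-form. Suppose $\phi$ is a $C^\infty$ positive function on $(-b_0,b_0)$ with $\phi(s)-s\phi'(s)+(b^2-s^2)\phi''(s)>0$ for $|s|\le b<b_0$. If $\|\beta_x\|_\alpha<b_0$ for all $x$, $F$ is a (regular) Finsler metric. If only $\|\beta_x\|_\alpha\le b_0$ is required, $F$ may be singular at points $x$ with $\|\beta_x\|_\alpha=b_0$, and such $F$ are called almost regular $(\alpha,\beta)$-metrics. Notation: '';'' is the covariant derivative with respect to the Levi-Civita connection of $\alpha$; $s_{ij}=\frac12(b_{i;j}-b_{j;i})$. Indices are raised and lowered with $a_{ij}$, $(a^{ij})=(a_{ij})^{-1}$;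 the index $0$ means contraction with $y$: $s^i_{\ 0}=s^i_{\ j}y^j$, $s_{0m}=s_{im}y^i$, $s_{0m}s^m_{\ 0}=s_{im}s^m_{\ j}y^iy^j$, $s^m_{\ 0;m}=s^m_{\ j;m}y^j$. $\beta$ is a Killing form if $r_{ij}:=\frac12(b_{i;j}+b_{j;i})=0$; it is Killing of constant length iff in addition $s_j:=b^ms_{mj}=0$, where $b^m=a^{mi}b_i$. $\overline{\mathrm{Ric}}$ is the Ricci curvature of $\alpha$, regarded as a quadratic form in $y$. $Q_s=dQ/ds$. *)

(* Defs.v *)
From HB Require Import structures.
From mathcomp Require Import all_boot all_order all_algebra.
From mathcomp Require Import all_classical all_reals all_analysis.

Set Implicit Arguments.
Unset Strict Implicit.
Unset Printing Implicit Defensive.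

Import Order.TTheory GRing.Theory Num.Theory.
Import numFieldNormedType.Exports.

Local Open Scope classical_set_scope.
Local Open Scope ring_scope.

Section Coordinates.
Context {R : realType} {n : nat}.
Implicit Types (f : 'rV[R]_n -> R) (F : 'rV[R]_n -> 'rV[R]_n -> R).
Implicit Types (x y : 'rV[R]_n) (i j k l m : 'I_n).

Definition dot (u v : 'rV[R]_n) : R := (u *m v^T) ord0 ord0.

Definition pd k f x : R := 'D_(delta_mx ord0 k) f x.

(* C^oo: every iterated partial derivative is differentiable. *)
Definition smooth f : Prop :=
  forall (s : seq 'I_n) x, differentiable (foldr pd f s) x.

Definition posdef (M : 'M[R]_n) : Prop :=
  forall v : 'rV[R]_n, v != 0 -> 0 < dot (v *m M) v.

(* A function on the tangent bundle is read in coordinates as F x y, with x the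
   base point and y the components of the tangent vector. *)

Definition dx k F : 'rV[R]_n -> 'rV[R]_n -> R :=
  fun x y => pd k (fun x' => F x' y) x.

Definition dy k F : 'rV[R]_n -> 'rV[R]_n -> R := fun x y => pd k (F x) y.

Definition sq F : 'rV[R]_n -> 'rV[R]_n -> R := fun x y => F x y ^+ 2.

Definition fundamental F x y : 'M[R]_n :=
  \matrix_(i, j) (2^-1 * dy j (dy i (sq F)) x y).

Definition geodesic_coef F i : 'rV[R]_n -> 'rV[R]_n -> R := fun x y =>
  4^-1 * \sum_l invmx (fundamental F x y) i l *
    (\sum_k dy l (dx k (sq F)) x y * y ord0 k - dx l (sq F) x y).

Definition riemann_curv F i k x y : R :=
  let G := geodesic_coef F in
  2 * dx k (G i) x y
  - \sum_m dy k (dx m (G i)) x y * y ord0 m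
  + 2 * \sum_m G m x y * dy k (dy m (G i)) x y
  - \sum_m dy m (G i) x y * dy k (G m) x y.

Definition ricci F x y : R := \sum_m riemann_curv F m m x y.

Definition finsler_at F x y : Prop := 0 < F x y /\ posdef (fundamental F x y).

(* Tensors of a Riemannian metric with coefficients a = (a_ij) and of a 1-form
   with coefficients b = (b_i). *)
Variables (a : 'rV[R]_n -> 'M[R]_n) (b : 'rV[R]_n -> 'rV[R]_n).

Definition christoffel i j k x : R :=
  2^-1 * \sum_l invmx (a x) i l *
    (pd j (fun z => a z l k) x + pd k (fun z => a z l j) x
     - pd l (fun z => a z j k) x).

(* b_{i;j} *)
Definition cov_form i j x : R :=
  pd j (fun z => b z ord0 i) x - \sum_k christoffel k i j x * b x ord0 k.

Definition r_form x : 'M[R]_n :=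
  \matrix_(i, j) (2^-1 * (cov_form i j x + cov_form j i x)).

Definition s_form x : 'M[R]_n :=
  \matrix_(i, j) (2^-1 * (cov_form i j x - cov_form j i x)).

(* s^i_j = a^{im} s_{mj} *)
Definition s_up x : 'M[R]_n := invmx (a x) *m s_form x.

(* s_{0m} s^m_0 *)
Definition s0s0 x y : R := dot (y *m (s_form x *m s_up x)) y.

(* s^m_{j;k} *)
Definition cov_s_up m j k x : R :=
  pd k (fun z => s_up z m j) x
  + \sum_l christoffel m l k x * s_up x l j
  - \sum_l christoffel l j k x * s_up x m l.

(* s^m_{0;m} *)
Definition div_s0 x y : R := \sum_j (\sum_m cov_s_up m j m x) * y ord0 j.

Definition form_norm x : R := Num.sqrt (dot (b x *m invmx (a x)) (b x)).

End Coordinates.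

Section Sphere.
Context {R : realType} {n : nat}.

(* S^n is the unit sphere of R^(n+1), with T_p S^n the orthogonal complement of
   p; its atlas consists of the stereographic projections from the two poles.
   stereo eps is the inverse of such a chart. *)

Definition on_sphere (p : 'rV[R]_(n + 1)) : Prop := dot p p = 1.

Definition stereo (eps : bool) (x : 'rV[R]_n) : 'rV[R]_(n + 1) :=
  row_mx ((2 / (dot x x + 1)) *: x)
         ((-1) ^+ eps * (dot x x - 1) / (dot x x + 1))%:M.

(* Row i is the coordinate vector field d/dx^i, as a vector of R^(n+1). *)
Definition frame (eps : bool) (x : 'rV[R]_n) : 'M[R]_(n, n + 1) :=
  jacobian (stereo eps) x.

Definition in_chart (eps : bool) (F : 'rV[R]_(n + 1) -> 'rV[R]_(n + 1) -> R)
  : 'rV[R]_n -> 'rV[R]_n -> R :=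
  fun x y => F (stereo eps x) (y *m frame eps x).

(* A field of bilinear forms on the spaces T_p S^n (resp. of linear forms) is
   given by a matrix A p (resp. a row vector B p) whose form on R^(n+1) is
   restricted to T_p S^n; every such field arises in this way, and only the
   restriction matters below. *)
Variables (A : 'rV[R]_(n + 1) -> 'M[R]_(n + 1))
          (B : 'rV[R]_(n + 1) -> 'rV[R]_(n + 1)).

Definition metric_coef (eps : bool) (x : 'rV[R]_n) : 'M[R]_n :=
  frame eps x *m A (stereo eps x) *m (frame eps x)^T.

Definition form_coef (eps : bool) (x : 'rV[R]_n) : 'rV[R]_n :=
  B (stereo eps x) *m (frame eps x)^T.

Definition riemannian_metric : Prop :=
  [/\ forall p u v, on_sphere p -> dot p u = 0 -> dot p v = 0 ->
        dot (u *m A p) v = dot (v *m A p) u,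
      forall p v, on_sphere p -> dot p v = 0 -> v != 0 -> 0 < dot (v *m A p) v
    & forall eps i j, smooth (fun x => metric_coef eps x i j)].

Definition smooth_form : Prop :=
  forall eps i, smooth (fun x => form_coef eps x ord0 i).

Definition alpha (p v : 'rV[R]_(n + 1)) : R := Num.sqrt (dot (v *m A p) v).

Definition beta (p v : 'rV[R]_(n + 1)) : R := dot (B p) v.

Definition alpha_beta (phi : R -> R) (p v : 'rV[R]_(n + 1)) : R :=
  alpha p v * phi (beta p v / alpha p v).

Definition killing_form : Prop :=
  forall eps x, r_form (metric_coef eps) (form_coef eps) x = 0.

Definition constant_length (b : R) : Prop :=
  forall eps x, form_norm (metric_coef eps) (form_coef eps) x = b.

(* phi is only meaningful on ]-b0, b0[; its values elsewhere are junk. *)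
Definition admissible (b0 : R) (phi : R -> R) : Prop :=
  [/\ 0 < b0,
      forall k s, `|s| < b0 -> derivable (derive1n k phi) s 1,
      forall s, `|s| < b0 -> 0 < phi s
    & forall s c, `|s| <= c -> c < b0 ->
        0 < phi s - s * derive1 phi s + (c ^+ 2 - s ^+ 2) * derive1n 2 phi s].

Definition almost_regular (b0 : R) (phi : R -> R) : Prop :=
  admissible b0 phi /\
  forall eps x, form_norm (metric_coef eps) (form_coef eps) x <= b0.

(* The nonzero vectors at which phi (beta / alpha) is defined: all of them when
   the norm of beta is less than b0; when it equals b0, all except those with
   |beta| = b0 alpha, where F is singular. *)
Definition domain (b0 : R) (eps : bool) (x y : 'rV[R]_n) : Prop :=
  y != 0 /\ `|in_chart eps beta x y| < b0 * in_chart eps alpha x y.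

(* F is a genuine (strongly convex) Finsler metric on the whole domain; the
   admissibility of phi gives this by itself unless the norm of beta is b0. *)
Definition finsler_on_domain (b0 : R) (phi : R -> R) : Prop :=
  forall eps x y, domain b0 eps x y ->
    finsler_at (in_chart eps (alpha_beta phi)) x y.

Definition einstein_const (b0 : R) (phi : R -> R) (K : R) : Prop :=
  forall eps x y, domain b0 eps x y ->
    let F := in_chart eps (alpha_beta phi) in
    finsler_at F x y ->
    ricci F x y = n.-1%:R * K * F x y ^+ 2.

Definition constant_flag_curvature (b0 : R) (phi : R -> R) : Prop :=
  exists c : R, forall eps x y, domain b0 eps x y ->
    let F := in_chart eps (alpha_beta phi) in
    finsler_at F x y ->
    forall i k, riemann_curv F i k x y =
      c * (F x y ^+ 2 * (i == k)%:R - F x y * dy k F x y * y ord0 i).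

End Sphere.

Section Family.
Context {R : realType}.

Definition Qfun (phi : R -> R) (s : R) : R :=
  derive1 phi s / (phi s - s * derive1 phi s).

Definition einstein_ode (K b b0 : R) (phi : R -> R) : Prop :=
  forall s, `|s| < b0 ->
    let Q := Qfun phi s in
    let Qs := derive1 (Qfun phi) s in
    (b ^+ 2 - s ^+ 2) * ((1 + s * Q) * Qs - Q ^+ 2 + 2)
    - (2 * s * Q + b ^+ 2 * Q ^+ 2 + 1) + K * phi s ^+ 2 = 0.

Variables (A : 'rV[R]_(3 + 1) -> 'M[R]_(3 + 1))
          (B : 'rV[R]_(3 + 1) -> 'rV[R]_(3 + 1)).

Definition alpha_beta_equations (b : R) : Prop :=
  forall eps (x y : 'rV[R]_3),
    let al := in_chart eps (alpha A) in
    let be := in_chart eps (beta B) in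
    let a_ := metric_coef A eps in
    let b_ := form_coef B eps in
    [/\ ricci al x y =
          2 * al x y ^+ 2 - 4 * (b ^+ 2 * al x y ^+ 2 - be x y ^+ 2),
        s0s0 a_ b_ x y = - (b ^+ 2 * al x y ^+ 2 - be x y ^+ 2)
      & div_s0 a_ b_ x y = 2 * be x y].

Definition alpha_beta_pair (b : R) : Prop :=
  [/\ riemannian_metric A, smooth_form B, killing_form A B,
      constant_length A B b & alpha_beta_equations b].

(* F = alpha phi(beta / alpha) is one of the (almost regular) metrics on S^3
   attached to K. *)
Definition in_family (K b b0 : R) (phi : R -> R) : Prop :=
  [/\ alpha_beta_pair b, almost_regular A B b0 phi & einstein_ode K b b0 phi].

End Family.

(* Main.v *)
(* For a Killing form of constant length the spray of F = alpha phi(beta/alpha)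
   is G^i = Gbar^i + alpha Q(s) s^i_0, and in dimension 3 the products s_{ij} s_{kl}
   and the tensor s^i_{j;k} are determined algebraically by a_{ij} and b_i.  Hence the Riemann
   curvature of F is that of alpha plus an explicit algebraic expression; its
   trace is 2 K F^2 exactly when phi solves the equation.  Since in dimension 3
   the Ricci curvature determines the curvature of alpha, the flag curvature of F
   is explicit too: it is constant for phi = 1 + s, and if Q(0) = 0 its constancy
   forces K phi(0)^2 = 1 - b^2.

   The pairs (alpha, beta) come from the round metric h of S^3 and its unit Hopf
   form eta, as alpha^2 = h / k + (b / k)^2 eta^2 and beta = (b / k) eta with
   k = 1 - b^2.  As alpha = h^(1/2) psi(eta / h^(1/2)) with
   psi(s) = (c1 + c2 s^2)^(1/2), the trace formula applied to (h, eta) gives its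
   Ricci curvature.

   For K = 2 N - M with 0 < N < M, let dz/dt = ((N - t^2) / (M - t^2))^(1/2),
   z(0) = 0 and r^2 = k (N - t^2) + z^2.  Then s = b z / r and phi = k / r, for
   t^2 < N, parametrize a solution of the equation on |s| < b with Q(0) = 0 and
   phi(0)^2 = k / N, so that K phi(0)^2 <> 1 - b^2 because K <> N. *)
Require Import Defs.
From HB Require Import structures.
From mathcomp Require Import all_boot all_order all_algebra.
From mathcomp Require Import all_classical all_reals all_analysis.
From mathcomp Require Import ring lra.

Set Implicit Arguments.
Unset Strict Implicit.
Unset Printing Implicit Defensive.

Import Order.TTheory GRing.Theory Num.Theory.
Import numFieldNormedType.Exports.

Local Open Scope classical_set_scope.
Local Open Scope ring_scope.

(** * Directional derivatives and smooth functions *)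

Section Calculus.
Context {R : realType} {V : normedModType R}.
Implicit Types (f g : V -> R) (z v : V).

(** The curvature of [F] is defined by differentiating [geodesic_coef], which contains the inverse
    of the Hessian of F^2 / 2; the closed formula for the spray is available only where that Hessian
    is invertible. To be differentiated, it must hold on a set open both in x and in y. This set is
    given by delta = phi - s phi' + (b^2 - s^2) phi'' > 0, which on the domain is equivalent to
    strong convexity. Admissibility gives delta > 0 only for b < b0, so in the curvature statements
    it is extracted from [finsler_at]. Origin of the profile: in a plane spanned by the direction of
    b^# and an orthogonal one, the indicatrix of F is the curve t -> (z, (k (N - t^2))^(1/2)) / k.
    For M = N one has z = t, the curve is an ellipse and F^2 = h / N is a scaled round metric with K
    = N. Taking M > N keeps the Einstein equation but separates K = 2 N - M from N, and so breaks K
    phi(0)^2 = 1 - b^2. *)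

Lemma derE f z v (d d' : R) : is_derive z v f d -> d = d' -> is_derive z v f d'.
Proof. by move=> h <-. Qed.

Lemma der_eq f g z v (d : R) : (\near z, f z = g z) ->
  is_derive z v f d -> is_derive z v g d.
Proof. exact: near_eq_is_derive. Qed.

Lemma der_ext f g z v (d : R) : (forall w, f w = g w) ->
  is_derive z v f d -> is_derive z v g d.
Proof. by move=> /funext ->. Qed.

Lemma derC (c : R) z v : is_derive z v (fun _ => c) 0.
Proof. exact: is_derive_cst. Qed.

Lemma derD f g z v (df dg : R) : is_derive z v f df -> is_derive z v g dg ->
  is_derive z v (fun w => f w + g w) (df + dg).
Proof. by move=> hf hg; exact: is_deriveD. Qed.

Lemma derB f g z v (df dg : R) : is_derive z v f df -> is_derive z v g dg ->
  is_derive z v (fun w => f w - g w) (df - dg).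
Proof. by move=> hf hg; exact: is_deriveB. Qed.

Lemma derN f z v (df : R) : is_derive z v f df ->
  is_derive z v (fun w => - f w) (- df).
Proof. by move=> hf; exact: is_deriveN. Qed.

Lemma derM f g z v (df dg : R) : is_derive z v f df -> is_derive z v g dg ->
  is_derive z v (fun w => f w * g w) (df * g z + f z * dg).
Proof.
move=> hf hg; apply: (derE (is_deriveM hf hg)).
by rewrite /GRing.scale /= addrC mulrC (mulrC (f z)) mulrC; congr (_ + _); rewrite mulrC.
Qed.

Lemma derX f n z v (df : R) : is_derive z v f df ->
  is_derive z v (fun w => f w ^+ n) (n%:R * f z ^+ n.-1 * df).
Proof.
move=> hf; elim: n => [|n IH].
  by rewrite !mul0r; apply: der_ext (derC _ _ _) => w; rewrite expr0.
apply: (@der_ext (fun w => f w * f w ^+ n)) => [w|]; first by rewrite exprS.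
apply: (derE (derM hf IH)) => /=.
case: n {IH} => [|n]; first by rewrite /= !expr0; ring.
by rewrite /= exprS -[in RHS]natr1; ring.
Qed.

Lemma derV f z v (df : R) : f z != 0 -> is_derive z v f df ->
  is_derive z v (fun w => (f w)^-1) (- df / f z ^+ 2).
Proof.
move=> fz hf; case: hf => hf <-.
apply: DeriveDef; first exact: derivableV.
by rewrite (deriveV fz hf) /GRing.scale /= mulNr mulrC mulNr.
Qed.

Lemma der_sum n (h : 'I_n -> V -> R) z v (dh : 'I_n -> R) :
  (forall i, is_derive z v (h i) (dh i)) ->
  is_derive z v (fun w => \sum_i h i w) (\sum_i dh i).
Proof.
move=> H; have := is_derive_sum H.
by rewrite (_ : \sum_i h i = fun w => \sum_i h i w)//; apply/funext => w;
  rewrite fct_sumE.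
Qed.

(** Both sides have literally the same difference quotients. This reduces directional derivatives to
    derivatives in one real variable, where the chain rule and the mean value theorem are
    available. *)
Lemma der_line (g : V -> R) z v (d : R) :
  is_derive z v g d <-> is_derive (0 : R) 1 (fun h => g (h *: v + z)) d.
Proof.
set k := fun h : R => _.
suff E : (fun h : R => h^-1 *: ((k \o shift 0) (h *: 1) - k 0)) =
         (fun h : R => h^-1 *: ((g \o shift z) (h *: v) - g z)).
  by split=> -[hd <-]; split; move: hd; rewrite /derivable /derive E.
by apply/funext => h /=; rewrite /k /= addr0 scale0r add0r /GRing.scale /= mulr1.
Qed.

Lemma der_comp (f : R -> R) g z v (df dg : R) :
  is_derive (g z) 1 f df -> is_derive z v g dg ->
  is_derive z v (fun w => f (g w)) (df * dg).
Proof.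
move=> hf /der_line hg; apply/der_line.
have hf' : is_derive (g (0 *: v + z)) 1 f df by rewrite scale0r add0r.
exact: (@is_derive1_comp _ f (fun h => g (h *: v + z)) _ _ _ hf' hg).
Qed.

Lemma der_sqrt g z v (dg : R) : 0 < g z -> is_derive z v g dg ->
  is_derive z v (fun w => Num.sqrt (g w)) ((2 * Num.sqrt (g z))^-1 * dg).
Proof. by move=> gz; apply: der_comp; exact: is_derive1_sqrt. Qed.

Lemma der_val f z v (d : R) : is_derive z v f d -> 'D_v f z = d.
Proof. by case. Qed.

Lemma der_diff f z v : differentiable f z -> is_derive z v f ('D_v f z).
Proof. by move=> h; apply: derivableP; exact: diff_derivable. Qed.

End Calculus.

Lemma derId {R : realType} (s : R) : is_derive s 1 (fun t => t) 1.
Proof. exact: is_derive_id. Qed.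

Lemma der_coord {R : realType} n (j k : 'I_n) (y : 'rV[R]_n) :
  is_derive y (delta_mx ord0 k) (fun z : 'rV[R]_n => z ord0 j) (j == k)%:R.
Proof.
apply/der_line; apply: (@der_ext _ _ (fun h : R => h * (j == k)%:R + y ord0 j)).
  by move=> h; rewrite !mxE eqxx.
eapply derE; first by eapply derD; [eapply derM; [exact: derId|exact: derC]|exact: derC].
by rewrite mul1r mulr0 !addr0.
Qed.

Section Smooth.
Context {R : realType} {n : nat}.
Implicit Types (f g : 'rV[R]_n -> R) (x : 'rV[R]_n) (k : 'I_n).

(** Graded version of [smooth]: the derivative of a product or of an inverse is again a combination
    of products, so closure under these operations goes by induction on the order of differentiation
    rather than on a sequence of directions. *)
Fixpoint smoothn (m : nat) f : Prop :=
  (forall x, differentiable f x) /\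
  (if m is m'.+1 then forall k, smoothn m' (pd k f) else True).

Lemma smoothn_smooth f : (forall m, smoothn m f) <-> smooth f.
Proof.
split=> [H s|].
  (* [foldr pd f s] differentiates first along the last entry of [s], hence the induction from the
     right end. *)
  move: f H; elim/last_ind: s => [|s k IH] f H x; first exact: (H 0%N).1.
  by rewrite foldr_rcons; apply: IH => m; have [_] := H m.+1; exact.
move=> H m; elim: m f H => [|m IH] f H /=; first by split=> // x; exact: (H [::]).
split=> [x|k]; first exact: (H [::]).
by apply: IH => s x; rewrite -(foldr_rcons pd f s k); exact: H.
Qed.

Lemma smoothn_diff m f x : smoothn m f -> differentiable f x.
Proof. by case: m => [|m] []. Qed.

Lemma smoothnW m f : smoothn m.+1 f -> smoothn m f.
Proof.
elim: m f => [|m IH] f [fd fk]; first by split.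
by split=> // k; exact: IH.
Qed.

Lemma smoothn_ext m f g : f =1 g -> smoothn m f -> smoothn m g.
Proof. by move=> /funext ->. Qed.

Lemma smoothn_cst m (c : R) : smoothn m (fun _ => c).
Proof.
elim: m c => [|m IH] c; split=> // k.
apply: (smoothn_ext _ (IH 0)) => x.
by rewrite /pd (der_val (derC _ _ _)).
Qed.

Lemma smoothnD m f g : smoothn m f -> smoothn m g ->
  smoothn m (fun x => f x + g x).
Proof.
elim: m f g => [|m IH] f g [fd fk] [gd gk];
  (split; first by move=> x; exact: differentiableD) => // k.
apply: (smoothn_ext _ (IH _ _ (fk k) (gk k))) => x.
by rewrite /pd (der_val (derD (der_diff _ (fd x)) (der_diff _ (gd x)))).
Qed.

Lemma smoothnM m f g : smoothn m f -> smoothn m g ->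
  smoothn m (fun x => f x * g x).
Proof.
elim: m f g => [|m IH] f g Hf Hg; have [fd fk] := Hf; have [gd gk] := Hg;
  (split; first by move=> x; exact: differentiableM) => // k.
apply: (smoothn_ext _ (smoothnD (IH _ _ (fk k) (smoothnW Hg))
                                (IH _ _ (smoothnW Hf) (gk k)))) => x.
by rewrite /pd (der_val (derM (der_diff _ (fd x)) (der_diff _ (gd x)))).
Qed.

Lemma smoothnV m f : (forall x, f x != 0) -> smoothn m f ->
  smoothn m (fun x => (f x)^-1).
Proof.
move=> f0; elim: m f f0 => [|m IH] f f0 Hf; have [fd fk] := Hf;
  (split; first by move=> x; exact: differentiableV) => // k.
have H := IH _ f0 (smoothnW Hf).
apply: (smoothn_ext _ (smoothnM (smoothnM (smoothn_cst m (-1)) (fk k))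
   (smoothnM H H))) => x.
rewrite /pd (der_val (derV (f0 x) (der_diff _ (fd x)))) expr2 invfM.
by rewrite mulN1r.
Qed.

Lemma smooth_diff f x : smooth f -> differentiable f x.
Proof. by move=> /(_ [::]). Qed.

Lemma smooth_pd f k : smooth f -> smooth (pd k f).
Proof. by move=> H s x; rewrite -(foldr_rcons pd f s k); exact: H. Qed.

Lemma smooth_ext f g : f =1 g -> smooth f -> smooth g.
Proof. by move=> /funext ->. Qed.

Lemma smooth_cst (c : R) : smooth (fun _ : 'rV[R]_n => c).
Proof. by apply/smoothn_smooth => m; exact: smoothn_cst. Qed.

Lemma smooth_coord (j : 'I_n) : smooth (fun x : 'rV[R]_n => x ord0 j).
Proof.
apply/smoothn_smooth; case=> [|m];
  (split; first by move=> x; exact: differentiable_coord) => // k.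
apply: (smoothn_ext _ (smoothn_cst m (j == k)%:R)) => x.
by rewrite /pd (der_val (der_coord _ _ _)).
Qed.

Lemma smoothD f g : smooth f -> smooth g -> smooth (fun x => f x + g x).
Proof.
by move=> /smoothn_smooth hf /smoothn_smooth hg; apply/smoothn_smooth => m; exact: smoothnD.
Qed.

Lemma smoothM f g : smooth f -> smooth g -> smooth (fun x => f x * g x).
Proof.
by move=> /smoothn_smooth hf /smoothn_smooth hg; apply/smoothn_smooth => m; exact: smoothnM.
Qed.

Lemma smoothN f : smooth f -> smooth (fun x => - f x).
Proof.
move=> hf; apply: smooth_ext (smoothM (smooth_cst (-1)) hf) => x.
by rewrite mulN1r.
Qed.

Lemma smoothV f : (forall x, f x != 0) -> smooth f -> smooth (fun x => (f x)^-1).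
Proof.
by move=> f0 /smoothn_smooth hf; apply/smoothn_smooth => m; exact: smoothnV.
Qed.

Lemma smooth_sum (I : Type) (r : seq I) (P : pred I) (h : I -> 'rV[R]_n -> R) :
  (forall i, P i -> smooth (h i)) -> smooth (fun x => \sum_(i <- r | P i) h i x).
Proof.
move=> H; elim: r => [|i r IH].
  by apply: smooth_ext (smooth_cst 0) => x; rewrite big_nil.
have [Pi|Pi] := boolP (P i).
  by apply: smooth_ext (smoothD (H i Pi) IH) => x; rewrite big_cons Pi.
by apply: smooth_ext IH => x; rewrite big_cons (negbTE Pi).
Qed.

Lemma smooth_prod (I : Type) (r : seq I) (P : pred I) (h : I -> 'rV[R]_n -> R) :
  (forall i, P i -> smooth (h i)) -> smooth (fun x => \prod_(i <- r | P i) h i x).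
Proof.
move=> H; elim: r => [|i r IH].
  by apply: smooth_ext (smooth_cst 1) => x; rewrite big_nil.
have [Pi|Pi] := boolP (P i).
  by apply: smooth_ext (smoothM (H i Pi) IH) => x; rewrite big_cons Pi.
by apply: smooth_ext IH => x; rewrite big_cons (negbTE Pi).
Qed.

Lemma smooth_det p (A : 'rV[R]_n -> 'M[R]_p) :
  (forall i j, smooth (fun x => A x i j)) -> smooth (fun x => \det (A x)).
Proof.
move=> H; apply: smooth_sum => s _.
by apply: smoothM; [exact: smooth_cst|apply: smooth_prod => i _; exact: H].
Qed.

(** Cramer's rule: the entries are cofactors divided by the determinant, all of them polynomial in
    the entries of [A]. *)
Lemma smooth_invmx p (A : 'rV[R]_n -> 'M[R]_p) :
  (forall x, A x \in unitmx) ->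
  (forall i j, smooth (fun x => A x i j)) ->
  forall i j, smooth (fun x => invmx (A x) i j).
Proof.
move=> Au H i j.
apply: (@smooth_ext (fun x => (\det (A x))^-1 * cofactor (A x) j i)).
  by move=> x; rewrite /invmx Au !mxE.
apply: smoothM; last first.
  apply: smoothM; first exact: smooth_cst.
  by apply: smooth_det => k l; apply: smooth_ext (H (lift j k) (lift i l)) => x; rewrite !mxE.
apply: smoothV; last exact: smooth_det.
by move=> x; have := Au x; rewrite unitmxE unitfE.
Qed.

Lemma der_pd f k x : smooth f -> is_derive x (delta_mx ord0 k) f (pd k f x).
Proof. by move=> H; apply: der_diff; exact: smooth_diff. Qed.

Lemma smooth_continuous f : smooth f -> continuous f.
Proof. by move=> H x; apply: differentiable_continuous; exact: smooth_diff. Qed.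

End Smooth.

Lemma der_along {R : realType} {V : normedModType R} (f : V -> R) z v (t d : R) :
  is_derive (t *: v + z) v f d -> is_derive t 1 (fun u : R => f (u *: v + z)) d.
Proof.
move=> /der_line H; apply/der_line; apply: der_ext H => h /=.
by rewrite scalerDl addrA /GRing.scale /= mulr1.
Qed.

Lemma dist_lt_half {R : realFieldType} (A B A' r : R) :
  `|A - A'| < r / 2 -> `|B - A'| < r / 2 -> `|A - B| < r.
Proof. by rewrite !ltr_norml => /andP[? ?] /andP[? ?]; apply/andP; split; lra. Qed.

(** * Symmetry of second partial derivatives *)

Section Schwarz.
Context {R : realType} {n : nat}.
Variable f : 'rV[R]_n -> R.
Hypothesis f_smooth : smooth f.

Let e (i : 'I_n) : 'rV[R]_n := delta_mx ord0 i.

Lemma smooth_mvt (g : 'rV[R]_n -> R) i (z : 'rV[R]_n) (h : R) : smooth g -> 0 < h ->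
  exists2 c, 0 < c < h & g (h *: e i + z) - g z = pd i g (c *: e i + z) * h.
Proof.
move=> gs h0.
have D (t : R) : is_derive t 1 (fun u : R => g (u *: e i + z)) (pd i g (t *: e i + z)).
  by apply: der_along; exact: der_pd.
have [|c cin E] := @MVT R (fun u : R => g (u *: e i + z))
  (fun u => pd i g (u *: e i + z)) 0 h h0 (fun t _ => D t).
  apply: continuous_subspaceT => t; apply: differentiable_continuous.
  by apply/derivable1_diffP; case: (D t).
exists c; first by move: cin; rewrite in_itv.
by move: E; rewrite scale0r add0r subr0.
Qed.

(** The second difference is the increment along [e i] of the function [g], itself the increment of
    [f] along [e j]. The mean value theorem for [g], and then along [e j] for [pd i f], produces the
    two intermediate parameters. *)
Lemma second_difference (i j : 'I_n) (x : 'rV[R]_n) (h : R) : 0 < h ->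
  exists c d, [/\ 0 < c < h, 0 < d < h &
   f (h *: e j + (h *: e i + x)) - f (h *: e i + x) - f (h *: e j + x) + f x
    = pd j (pd i f) (d *: e j + (c *: e i + x)) * h * h].
Proof.
move=> h0.
pose g z := f (h *: e j + z) + -1 * f z.
have fsh : smooth (fun z => f (h *: e j + z)).
  suff H m : forall u, (forall m, smoothn m u) -> smoothn m (fun z => u (h *: e j + z)).
    by apply/smoothn_smooth => m; apply: H; apply/smoothn_smooth.
  elim: m => [|m IH] u Hu.
    split=> // x0; apply: (@differentiable_comp _ _ _ _ (fun z => h *: e j + z) u).
      by apply: differentiableD => //; exact: differentiable_cst.
    exact: (smoothn_diff _ (Hu 0%N)).
  split=> [x0|k].
    apply: (@differentiable_comp _ _ _ _ (fun z => h *: e j + z) u).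
      by apply: differentiableD => //; exact: differentiable_cst.
    exact: (smoothn_diff _ (Hu 0%N)).
  apply: (smoothn_ext _ (IH (pd k u) _)); last by move=> p; have [_] := Hu p.+1; exact.
  move=> z; rewrite /pd; apply/esym; apply: der_val.
  apply/der_line; have /der_line := der_diff (delta_mx ord0 k) (smoothn_diff (h *: e j + z) (Hu 0%N)).
  by apply: der_ext => w; rewrite addrCA.
have gs : smooth g by apply: smoothD => //; apply: smoothM => //; exact: smooth_cst.
have [c ch E] := smooth_mvt i x gs h0.
have pg z : pd i g z = pd i f (h *: e j + z) - pd i f z.
  apply: der_val; apply: derE.
    apply: derD (der_pd i _ fsh) (derM (derC _ _ _) (der_pd i _ f_smooth)).
  have -> : pd i (fun z => f (h *: e j + z)) z = pd i f (h *: e j + z); last first.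
    by move: (pd i f z) (pd i f (h *: e j + z)) => s1 s2; ring.
  apply: der_val; apply/der_line; have /der_line := der_pd i (h *: e j + z) f_smooth.
  by apply: der_ext => w; rewrite addrCA.
have [d dh E'] := smooth_mvt j (c *: e i + x) (smooth_pd i f_smooth) h0.
exists c, d; split=> //.
move: E; rewrite pg E' /g => <-.
ring.
Qed.

(** The second difference over a small parallelogram is symmetric in [i] and [j], so it equates one
    mixed derivative at a point near [x] with the other one at another such point; continuity at [x]
    then bounds their difference by any [eps]. *)
Lemma pdC i j x : pd i (pd j f) x = pd j (pd i f) x.
Proof.
apply/eqP; rewrite -subr_eq0 -normr_le0; apply/ler_addgt0Pr => eps eps0; rewrite add0r.
have Ci : {for x, continuous (pd i (pd j f))}.
  by apply: smooth_continuous; do 2 apply: smooth_pd.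
have Cj : {for x, continuous (pd j (pd i f))}.
  by apply: smooth_continuous; do 2 apply: smooth_pd.
have e2 : 0 < eps / 2 by rewrite divr_gt0.
move/cvgrPdist_lt : Ci => /(_ _ e2) /nbhs_ballP[r1 /= r10 H1].
move/cvgrPdist_lt : Cj => /(_ _ e2) /nbhs_ballP[r2 /= r20 H2].
(* With [h = r / N] every intermediate point is within [r] of [x], whatever the norms of the basis
   vectors. *)
pose N := `|e i| + `|e j| + 1.
have N0 : 0 < N by rewrite ltr_pwDr// addr_ge0.
pose r := Num.min r1 r2.
have r0 : 0 < r by rewrite lt_min r10 r20.
pose h := r / N.
have h0 : 0 < h by rewrite divr_gt0.
have near_x k l c d : 0 < c < h -> 0 < d < h -> `|e k| + `|e l| < N ->
    ball x r (d *: e l + (c *: e k + x)).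
  move=> /andP[c0 ch] /andP[d0 dh] eN.
  rewrite -ball_normE /= addrA [X in x - X]addrC opprD addrA subrr sub0r normrN.
  apply: le_lt_trans (ler_normD _ _) _; rewrite !normrZ !gtr0_norm//.
  apply: (@le_lt_trans _ _ (h * (`|e k| + `|e l|))).
    by rewrite mulrDr addrC lerD// ler_wpM2r// ltW.
  by rewrite -ltr_pdivlMl// (lt_le_trans eN)// /h invf_div divfK ?gt_eqF.
have bd1 p : ball x r p -> ball x r1 p by apply: le_ball; rewrite ge_min lexx.
have bd2 p : ball x r p -> ball x r2 p by apply: le_ball; rewrite ge_min lexx orbT.
have [c [d [ch dh E]]] := second_difference j i x h0.
have [c' [d' [ch' dh' E']]] := second_difference i j x h0.
have eqAB : pd i (pd j f) (d *: e i + (c *: e j + x)) =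
            pd j (pd i f) (d' *: e j + (c' *: e i + x)).
  move: E E'; set X := pd i _ _; set Y := pd j _ _.
  rewrite [h *: e i + (h *: e j + x)]addrCA.
  move: (f (h *: e j + (h *: e i + x))) (f (h *: e i + x)) (f (h *: e j + x)) (f x).
  move: X Y => X Y s1 s2 s3 s4 E E'.
  by apply: (mulIf (lt0r_neq0 h0)); apply: (mulIf (lt0r_neq0 h0)); rewrite -E -E'; ring.
have L1 := H1 _ (bd1 _ (near_x _ _ _ _ ch dh _)).
have L2 := H2 _ (bd2 _ (near_x _ _ _ _ ch' dh' _)).
have /L1 A1 : `|e j| + `|e i| < N by rewrite /N addrC ltrDl.
have /L2 A2 : `|e i| + `|e j| < N by rewrite /N ltrDl.
move: eqAB A1 A2.
move: (pd i (pd j f) x) (pd j (pd i f) x) (pd i _ _) (pd j _ _) => A B A' B' <- A1 A2.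
exact: ltW (dist_lt_half A1 A2).
Qed.

End Schwarz.

(** * Linear algebra in dimension 3 *)

(** Closed ordinals, on which index equality and [match val i] compute; with [sum3] and [cases3] a
    tensor identity in dimension 3 becomes a polynomial or rational identity for [ring] or
    [field]. *)
Definition o0 : 'I_3 := @Ordinal 3 0 isT.
Definition o1 : 'I_3 := @Ordinal 3 1 isT.
Definition o2 : 'I_3 := @Ordinal 3 2 isT.

Lemma ord3P (i : 'I_3) : [\/ i = o0, i = o1 | i = o2].
Proof.
by case: i => -[|[|[|//]]] H; [apply: Or31|apply: Or32|apply: Or33]; apply: val_inj.
Qed.

Lemma sum3 (V : nmodType) (F : 'I_3 -> V) : \sum_i F i = F o0 + F o1 + F o2.
Proof.
rewrite !big_ord_recl big_ord0 addr0 addrA.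
by congr (F _ + F _ + F _); apply: val_inj.
Qed.

Ltac cases3 i := have [->|->|->] := ord3P i.

Section Algebra3.
Context {R : realFieldType}.
Implicit Types (a S W : 'I_3 -> 'I_3 -> R) (b u v y : 'I_3 -> R).

Definition mulv a u (i : 'I_3) : R := \sum_j a i j * u j.
Definition pair3 u v : R := \sum_i u i * v i.

Definition adj3 a (i j : 'I_3) : R :=
  let c p q r s := a p q * a r s - a p s * a r q in
  match val i, val j with
  | 0%N, 0%N => c o1 o1 o2 o2 | 0%N, 1%N => c o1 o2 o2 o0 | 0%N, _ => c o1 o0 o2 o1
  | 1%N, 0%N => c o2 o1 o0 o2 | 1%N, 1%N => c o2 o2 o0 o0 | 1%N, _ => c o2 o0 o0 o1
  | _, 0%N => c o0 o1 o1 o2 | _, 1%N => c o0 o2 o1 o0 | _, _ => c o0 o0 o1 o1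
  end.

Definition det3 a : R :=
  a o0 o0 * adj3 a o0 o0 + a o0 o1 * adj3 a o0 o1 + a o0 o2 * adj3 a o0 o2.

(** The vector v with S_ij = epsilon_ijk v_k: in dimension 3 an antisymmetric form is a vector, the
    source of the rigidity used below. *)
Definition axial S (i : 'I_3) : R :=
  match val i with 0%N => S o1 o2 | 1%N => S o2 o0 | _ => S o0 o1 end.

Lemma antisym_zero S : (forall i j, S i j = - S j i) -> forall i, S i i = 0.
Proof. by move=> SN i; have := SN i i; lra. Qed.

Lemma antisym_eq0 S : (forall i j, S i j = - S j i) ->
  (forall i, axial S i = 0) -> forall i j, S i j = 0.
Proof.
move=> SN H i j; have Z := antisym_zero SN.
have := H o0; have := H o1; have := H o2; rewrite /axial /= => h01 h20 h12.
by cases3 i; cases3 j; rewrite ?Z // SN ?h01 ?h20 ?h12 ?oppr0 // SN ?h01 ?h20 ?h12 ?oppr0.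
Qed.

Section Metric.
Variable a : 'I_3 -> 'I_3 -> R.
Hypothesis a_sym : forall i j, a i j = a j i.
Hypothesis det_neq0 : det3 a != 0.

Let a10 : a o1 o0 = a o0 o1. Proof. exact: a_sym. Qed.
Let a20 : a o2 o0 = a o0 o2. Proof. exact: a_sym. Qed.
Let a21 : a o2 o1 = a o1 o2. Proof. exact: a_sym. Qed.

Lemma mul_adj3 i k : \sum_j a i j * adj3 a j k = det3 a * (i == k)%:R.
Proof.
by rewrite sum3 /det3; cases3 i; cases3 k; rewrite /adj3 /= ?a10 ?a20 ?a21; ring.
Qed.

Lemma adj3_sym i j : adj3 a i j = adj3 a j i.
Proof. by cases3 i; cases3 j; rewrite /adj3 /= ?a10 ?a20 ?a21; ring. Qed.

Lemma adj3_mulv u i : mulv (adj3 a) (mulv a u) i = det3 a * u i.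
Proof.
by rewrite /mulv !sum3 /det3; cases3 i; rewrite /adj3 /= ?a10 ?a20 ?a21; ring.
Qed.

Lemma adj3_trace u v :
  \sum_i \sum_j adj3 a i j * (mulv a u i * mulv a v j) = det3 a * pair3 u (mulv a v).
Proof.
by rewrite /pair3 /mulv !sum3 /det3 /adj3 /= ?a10 ?a20 ?a21; ring.
Qed.

Lemma adj3_trace_metric : \sum_i \sum_j adj3 a i j * a i j = 3 * det3 a.
Proof. by rewrite !sum3 /det3 /adj3 /= ?a10 ?a20 ?a21; ring. Qed.

(** For the identity metric this is the product rule of cross-product matrices, [v][w] = w v^T -
    (v.w) 1; the adjugate in the middle makes it hold for every symmetric [a]. *)
Lemma antisym_sandwich S W (SN : forall i j, S i j = - S j i)
    (WN : forall i j, W i j = - W j i) i j :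
  \sum_k \sum_l S i k * adj3 a k l * W l j =
  mulv a (axial W) i * mulv a (axial S) j - pair3 (axial S) (mulv a (axial W)) * a i j.
Proof.
rewrite /pair3 /mulv !sum3 /axial /adj3 /=.
have S0 := antisym_zero SN; have W0 := antisym_zero WN.

by cases3 i; cases3 j; rewrite !S0 !W0 ?(SN o1 o0) ?(SN o2 o1) ?(SN o0 o2)
  ?(WN o1 o0) ?(WN o2 o1) ?(WN o0 o2) ?a10 ?a20 ?a21; ring.
Qed.

(** Each component of [mulv S y] is a triple product of a basis vector with [axial S] and [y], so
    the product of two of them is, up to [det3 a], a 3 by 3 Gram determinant, here expanded. *)
Lemma antisym_gram S (SN : forall i j, S i j = - S j i) y i k :
  det3 a * (mulv S y i * mulv S y k) =
  let v := axial S in let t := mulv a v in let z := mulv a y in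
  a i k * (pair3 y z * pair3 v t - pair3 y t ^+ 2) - pair3 v t * (z i * z k)
  - pair3 y z * (t i * t k) + pair3 y t * (z i * t k + t i * z k).
Proof.
rewrite /= /pair3 /mulv !sum3 /axial /det3 /adj3 /=.
have S0 := antisym_zero SN.
by cases3 i; cases3 k; rewrite !S0 ?(SN o1 o0) ?(SN o2 o1) ?(SN o0 o2)
  ?a10 ?a20 ?a21; ring.
Qed.

End Metric.
End Algebra3.

(** * Unit Killing forms and curvature in dimension 3, pointwise *)

Section UnitKilling.
Context {R : realFieldType}.
Variables (a S U : 'I_3 -> 'I_3 -> R) (b : 'I_3 -> R) (C : R).
Hypothesis a_sym : forall i j, a i j = a j i.
Hypothesis det_neq0 : det3 a != 0.
Hypothesis S_anti : forall i j, S i j = - S j i.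
Hypothesis aU : forall i j, \sum_m a i m * U m j = S i j.
Hypothesis SU : forall i j, \sum_m S i m * U m j = - (C * a i j - b i * b j).
Hypothesis b_norm : \sum_i \sum_j adj3 a i j * (b i * b j) = det3 a * C.

Let d := det3 a.
Let v := axial S.
Let t := mulv a v.

Lemma det_U i j : d * U i j = \sum_l adj3 a i l * S l j.
Proof. by have := adj3_mulv a_sym (fun m => U m j) i; rewrite /mulv => <-; apply: eq_bigr => l _; rewrite aU. Qed.

Lemma det_SU i j : \sum_k \sum_l S i k * adj3 a k l * S l j = d * \sum_m S i m * U m j.
Proof.
rewrite mulr_sumr; apply: eq_bigr => k _; rewrite mulrCA det_U mulr_sumr.
by apply: eq_bigr => l _; rewrite mulrA.
Qed.

Let axial_eq i j : t i * t j - pair3 v t * a i j = d * (b i * b j) - d * C * a i j.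
Proof.
by rewrite -(antisym_sandwich a_sym S_anti S_anti) det_SU SU; ring.
Qed.

(** Trace of [axial_eq] against the adjugate: the left side gives -2 d times the norm of v, the
    right side -2 d^2 C, and d is nonzero. *)
Lemma axial_norm : pair3 v t = d * C.
Proof.
have E : \sum_i \sum_j adj3 a i j * (t i * t j - pair3 v t * a i j) =
         \sum_i \sum_j adj3 a i j * (d * (b i * b j) - d * C * a i j).
  by apply: eq_bigr => i _; apply: eq_bigr => j _; rewrite axial_eq.
have E1 (x y : R) (f g : 'I_3 -> 'I_3 -> R) :
    \sum_i \sum_j adj3 a i j * (x * f i j - y * g i j) =
    x * (\sum_i \sum_j adj3 a i j * f i j) - y * \sum_i \sum_j adj3 a i j * g i j.
  by rewrite !sum3; ring.
have := E; rewrite E1 b_norm adj3_trace_metric //.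
have -> : \sum_i \sum_j adj3 a i j * (t i * t j - pair3 v t * a i j) =
    \sum_i \sum_j adj3 a i j * (1 * (t i * t j) - pair3 v t * a i j).
  by apply: eq_bigr => i _; apply: eq_bigr => j _; rewrite mul1r.
rewrite (E1 1 _ (fun i j => t i * t j)) adj3_trace_metric // adj3_trace // -/t -/d.
move=> E2; have : d * (pair3 v t - d * C) = 0 by lra.
by move/eqP; rewrite mulf_eq0 (negbTE det_neq0) /= subr_eq0 => /eqP.
Qed.

(** Thus the lowered axial vector of S is proportional to b: the Hodge dual of d beta is a multiple
    of beta. Recording products only avoids the square root of [d] and a choice of orientation. *)
Lemma axial_mul i j : t i * t j = d * (b i * b j).
Proof. by have := axial_eq i j; rewrite axial_norm; lra. Qed.

(** The axial vector lies in the kernel of S, and b^# is proportional to it. *)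
Lemma form_contract_U j : \sum_i b i * U i j = 0.
Proof.
(* Multiplied by [b k], the form enters only through the products known from [axial_mul]; if the sum
   were nonzero, all [b k] would vanish and the sum with them. *)
have H k : b k * (\sum_i b i * U i j) = 0.
  apply: (mulfI det_neq0); apply: (mulfI det_neq0); rewrite !mulr0.
  have -> : d * (d * (b k * \sum_i b i * U i j)) =
            \sum_i (d * (b k * b i)) * (d * U i j) by rewrite !sum3; ring.
  have -> : \sum_i (d * (b k * b i)) * (d * U i j) =
            t k * \sum_l mulv (adj3 a) t l * S l j.
    under eq_bigr do rewrite det_U -axial_mul.
    rewrite /mulv !sum3 !(adj3_sym a_sym o1 o0) !(adj3_sym a_sym o2 o0) !(adj3_sym a_sym o2 o1).
    by ring.
  under eq_bigr do rewrite adj3_mulv //.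
  rewrite sum3 /v /axial /= -/d.
  have S0 := antisym_zero S_anti.
  by cases3 j; rewrite !S0 ?(S_anti o1 o0) ?(S_anti o2 o1) ?(S_anti o0 o2); ring.
have [//|n0] := eqVneq (\sum_i b i * U i j) 0.
rewrite big1 // => k _; have /eqP := H k; rewrite mulf_eq0 (negbTE n0) orbF => /eqP ->.
by rewrite mul0r.
Qed.

(** This is [antisym_gram] with the axial vector replaced by b through [axial_mul]. *)
Lemma killing_gram y i k :
  mulv S y i * mulv S y k =
  let z := mulv a y in let q := pair3 y z in let be := pair3 b y in
  a i k * (C * q - be ^+ 2) - C * (z i * z k)
  - q * (b i * b k) + be * (z i * b k + b i * z k).
Proof.
apply: (mulfI det_neq0); rewrite antisym_gram //= -/v -/t axial_norm axial_mul.
have T j : pair3 y t * t j = d * (pair3 b y * b j).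
  have -> : pair3 y t * t j = \sum_i y i * (t i * t j) by rewrite /pair3 !sum3; ring.
  by under eq_bigr do rewrite axial_mul; rewrite /pair3 !sum3; ring.
have TT : pair3 y t ^+ 2 = d * pair3 b y ^+ 2.
  have -> : pair3 y t ^+ 2 = \sum_j y j * (pair3 y t * t j) by rewrite /pair3 !sum3; ring.
  by under eq_bigr do rewrite T; rewrite /pair3 !sum3; ring.
have E : pair3 y t * (mulv a y i * t k + t i * mulv a y k) =
   mulv a y i * (d * (pair3 b y * b k)) + d * (pair3 b y * b i) * mulv a y k.
  by rewrite -!T; ring.
by rewrite TT E -/d; ring.
Qed.

Section CovariantDerivative.
Variables (k : 'I_3) (W WU : 'I_3 -> 'I_3 -> R).
Hypothesis W_anti : forall i j, W i j = - W j i.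
Hypothesis aWU : forall i j, \sum_m a i m * WU m j = W i j.
Hypothesis W_eq : forall i j,
  \sum_m (W i m * U m j + S i m * WU m j) = S i k * b j + b i * S j k.
Hypothesis C_neq0 : C != 0.

(** [W] stands for the covariant derivative of S in direction [k], and [W_eq] for the derivative of
    the quadratic relation [SU]. This linear equation is solved by [W0]; the difference [D]
    anticommutes with S, which for the axial vectors reads x t^T + t x^T = 2 (v.x) a. Its trace
    gives v.x = 0, and then t nonzero forces x = 0. *)
Lemma cov_killing i j : W i j = a i k * b j - a j k * b i.
Proof.
pose W0 i j := a i k * b j - a j k * b i.
have W0_anti i' j' : W0 i' j' = - W0 j' i' by rewrite /W0; ring.
pose D i j := W i j - W0 i j.
have D_anti i' j' : D i' j' = - D j' i' by rewrite /D W_anti W0_anti; ring.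
suff : D i j = 0 by rewrite /D /W0; lra.
have det_WU i' j' : d * WU i' j' = \sum_l adj3 a i' l * W l j'.
  by have := adj3_mulv a_sym (fun m => WU m j') i'; rewrite /mulv => <-;
    apply: eq_bigr => l _; rewrite aWU.
have bU := form_contract_U.
have dbU j' : d * (\sum_m b m * U m j') = \sum_m b m * \sum_l adj3 a m l * S l j'.
  by rewrite mulr_sumr; apply: eq_bigr => m _; rewrite mulrCA det_U.
have Sb i' : \sum_m \sum_l S i' m * adj3 a m l * b l = 0.
  transitivity (- (d * \sum_l b l * U l i')).
    rewrite dbU !sum3 !(S_anti i') !(adj3_sym a_sym o1 o0) !(adj3_sym a_sym o2 o0) !(adj3_sym a_sym o2 o1).
    by ring.
  by rewrite bU mulr0 oppr0.
have DS i' j' : \sum_m \sum_l D i' m * adj3 a m l * S l j' +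
    \sum_m \sum_l S i' m * adj3 a m l * D l j' = 0.
  have E1 : \sum_m \sum_l W i' m * adj3 a m l * S l j' +
            \sum_m \sum_l S i' m * adj3 a m l * W l j' =
            d * (S i' k * b j' + b i' * S j' k).
    rewrite -W_eq mulr_sumr -big_split; apply: eq_bigr => m _ /=.
    rewrite mulrDr [d * (W _ _ * _)]mulrCA [d * (S _ _ * _)]mulrCA det_U det_WU !mulr_sumr.
    by congr (_ + _); apply: eq_bigr => l _; rewrite mulrA.
  have E2 : \sum_m \sum_l W0 i' m * adj3 a m l * S l j' =
            - (d * (b i' * S k j')).
    transitivity (a i' k * (d * \sum_m b m * U m j') -
      b i' * \sum_l (\sum_m a k m * adj3 a m l) * S l j').
      rewrite dbU /W0 !sum3 !(a_sym _ k); ring.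
    rewrite bU mulr0 mulr0 sub0r; under eq_bigr do rewrite mul_adj3 //.
    by rewrite !sum3 -/d; cases3 k; rewrite /=; ring.
  have E3 : \sum_m \sum_l S i' m * adj3 a m l * W0 l j' = d * (S i' k * b j').
    transitivity (b j' * (\sum_m S i' m * \sum_l (a k l * adj3 a l m)) -
      a j' k * \sum_m \sum_l S i' m * adj3 a m l * b l).
      rewrite /W0 !sum3 !(a_sym _ k) !(adj3_sym a_sym o1 o0) !(adj3_sym a_sym o2 o0) !(adj3_sym a_sym o2 o1).
      ring.
    rewrite Sb mulr0 subr0; under eq_bigr do rewrite mul_adj3 //.
    by rewrite !sum3 -/d; cases3 k; rewrite /=; ring.
  have -> : \sum_m \sum_l D i' m * adj3 a m l * S l j' +
    \sum_m \sum_l S i' m * adj3 a m l * D l j' =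
    (\sum_m \sum_l W i' m * adj3 a m l * S l j' +
            \sum_m \sum_l S i' m * adj3 a m l * W l j') -
    (\sum_m \sum_l W0 i' m * adj3 a m l * S l j') -
    (\sum_m \sum_l S i' m * adj3 a m l * W0 l j').
    by rewrite /D !sum3; ring.
  by rewrite E1 E2 E3 (S_anti k j'); ring.
pose u := axial D; pose x := mulv a u.
have ut : pair3 u t = pair3 v x.
  by rewrite /pair3 /t /x /mulv !sum3 !(a_sym o1 o0) !(a_sym o2 o0) !(a_sym o2 o1); ring.
have XT i' j' : x i' * t j' + t i' * x j' = 2 * pair3 v x * a i' j'.
  have := DS i' j'; rewrite !(antisym_sandwich a_sym) // -/u -/v -/x -/t ut.
  by move=> H; lra.
(* Trace against the adjugate: 2 d (v.x) on the left, 6 d (v.x) on the right. *)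
have ut0 : pair3 v x = 0.
  have E : \sum_i \sum_j adj3 a i j * (x i * t j + t i * x j) =
           \sum_i \sum_j adj3 a i j * (2 * pair3 v x * a i j).
    by apply: eq_bigr => i' _; apply: eq_bigr => j' _; rewrite XT.
  have L : \sum_i \sum_j adj3 a i j * (x i * t j + t i * x j) =
      d * pair3 u t + d * pair3 v x.
    by rewrite -(adj3_trace a_sym u v) -(adj3_trace a_sym v u) -/t -/x !sum3; ring.
  have M : \sum_i \sum_j adj3 a i j * (2 * pair3 v x * a i j) =
      2 * pair3 v x * (3 * d).
    by rewrite -(adj3_trace_metric a_sym) !sum3; ring.
  have H : d * pair3 v x + d * pair3 v x = 2 * pair3 v x * (3 * d).
    by rewrite -M -E L ut.
  have : d * pair3 v x = 0 by lra.
  by move/eqP; rewrite mulf_eq0 (negbTE det_neq0) => /eqP.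
apply: (antisym_eq0 D_anti) => i'; rewrite -/u.
apply: (mulfI det_neq0); rewrite mulr0 -(adj3_mulv a_sym) -/x.
have XT0 p q : x p * t q + t p * x q = 0 by rewrite XT ut0 mulr0 mul0r.
(* By [axial_norm] the norm of the axial vector is d C, which is nonzero. *)
have [p tp] : exists p, t p != 0.
  have [//|/forallNP H] := pselect (exists p, t p != 0).
  exfalso; move/eqP: C_neq0; apply; apply: (mulfI det_neq0); rewrite mulr0 -/d -axial_norm.
  rewrite /pair3 big1 // => p _; have /negP := H p; rewrite negbK => /eqP ->.
  by rewrite mulr0.
have xp : x p = 0.
  have := XT0 p p => H; have /eqP : x p * t p = 0 by lra.
  by rewrite mulf_eq0 (negbTE tp) orbF => /eqP.
rewrite /mulv big1 // => q _.
have := XT0 p q; rewrite xp mul0r add0r => /eqP; rewrite mulf_eq0 (negbTE tp) => /eqP ->.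
by rewrite mulr0.
Qed.

End CovariantDerivative.
End UnitKilling.

(** * Ricci-flat curvature tensors vanish in dimension 3 *)

Section CurvatureDecomposition.
Context {R : realFieldType}.

(** Ten sample points separate the ten cubic monomials in three variables. *)
Lemma cubic_form_eq0 (c000 c111 c222 c001 c002 c011 c112 c022 c122 c012 : R) :
  (forall x y z : R, c000 * x ^+ 3 + c111 * y ^+ 3 + c222 * z ^+ 3
    + c001 * (x ^+ 2 * y) + c002 * (x ^+ 2 * z) + c011 * (x * y ^+ 2)
    + c112 * (y ^+ 2 * z) + c022 * (x * z ^+ 2) + c122 * (y * z ^+ 2)
    + c012 * (x * y * z) = 0) ->
  [/\ c000 = 0, c111 = 0 & c222 = 0] /\ [/\ c001 = 0, c002 = 0 & c011 = 0] /\
  [/\ c112 = 0, c022 = 0, c122 = 0 & c012 = 0].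
Proof.
move=> H.
have := H 1 0 0; have := H 0 1 0; have := H 0 0 1.
have := H 1 1 0; have := H 1 (-1) 0; have := H 1 0 1; have := H 1 0 (-1).
have := H 0 1 1; have := H 0 1 (-1); have := H 1 1 1.
rewrite !(expr0n, expr1n, mulr0, mulr1, mul0r, mul1r, addr0, add0r, sqrrN) /=.
rewrite !exprS expr0 !mulr1 !mulN1r !opprK !mulrN !mulr1 => *.
by do !split; lra.
Qed.

Lemma quadratic_form_eq0 (c00 c11 c22 c01 c02 c12 : R) :
  (forall x y z : R, c00 * x ^+ 2 + c11 * y ^+ 2 + c22 * z ^+ 2
    + c01 * (x * y) + c02 * (x * z) + c12 * (y * z) = 0) ->
  [/\ c00 = 0, c11 = 0 & c22 = 0] /\ [/\ c01 = 0, c02 = 0 & c12 = 0].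
Proof.
move=> H.
have := H 1 0 0; have := H 0 1 0; have := H 0 0 1.
have := H 1 1 0; have := H 1 0 1; have := H 0 1 1.
rewrite !(expr0n, expr1n, mulr0, mulr1, mul0r, mul1r, addr0, add0r) /= => *.
by do !split; lra.
Qed.

Variables (a : 'I_3 -> 'I_3 -> R) (c : 'I_3 -> 'I_3 -> 'I_3 -> 'I_3 -> R).
Hypothesis a_sym : forall i j, a i j = a j i.
Hypothesis det_neq0 : det3 a != 0.

Let D (y : 'I_3 -> R) i k := \sum_j \sum_l c i k j l * (y j * y l).

Hypothesis D_sym : forall y i k, D y i k = D y k i.
Hypothesis D_ker : forall y i, \sum_k D y i k * y k = 0.
Hypothesis D_trace : forall y, \sum_i \sum_k adj3 a i k * D y i k = 0.

Let p (x y z : R) (i : 'I_3) : R := match val i with 0%N => x | 1%N => y | _ => z end.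

Let s i k j l := c i k j l + c i k l j.

Let Dp i k x y z : D (p x y z) i k =
  c i k o0 o0 * x ^+ 2 + c i k o1 o1 * y ^+ 2 + c i k o2 o2 * z ^+ 2
  + s i k o0 o1 * (x * y) + s i k o0 o2 * (x * z) + s i k o1 o2 * (y * z).
Proof. by rewrite /D !sum3 /p /s /=; ring. Qed.

Let c_sym i k : [/\ c i k o0 o0 = c k i o0 o0, c i k o1 o1 = c k i o1 o1
    & c i k o2 o2 = c k i o2 o2] /\
  [/\ s i k o0 o1 = s k i o0 o1, s i k o0 o2 = s k i o0 o2
    & s i k o1 o2 = s k i o1 o2].
Proof.
have [|[h1 h2 h3] [h4 h5 h6]] := @quadratic_form_eq0
   (c i k o0 o0 - c k i o0 o0) (c i k o1 o1 - c k i o1 o1) (c i k o2 o2 - c k i o2 o2)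
   (s i k o0 o1 - s k i o0 o1) (s i k o0 o2 - s k i o0 o2) (s i k o1 o2 - s k i o1 o2).
  by move=> x y z; have := D_sym (p x y z) i k; rewrite !Dp; lra.
by do !split; apply/eqP; rewrite -subr_eq0; apply/eqP.
Qed.

Let c_ker i :
  [/\ c i o0 o0 o0 = 0, c i o1 o1 o1 = 0 & c i o2 o2 o2 = 0] /\
  [/\ s i o0 o0 o1 + c i o1 o0 o0 = 0, s i o0 o0 o2 + c i o2 o0 o0 = 0
    & s i o1 o0 o1 + c i o0 o1 o1 = 0] /\
  [/\ s i o1 o1 o2 + c i o2 o1 o1 = 0, s i o2 o0 o2 + c i o0 o2 o2 = 0,
      s i o2 o1 o2 + c i o1 o2 o2 = 0
    & s i o0 o1 o2 + s i o1 o0 o2 + s i o2 o0 o1 = 0].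
Proof.
apply: cubic_form_eq0 => x y z.
by rewrite -(D_ker (p x y z) i) sum3 !Dp /p /=; ring.
Qed.

(** Components of a symmetric form E on bivectors with D(y)_ik = E(y x e_i, y x e_k), for the
    coordinate cross product; [Dform] shows that symmetry and the kernel condition leave only these
    six numbers. *)
Let E00 := c o1 o1 o2 o2. Let E11 := c o0 o0 o2 o2. Let E22 := c o0 o0 o1 o1.
Let E12 := - s o0 o0 o1 o2 / 2. Let E02 := - s o1 o1 o0 o2 / 2.
Let E01 := - s o2 o2 o0 o1 / 2.

Let Dform x y z :
  [/\ D (p x y z) o0 o0 = E11 * z ^+ 2 - 2 * E12 * (y * z) + E22 * y ^+ 2,
      D (p x y z) o1 o1 = E00 * z ^+ 2 - 2 * E02 * (x * z) + E22 * x ^+ 2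
    & D (p x y z) o2 o2 = E00 * y ^+ 2 - 2 * E01 * (x * y) + E11 * x ^+ 2] /\
  [/\ D (p x y z) o0 o1 = - E01 * z ^+ 2 + E12 * (x * z) + E02 * (y * z) - E22 * (x * y),
      D (p x y z) o0 o2 = - E02 * y ^+ 2 + E12 * (x * y) + E01 * (y * z) - E11 * (x * z)
    & D (p x y z) o1 o2 = - E12 * x ^+ 2 + E02 * (x * y) + E01 * (x * z) - E00 * (y * z)].
Proof.
rewrite !Dp.
have [[a1 a2 a3] [[a4 a5 a6] [a7 a8 a9 a10]]] := c_ker o0.
have [[b1 b2 b3] [[b4 b5 b6] [b7 b8 b9 b10]]] := c_ker o1.
have [[d1 d2 d3] [[d4 d5 d6] [d7 d8 d9 d10]]] := c_ker o2.
have [[e1 e2 e3] [e4 e5 e6]] := c_sym o0 o1.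
have [[f1 f2 f3] [f4 f5 f6]] := c_sym o0 o2.
have [[g1 g2 g3] [g4 g5 g6]] := c_sym o1 o2.
rewrite /E00 /E11 /E22 /E12 /E02 /E01.
have lin (u1 u2 u3 u4 u5 u6 w1 w2 w3 w4 w5 w6 : R) : u1 = w1 -> u2 = w2 -> u3 = w3 ->
   u4 = w4 -> u5 = w5 -> u6 = w6 ->
   u1 * x ^+ 2 + u2 * y ^+ 2 + u3 * z ^+ 2 + u4 * (x * y) + u5 * (x * z) + u6 * (y * z) =
   w1 * x ^+ 2 + w2 * y ^+ 2 + w3 * z ^+ 2 + w4 * (x * y) + w5 * (x * z) + w6 * (y * z).
  by move=> -> -> -> -> -> ->.
split; split.
- rewrite (lin _ _ _ _ _ _ 0 (c o0 o0 o1 o1) (c o0 o0 o2 o2) 0 0 (s o0 o0 o1 o2)); [by field|lra..].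
- rewrite (lin _ _ _ _ _ _ (c o0 o0 o1 o1) 0 (c o1 o1 o2 o2) 0 (s o1 o1 o0 o2) 0); [by field|lra..].
- rewrite (lin _ _ _ _ _ _ (c o0 o0 o2 o2) (c o1 o1 o2 o2) 0 (s o2 o2 o0 o1) 0 0); [by field|lra..].
- rewrite (lin _ _ _ _ _ _ 0 0 (s o2 o2 o0 o1 / 2) (- c o0 o0 o1 o1) (- s o0 o0 o1 o2 / 2) (- s o1 o1 o0 o2 / 2)); [by field|lra..].
- rewrite (lin _ _ _ _ _ _ 0 (s o1 o1 o0 o2 / 2) 0 (- s o0 o0 o1 o2 / 2) (- c o0 o0 o2 o2) (- s o2 o2 o0 o1 / 2)); [by field|lra..].
- rewrite (lin _ _ _ _ _ _ (s o0 o0 o1 o2 / 2) 0 0 (- s o1 o1 o0 o2 / 2) (- s o2 o2 o0 o1 / 2) (- c o1 o1 o2 o2)); [by field|lra..].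
Qed.

Let E (i j : 'I_3) : R :=
  match val i, val j with
  | 0%N, 0%N => E00 | 0%N, 1%N => E01 | 0%N, _ => E02
  | 1%N, 0%N => E01 | 1%N, 1%N => E11 | 1%N, _ => E12
  | _, 0%N => E02 | _, 1%N => E12 | _, _ => E22
  end.

Let trE := \sum_i \sum_j a i j * E i j.
Let aEa i j := \sum_k \sum_l a i k * E k l * a l j.

(** Contracting [Dform] with the adjugate turns the trace condition into the vanishing of the
    quadratic form tr(aE) a - aEa in y, hence of its coefficients. *)
Let trace_eq i j : trE * a i j - aEa i j = 0.
Proof.
have [|[h1 h2 h3] [h4 h5 h6]] := @quadratic_form_eq0
  (trE * a o0 o0 - aEa o0 o0) (trE * a o1 o1 - aEa o1 o1) (trE * a o2 o2 - aEa o2 o2)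
  (2 * (trE * a o0 o1 - aEa o0 o1)) (2 * (trE * a o0 o2 - aEa o0 o2))
  (2 * (trE * a o1 o2 - aEa o1 o2)).
  move=> x y z; rewrite -[RHS](D_trace (p x y z)) !sum3.
  have [[H00 H11 H22] [H01 H02 H12]] := Dform x y z.
  rewrite (D_sym _ o1 o0) (D_sym _ o2 o0) (D_sym _ o2 o1) H00 H11 H22 H01 H02 H12.
  rewrite /trE /aEa !sum3 /E /= /adj3 /= !(a_sym o1 o0) !(a_sym o2 o0) !(a_sym o2 o1).
  by ring.
have aEa_sym i' j' : aEa i' j' = aEa j' i'.
  by rewrite /aEa !sum3 /E /= !(a_sym _ i') !(a_sym _ j'); ring.
by cases3 i; cases3 j; rewrite ?(a_sym o1 o0) ?(a_sym o2 o0) ?(a_sym o2 o1)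
  ?(aEa_sym o1 o0) ?(aEa_sym o2 o0) ?(aEa_sym o2 o1) //; lra.
Qed.

(** A second trace gives 2 det(a) tr(aE) = 0, hence aEa = 0, and [a] is invertible. *)
Let E_eq0 i j : E i j = 0.
Proof.
have tr0 : trE = 0.
  have H : \sum_i \sum_j adj3 a i j * (trE * a i j - aEa i j) = 0.
    by apply: big1 => k _; apply: big1 => l _; rewrite trace_eq mulr0.
  have : \sum_i \sum_j adj3 a i j * (trE * a i j - aEa i j) = 2 * (det3 a * trE).
    rewrite /trE /aEa !sum3 /E /= /adj3 /det3 /adj3 /= !(a_sym o1 o0) !(a_sym o2 o0) !(a_sym o2 o1).
    by ring.
  rewrite H => /esym/eqP; rewrite mulf_eq0 pnatr_eq0 /= mulf_eq0 (negbTE det_neq0).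
  by move/eqP.
have aE k l : aEa k l = 0 by have := trace_eq k l; rewrite tr0; lra.
have H k l : \sum_m E k m * a m l = 0.
  apply: (mulfI det_neq0); rewrite mulr0.
  rewrite -(adj3_mulv a_sym (fun k => \sum_m E k m * a m l)) /mulv big1 // => q _.
  suff -> : \sum_j a q j * \sum_m E j m * a m l = aEa q l by rewrite aE mulr0.
  by rewrite /aEa; apply: eq_bigr => j' _; rewrite mulr_sumr; apply: eq_bigr => m _; rewrite mulrA.
apply: (mulfI det_neq0); rewrite mulr0 -(adj3_mulv a_sym (fun j => E i j)) /mulv big1 // => q _.
suff -> : \sum_l a q l * E i l = \sum_m E i m * a m q by rewrite H mulr0.
by apply: eq_bigr => l _; rewrite mulrC a_sym.
Qed.

(** This is the vanishing of the Weyl tensor in dimension 3: curvature is a symmetric form on the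
    3-dimensional space of bivectors, and such a form is determined by its Ricci contraction. *)
Lemma curvature_form_eq0 (y : 'I_3 -> R) i k : D y i k = 0.
Proof.
have -> : D y i k = D (p (y o0) (y o1) (y o2)) i k by rewrite /D !sum3 /p.
have [[H00 H11 H22] [H01 H02 H12]] := Dform (y o0) (y o1) (y o2).
have e00 : E00 = 0 := E_eq0 o0 o0. have e11 : E11 = 0 := E_eq0 o1 o1.
have e22 : E22 = 0 := E_eq0 o2 o2. have e01 : E01 = 0 := E_eq0 o0 o1.
have e02 : E02 = 0 := E_eq0 o0 o2. have e12 : E12 = 0 := E_eq0 o1 o2.
move: H00 H11 H22 H01 H02 H12; rewrite e00 e11 e22 e01 e02 e12.
rewrite !(mulr0, mul0r, addr0, oppr0) => H00 H11 H22 H01 H02 H12.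
by cases3 i; cases3 k; rewrite // D_sym.
Qed.

End CurvatureDecomposition.

(** * Curvature of the spray Gbar + P u, as an algebraic identity at one point *)

Section PerturbedSpray.
Context {R : realFieldType}.
Variables (Gam Z : 'I_3 -> 'I_3 -> 'I_3 -> R) (a s S : 'I_3 -> 'I_3 -> R).
Variables (b bu y : 'I_3 -> R) (P Pq Pb Pqk Pbk C : R) (i k : 'I_3).
Hypothesis Gam_sym : forall l m n, Gam l m n = Gam l n m.
Hypothesis a_sym : forall m n, a m n = a n m.

Let yl := mulv a y.
Let u := mulv s y.
Let So m := \sum_n S n m * y n.
Let N m n := \sum_l Gam m n l * y l.
Let g m := 2^-1 * \sum_n N m n * y n.
Let dq m := 2 * \sum_n yl n * N n m.
Let db m := So m + \sum_n b n * N n m.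
Let ddq m := 2 * \sum_n (a k n * N n m + yl n * Gam n k m).
Let ddb m := S k m + \sum_n Gam n k m * b n.
Let Z0 m n := \sum_l Z m l n * y l.
Let du m n := Z0 m n - \sum_l Gam m l n * u l + \sum_l N l n * s m l.
Let ds m := Z i k m - \sum_l Gam i l m * s l k + \sum_l Gam l k m * s i l.
Let Py m := 2 * Pq * yl m + Pb * b m.
Let Pyk m := 2 * (Pqk * yl m + Pq * a m k) + Pbk * b m.
Let T m := P * u m.
Let Tx m n := (Pq * dq n + Pb * db n) * u m + P * du m n.
Let Ty m n := Py n * u m + P * s m n.
Let Txk m := (Pqk * dq m + Pq * ddq m + (Pbk * db m + Pb * ddb m)) * u i
  + (Pq * dq m + Pb * db m) * s i k + (Py k * du i m + P * ds m).
Let Tyk m := Pyk m * u i + Py m * s i k + (Py k * s i m).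

(** The local definitions are the coordinate derivatives of alpha^2, beta, s^i_0 and P, written with
    Christoffel symbols. In the part of the curvature linear in T = P u all terms with [Gam] cancel,
    as covariance demands, and so do those with [Pqk], since alpha is constant along its own
    geodesics. *)
Lemma spray_linear_part :
  2 * Tx i k - \sum_m Txk m * y m + 2 * \sum_m (g m * Tyk m + T m * Gam i m k)
  - \sum_m (N i m * Ty m k + Ty i m * N m k) =
  2 * (Pb * So k * u i + P * Z0 i k)
  - (Pbk * (\sum_m y m * So m) + Pb * \sum_m y m * S k m) * u i
  - Pb * (\sum_m y m * So m) * s i k
  - Py k * (\sum_m y m * Z0 i m) - P * \sum_m y m * Z i k m.
Proof.
rewrite /Tx /Txk /Tyk /Ty /T /Pyk /Py /du /ds /ddq /ddb /dq /db /g.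
move: u yl So Z0 => u' yl' So' Z0'.
rewrite /N !sum3.
rewrite !(Gam_sym _ o1 o0) !(Gam_sym _ o2 o0) !(Gam_sym _ o2 o1) !(Gam_sym _ _ k).
rewrite !(a_sym _ k).
by field.
Qed.

Hypothesis S_anti : forall m n, S m n = - S n m.
Hypothesis as_S : forall m n, \sum_l a m l * s l n = S m n.
Hypothesis b_s : forall n, \sum_m b m * s m n = 0.
Hypothesis s_s : forall m n,
  \sum_l s m l * s l n = - (C * (m == n)%:R - bu m * b n).
Hypothesis Z_eq : forall m n l, Z m n l = (m == l)%:R * b n - a n l * bu m.

Let q := pair3 y yl.
Let be := pair3 b y.

Let au m : \sum_l a m l * u l = mulv S y m.
Proof. by rewrite /u /mulv -(eq_bigr _ (fun n _ => congr1 ( *%R^~ _) (as_S m n))) !sum3; ring. Qed.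

Let So_S m : So m = - mulv S y m.
Proof. by rewrite /So /mulv !sum3 !(S_anti _ m) ; ring. Qed.

Let y_So : \sum_m y m * So m = 0.
Proof.
have S0 := antisym_zero S_anti.
by rewrite /So !sum3 !S0 (S_anti o1 o0) (S_anti o2 o0) (S_anti o2 o1); ring.
Qed.

Let yl_s n : \sum_m yl m * s m n = So n.
Proof.
rewrite /yl /So /mulv; under [RHS]eq_bigr do rewrite -as_S.
by rewrite !sum3 (a_sym o1 o0) (a_sym o2 o0) (a_sym o2 o1); ring.
Qed.

Let yl_u : \sum_m yl m * u m = 0.
Proof.
have -> : \sum_m yl m * u m = \sum_n y n * \sum_m yl m * s m n.
  by rewrite /u /mulv !sum3; ring.
by under eq_bigr do rewrite yl_s; exact: y_So.
Qed.

Let b_u : \sum_m b m * u m = 0.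
Proof.
have -> : \sum_m b m * u m = \sum_n y n * \sum_m b m * s m n.
  by rewrite /u /mulv !sum3; ring.
by apply: big1 => n _; rewrite b_s mulr0.
Qed.

Let s_u m : \sum_l s m l * u l = - (C * y m - be * bu m).
Proof.
have -> : \sum_l s m l * u l = \sum_n y n * \sum_l s m l * s l n.
  by rewrite /u /mulv !sum3; ring.
under eq_bigr do rewrite s_s.
by rewrite /be /pair3 !sum3; cases3 m => /=; ring.
Qed.

(** The terms quadratic in T reduce because u is orthogonal to y and to b^# while s u is known from
    [s_s]; the covariant derivatives are eliminated by [Z_eq]. No second derivative of P remains. *)
Lemma spray_curvature :
  2 * Tx i k - \sum_m Txk m * y m
  + 2 * \sum_m (g m * Tyk m + T m * Gam i m k + T m * Tyk m)
  - \sum_m (N i m * Ty m k + Ty i m * N m k + Ty i m * Ty m k) =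
  3 * (2 * P * Pq - Pb) * mulv S y k * u i
  + P * (2 * be * (i == k)%:R - yl k * bu i - y i * b k)
  - Py k * (be * y i - q * bu i)
  - P * Py k * (C * y i - be * bu i) + P ^+ 2 * (C * (i == k)%:R - bu i * b k).
Proof.
rewrite (big_split _ _ _ _ (fun m => T m * Tyk m)) /=.
rewrite (big_split _ _ _ _ (fun m => Ty i m * Ty m k)) /=.
have TT : \sum_m T m * Tyk m =
    P * (2 * Pq * mulv S y k * u i + Py k * - (C * y i - be * bu i)).
  rewrite -s_u -au.
  transitivity (P * ((2 * Pqk * (\sum_m yl m * u m) + 2 * Pq * (\sum_l a k l * u l) +
       Pbk * \sum_m b m * u m) * u i
    + (2 * Pq * (\sum_m yl m * u m) + Pb * \sum_m b m * u m) * s i k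
    + Py k * \sum_l s i l * u l)).
    rewrite /T /Tyk /Pyk; have -> : Py = fun m => 2 * Pq * yl m + Pb * b m by [].
    by move: u yl => u' yl'; rewrite !sum3 !(a_sym _ k); ring.
  by rewrite yl_u b_u; ring.
have TyTy : \sum_m Ty i m * Ty m k =
    2 * P * Pq * So k * u i + P * Py k * - (C * y i - be * bu i)
    + P ^+ 2 * - (C * (i == k)%:R - bu i * b k).
  rewrite -s_u -s_s -yl_s.
  transitivity ((2 * Pq * (\sum_m yl m * u m) + Pb * \sum_m b m * u m) * Py k * u i
    + P * (2 * Pq * (\sum_m yl m * s m k) + Pb * \sum_m b m * s m k) * u i
    + P * Py k * (\sum_l s i l * u l) + P ^+ 2 * \sum_l s i l * s l k).
    rewrite /Ty; move: (Py k) => Pk; have -> : Py = fun m => 2 * Pq * yl m + Pb * b m by [].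
    by move: u yl => u' yl'; rewrite !sum3; ring.
  by rewrite yl_u b_u b_s; ring.
have Zy : \sum_m y m * Z0 i m = be * y i - q * bu i.
  rewrite /Z0 /be /q /yl /pair3 /mulv; under eq_bigr do under eq_bigr do rewrite Z_eq.
  by rewrite !sum3 (a_sym o1 o0) (a_sym o2 o0) (a_sym o2 o1); cases3 i => /=; ring.
have Zk : Z0 i k = be * (i == k)%:R - yl k * bu i.
  rewrite /Z0 /be /yl /pair3 /mulv; under eq_bigr do rewrite Z_eq.
  by rewrite !sum3 !(a_sym _ k); ring.
have Zky : \sum_m y m * Z i k m = y i * b k - yl k * bu i.
  under eq_bigr do rewrite Z_eq.
  by rewrite /yl /mulv !sum3; cases3 i => /=; ring.
have Sky : \sum_m y m * S k m = mulv S y k by rewrite /mulv !sum3; ring.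
have L := spray_linear_part.
rewrite Zy Zk Zky Sky y_So in L.
rewrite TT TyTy So_S.
have E (l1 l2 l3 l4 r x1 x2 : R) : l1 - l2 + 2 * l3 - l4 = r ->
   l1 - l2 + 2 * (l3 + x1) - (l4 + x2) = r + 2 * x1 - x2 by move=> <-; ring.
rewrite (E _ _ _ _ _ _ _ L) So_S; ring.
Qed.

End PerturbedSpray.

(** * Sprays in coordinates *)

Local Opaque pd.

Section LinearForms.
Context {R : realType}.
Implicit Types (y : 'rV[R]_3) (c : 'I_3 -> R).

Lemma sum_delta i (f : 'I_3 -> R) : \sum_m (i == m)%:R * f m = f i.
Proof.
rewrite (bigD1 i) //= eqxx mul1r big1 ?addr0 // => m /negbTE; rewrite eq_sym => ->.
by rewrite mul0r.
Qed.

Lemma der_mul {V : normedModType R} (f g : V -> R) z v (df dg d : R) :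
  is_derive z v f df -> is_derive z v g dg -> df * g z + f z * dg = d ->
  is_derive z v (fun w => f w * g w) d.
Proof. by move=> hf hg <-; exact: derM. Qed.

Lemma der_scale {V : normedModType R} (c : R) (f : V -> R) z v (df : R) :
  is_derive z v f df -> is_derive z v (fun w => c * f w) (c * df).
Proof. by move=> hf; apply: der_mul (derC c z v) hf _; rewrite mul0r add0r. Qed.

Lemma der_scaler {V : normedModType R} (c : R) (f : V -> R) z v (df : R) :
  is_derive z v f df -> is_derive z v (fun w => f w * c) (df * c).
Proof. by move=> hf; apply: der_mul hf (derC c z v) _; rewrite mulr0 addr0. Qed.

Lemma der_lin c y k :
  is_derive y (delta_mx ord0 k) (fun z : 'rV[R]_3 => \sum_j c j * z ord0 j) (c k).
Proof.
apply: (@derE _ _ _ _ _ (\sum_j c j * (j == k)%:R)).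
  by apply: der_sum => j; apply: der_scale; exact: der_coord.
by under eq_bigr do rewrite mulrC eq_sym; exact: sum_delta.
Qed.

Lemma der_quad (M : 'I_3 -> 'I_3 -> R) y k :
  is_derive y (delta_mx ord0 k) (fun z : 'rV[R]_3 => \sum_n (\sum_l M n l * z ord0 l) * z ord0 n)
   (\sum_n (M k n + M n k) * y ord0 n).
Proof.
apply: (@derE _ _ _ _ _ (\sum_n (M n k * y ord0 n + (\sum_l M n l * y ord0 l) * (n == k)%:R))).
  by apply: der_sum => n; apply: derM; [exact: der_lin|exact: der_coord].
by rewrite !sum3; cases3 k => /=; ring.
Qed.

End LinearForms.

Section Coordinates.
Context {R : realType}.
Variables (a : 'rV[R]_3 -> 'M[R]_3) (b : 'rV[R]_3 -> 'rV[R]_3).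
Implicit Types (x y : 'rV[R]_3) (i j k l m n : 'I_3).

Hypothesis a_smooth : forall i j, smooth (fun x => a x i j).
Hypothesis a_sym : forall x i j, a x i j = a x j i.
Hypothesis a_unit : forall x, a x \in unitmx.
Hypothesis b_smooth : forall i, smooth (fun x => b x ord0 i).

Local Notation e k := (delta_mx ord0 k).
Local Notation Gam := (christoffel a).
Local Notation "'da' k i j x" := (pd k (fun z => a z i j) x)
  (at level 10, k, i, j, x at level 9).
Local Notation s := (s_up a b).
Local Notation S := (s_form a b).

Lemma invmx_sum x i j : \sum_l a x i l * invmx (a x) l j = (i == j)%:R.
Proof. by have := mulmxV (a_unit x) => /matrixP/(_ i j); rewrite !mxE. Qed.

Lemma invmx_sum' x i j : \sum_l invmx (a x) i l * a x l j = (i == j)%:R.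
Proof. by have := mulVmx (a_unit x) => /matrixP/(_ i j); rewrite !mxE. Qed.

Lemma christoffel_sym x i j k : Gam i j k x = Gam i k j x.
Proof.
rewrite /christoffel; congr (_ * _); apply: eq_bigr => l _; congr (_ * _).
rewrite [pd k _ x + _]addrC; congr (_ + _ - _).
by congr (pd l _ x); apply/funext => z; rewrite a_sym.
Qed.

Lemma christoffel_lower x i j k :
  \sum_l a x i l * Gam l j k x = 2^-1 * (da j i k x + da k i j x - da i j k x).
Proof.
have E (c : R) (f : 'I_3 -> R) :
  \sum_l a x i l * (c * \sum_m invmx (a x) l m * f m) =
  c * \sum_m (\sum_l a x i l * invmx (a x) l m) * f m by rewrite !sum3; ring.
rewrite /christoffel E; under eq_bigr do rewrite invmx_sum.
by rewrite sum_delta.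
Qed.

(** Metric compatibility of the Levi-Civita connection, through which first derivatives of [a] are
    traded for Christoffel symbols. *)
Lemma pd_metric x i j k :
  da k i j x = \sum_l (a x i l * Gam l j k x + a x j l * Gam l i k x).
Proof.
rewrite big_split /= !christoffel_lower.
have -> : (fun z => a z j k) = (fun z => a z k j) by apply/funext => z; exact: a_sym.
have -> : (fun z => a z j i) = (fun z => a z i j) by apply/funext => z; exact: a_sym.
have -> : (fun z => a z i k) = (fun z => a z k i) by apply/funext => z; exact: a_sym.
by field.
Qed.

Lemma christoffel_smooth i j k : smooth (Gam i j k).
Proof.
apply: smoothM; first exact: smooth_cst.
apply: smooth_sum => l _; apply: smoothM; first exact: smooth_invmx.
by apply: smoothD; [apply: smoothD|apply: smoothN]; exact: smooth_pd.
Qed.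

Lemma cov_form_smooth i j : smooth (cov_form a b i j).
Proof.
apply: smoothD; first exact: smooth_pd.
apply: smoothN; apply: smooth_sum => k _; apply: smoothM => //; exact: christoffel_smooth.
Qed.

Lemma cov_formE i j x : cov_form a b i j x =
  pd j (fun z => b z ord0 i) x - \sum_k Gam k i j x * b x ord0 k.
Proof. by []. Qed.

Local Opaque cov_form christoffel.

Lemma s_form_smooth i j : smooth (fun x => S x i j).
Proof.
apply: (@smooth_ext _ _ (fun x => 2^-1 * (cov_form a b i j x - cov_form a b j i x))).
  by move=> x; rewrite mxE.
apply: smoothM; first exact: smooth_cst.
by apply: smoothD; [|apply: smoothN]; exact: cov_form_smooth.
Qed.

Lemma s_up_smooth i j : smooth (fun x => s x i j).
Proof.
apply: (@smooth_ext _ _ (fun x => \sum_l invmx (a x) i l * S x l j)).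
  by move=> x; rewrite mxE.
by apply: smooth_sum => l _; apply: smoothM; [exact: smooth_invmx|exact: s_form_smooth].
Qed.

Lemma s_form_anti x i j : S x i j = - S x j i.
Proof.
have E (u v : R) : 2^-1 * (u - v) = - (2^-1 * (v - u)) by ring.
by rewrite mxE [in RHS]mxE; exact: E.
Qed.

Lemma s_up_lower x i j : \sum_l a x i l * s x l j = S x i j.
Proof.
have E : a x *m s x = S x by rewrite /s_up mulmxA mulmxV // mul1mx.
have /matrixP/(_ i j) := E; rewrite [X in X = _ -> _]mxE => <-.
by [].
Qed.

Local Opaque s_form s_up.

Definition spray i x y : R :=
  2^-1 * \sum_n (\sum_l Gam i n l x * y ord0 l) * y ord0 n.

Definition spray_dy i x y n : R := \sum_l Gam i n l x * y ord0 l.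

Lemma spray_dyE i x y n : spray_dy i x y n = \sum_l Gam i l n x * y ord0 l.
Proof. by apply: eq_bigr => l _; rewrite christoffel_sym. Qed.

Definition spray_dx i x y k : R :=
  2^-1 * \sum_n (\sum_l pd k (Gam i n l) x * y ord0 l) * y ord0 n.

Lemma der_spray_y i x y k : is_derive y (e k) (spray i x) (spray_dy i x y k).
Proof.
apply: derE; first by apply: der_scale; exact: der_quad.
rewrite /spray_dy !sum3 !(christoffel_sym _ _ o0 k) !(christoffel_sym _ _ o1 k) !(christoffel_sym _ _ o2 k).
by field.
Qed.

Lemma der_spray_dy i x y n k :
  is_derive y (e k) (fun y => spray_dy i x y n) (Gam i n k x).
Proof. exact: der_lin. Qed.

Lemma der_spray_x i x y k :
  is_derive x (e k) (fun x => spray i x y) (spray_dx i x y k).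
Proof.
apply: der_scale; apply: der_sum => n; apply: der_scaler; apply: der_sum => l.
by apply: der_scaler; apply: der_pd; exact: christoffel_smooth.
Qed.

Lemma der_spray_dx i x y m k :
  is_derive y (e k) (fun y => spray_dx i x y m)
   (2^-1 * \sum_n (pd m (Gam i k n) x + pd m (Gam i n k) x) * y ord0 n).
Proof. by apply: der_scale; exact: der_quad. Qed.

(** What [riemann_curv] becomes for the quadratic spray of [a], with the derivatives carried out; it
    is the reference curvature against which that of [F] is expressed. *)
Definition spray_riemann i k x y : R :=
  2 * spray_dx i x y k
  - \sum_m 2^-1 * (\sum_n (pd m (Gam i k n) x + pd m (Gam i n k) x) * y ord0 n) * y ord0 m
  + 2 * \sum_m spray m x y * Gam i m k x
  - \sum_m spray_dy i x y m * spray_dy m x y k.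

Local Notation q x y := (pair3 (y ord0) (mulv (a x) (y ord0))).
Local Notation be x y := (pair3 (b x ord0) (y ord0)).
Local Notation U i x y := (mulv (s x) (y ord0) i).

Lemma der_q_y x y k : is_derive y (e k) (fun y => q x y) (2 * mulv (a x) (y ord0) k).
Proof.
apply: (@der_ext _ _ (fun y => \sum_n (\sum_l a x n l * y ord0 l) * y ord0 n)).
  by move=> w; apply: eq_bigr => n _; rewrite mulrC.
apply: derE; first exact: der_quad.
by rewrite /mulv !sum3 !(a_sym x _ k); ring.
Qed.

Lemma der_be_y x y k : is_derive y (e k) (fun y => be x y) (b x ord0 k).
Proof. exact: der_lin. Qed.

Lemma der_low_y x y i k :
  is_derive y (e k) (fun y => mulv (a x) (y ord0) i) (a x i k).
Proof. exact: der_lin. Qed.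

Definition q_dx x y k : R :=
  2 * \sum_n mulv (a x) (y ord0) n * spray_dy n x y k.

(** By metric compatibility only the connection [spray_dy] enters: the horizontal derivative of
    alpha vanishes. *)
Lemma der_q_x x y k : is_derive x (e k) (fun x => q x y) (q_dx x y k).
Proof.
apply: (@derE _ _ _ _ _ (\sum_i y ord0 i * \sum_j da k i j x * y ord0 j)).
  apply: der_sum => i; apply: der_scale; apply: der_sum => j; apply: der_scaler.
  by apply: der_pd; exact: a_smooth.
under eq_bigr do under eq_bigr do rewrite pd_metric.
rewrite /q_dx; under [in RHS]eq_bigr do rewrite spray_dyE.
have E (A G : 'I_3 -> 'I_3 -> R) (w : 'I_3 -> R) : (forall m n, A m n = A n m) ->
    \sum_m w m * (\sum_n (\sum_l (A m l * G l n + A n l * G l m)) * w n) =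
    2 * \sum_n mulv A w n * \sum_l G n l * w l.
  by move=> A_sym; rewrite /mulv !sum3 (A_sym o1 o0) (A_sym o2 o0) (A_sym o2 o1); ring.
exact: (E (a x) (fun l n => Gam l n k x) (y ord0) (a_sym x)).
Qed.

Section Killing.
Hypothesis killing : forall x, r_form a b x = 0.

Lemma killing_cov x i j : cov_form a b i j x = S x i j.
Proof.
have := killing x => /matrixP/(_ i j); rewrite mxE [RHS]mxE => H.
rewrite mxE; move: (cov_form a b i j x) (cov_form a b j i x) H => u v; lra.
Qed.

Lemma pd_form x i j : pd j (fun z => b z ord0 i) x = S x i j + \sum_n Gam n i j x * b x ord0 n.
Proof. by rewrite -killing_cov cov_formE; ring. Qed.

Definition be_dx x y k : R :=
  (\sum_n S x n k * y ord0 n) + \sum_n b x ord0 n * spray_dy n x y k.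

Lemma der_be_x x y k : is_derive x (e k) (fun x => be x y) (be_dx x y k).
Proof.
apply: (@derE _ _ _ _ _ (\sum_i pd k (fun z => b z ord0 i) x * y ord0 i)).
  by apply: der_sum => i; apply: der_scaler; apply: der_pd; exact: b_smooth.
under eq_bigr do rewrite pd_form.
rewrite /be_dx; under [X in _ = _ + X]eq_bigr do rewrite spray_dyE.
have E (T G : 'I_3 -> 'I_3 -> R) (c w : 'I_3 -> R) :
    \sum_i (T i k + \sum_n G n i * c n) * w i =
    \sum_n T n k * w n + \sum_n c n * \sum_l G n l * w l by rewrite !sum3; ring.
exact: (E (S x) (fun l n => Gam l n k x)).
Qed.

(** The coordinate derivative of s^m_0, split into its covariant derivative and connection terms so
    as to match the shape required by [spray_curvature]. *)
Definition U_dx m x y k : R :=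
  (\sum_l cov_s_up a b m l k x * y ord0 l) - \sum_l Gam m l k x * U l x y
  + \sum_l spray_dy l x y k * s x m l.

Lemma pd_s_up x m j k : pd k (fun z => s z m j) x =
  cov_s_up a b m j k x - \sum_l Gam m l k x * s x l j + \sum_l Gam l j k x * s x m l.
Proof. by rewrite /cov_s_up; ring. Qed.

Lemma der_U_x m x y k : is_derive x (e k) (fun x => U m x y) (U_dx m x y k).
Proof.
apply: (@derE _ _ _ _ _ (\sum_i pd k (fun z => s z m i) x * y ord0 i)).
  by apply: der_sum => i; apply: der_scaler; apply: der_pd; exact: s_up_smooth.
under eq_bigr do rewrite pd_s_up.
rewrite /U_dx; under [X in _ = _ + X]eq_bigr do rewrite spray_dyE.
have E (Z : 'I_3 -> R) (G T : 'I_3 -> 'I_3 -> R) (w : 'I_3 -> R) :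
    \sum_i (Z i - \sum_l G m l * T l i + \sum_l G l i * T m l) * w i =
    \sum_l Z l * w l - \sum_l G m l * mulv T w l
    + \sum_l (\sum_n G l n * w n) * T m l by rewrite /mulv !sum3; ring.
exact: (E (fun i => cov_s_up a b m i k x) (fun l n => Gam l n k x) (s x)).
Qed.

Lemma der_q_dx x y m k : is_derive y (e k) (fun y => q_dx x y m)
  (2 * \sum_n (a x k n * spray_dy n x y m + mulv (a x) (y ord0) n * Gam n k m x)).
Proof.
apply: der_scale; apply: der_sum => n; apply: der_mul.
- exact: der_low_y.
- exact: der_spray_dy.
- by rewrite a_sym christoffel_sym.
Qed.

Lemma der_be_dx x y m k : is_derive y (e k) (fun y => be_dx x y m)
  (S x k m + \sum_n Gam n k m x * b x ord0 n).
Proof.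
apply: derD; first exact: der_lin.
apply: der_sum => n; rewrite mulrC christoffel_sym; apply: der_scale; exact: der_spray_dy.
Qed.

Lemma der_U_dx x y i m k : is_derive y (e k) (fun y => U_dx i x y m)
  (cov_s_up a b i k m x - \sum_l Gam i l m x * s x l k + \sum_l Gam l k m x * s x i l).
Proof.
apply: derD; first apply: derB; first exact: der_lin.
  by apply: der_sum => l; apply: der_scale; exact: der_lin.
apply: der_sum => l; rewrite christoffel_sym; apply: der_scaler; exact: der_spray_dy.
Qed.

End Killing.
End Coordinates.

Local Transparent pd cov_form christoffel s_form s_up.

(** * From the perturbed spray to [riemann_curv] *)

Section PerturbedCoordinates.
Context {R : realType}.
Variables (a : 'rV[R]_3 -> 'M[R]_3) (b : 'rV[R]_3 -> 'rV[R]_3).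
Implicit Types (x y : 'rV[R]_3) (i j k l m n : 'I_3).

Hypothesis a_smooth : forall i j, smooth (fun x => a x i j).
Hypothesis a_sym : forall x i j, a x i j = a x j i.
Hypothesis a_unit : forall x, a x \in unitmx.
Hypothesis b_smooth : forall i, smooth (fun x => b x ord0 i).

Local Notation e k := (delta_mx ord0 k).
Local Notation Gam := (christoffel a).
Local Notation s := (s_up a b).
Local Notation S := (s_form a b).
Local Notation q x y := (pair3 (y ord0) (mulv (a x) (y ord0))).
Local Notation be x y := (pair3 (b x ord0) (y ord0)).
Local Notation low x y i := (mulv (a x) (y ord0) i).
Local Notation U i x y := (mulv (s x) (y ord0) i).

Variables (F P Pq Pb : 'rV[R]_3 -> 'rV[R]_3 -> R)
  (Pqy Pby : 'I_3 -> 'rV[R]_3 -> 'rV[R]_3 -> R) (good : 'rV[R]_3 -> 'rV[R]_3 -> Prop).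

Definition P_dy k x y : R := 2 * Pq x y * low x y k + Pb x y * b x ord0 k.

Hypothesis good_x : forall x y, good x y -> \forall z \near x, good z y.
Hypothesis good_y : forall x y, good x y -> \forall z \near y, good x z.
Hypothesis F_spray : forall x y i, good x y ->
  geodesic_coef F i x y = spray a i x y + P x y * U i x y.
Hypothesis der_P_x : forall x y k, good x y -> is_derive x (e k)
  (fun x => P x y) (Pq x y * q_dx a x y k + Pb x y * be_dx a b x y k).
Hypothesis der_P_y : forall x y k, good x y -> is_derive y (e k) (P x) (P_dy k x y).
Hypothesis der_Pq_y : forall x y k, good x y -> is_derive y (e k) (Pq x) (Pqy k x y).
Hypothesis der_Pb_y : forall x y k, good x y -> is_derive y (e k) (Pb x) (Pby k x y).

Let Tx i x y k : R :=
  (Pq x y * q_dx a x y k + Pb x y * be_dx a b x y k) * U i x y + P x y * U_dx a b i x y k.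
Let Ty i x y k : R := P_dy k x y * U i x y + P x y * s x i k.

(** [good] is open in each variable, so the formula [F_spray] holds near the point and passes to the
    derivative. *)
Lemma geodesic_dx i x y k : good x y ->
  dx k (geodesic_coef F i) x y = spray_dx a i x y k + Tx i x y k.
Proof.
move=> gxy; apply: der_val.
apply: (@der_eq _ _ (fun x => spray a i x y + P x y * U i x y)).
  by apply: filterS (good_x gxy) => z gzy; rewrite F_spray.
apply: derD; first by apply: der_spray_x.
by apply: der_mul; [by apply: der_P_x|by apply: der_U_x|by []].
Qed.

Lemma geodesic_dy i x y k : good x y ->
  dy k (geodesic_coef F i) x y = spray_dy a i x y k + Ty i x y k.
Proof.
move=> gxy; apply: der_val.
apply: (@der_eq _ _ (fun y => spray a i x y + P x y * U i x y)).
  by apply: filterS (good_y gxy) => z gxz; rewrite F_spray.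
apply: derD; first by apply: der_spray_y.
by apply: der_mul; [by apply: der_P_y|by apply: der_lin|by []].
Qed.

Lemma geodesic_dxdy i x y m k : good x y ->
  dy k (dx m (geodesic_coef F i)) x y =
  2^-1 * (\sum_n (pd m (Gam i k n) x + pd m (Gam i n k) x) * y ord0 n) +
  ((Pqy k x y * q_dx a x y m
    + Pq x y * (2 * \sum_n (a x k n * spray_dy a n x y m + low x y n * Gam n k m x))
    + (Pby k x y * be_dx a b x y m
       + Pb x y * (S x k m + \sum_n Gam n k m x * b x ord0 n))) * U i x y
   + (Pq x y * q_dx a x y m + Pb x y * be_dx a b x y m) * s x i k
   + (P_dy k x y * U_dx a b i x y m
      + P x y * (cov_s_up a b i k m x - \sum_l Gam i l m x * s x l k
                 + \sum_l Gam l k m x * s x i l))).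
Proof.
move=> gxy; apply: der_val.
apply: (@der_eq _ _ (fun y => spray_dx a i x y m + Tx i x y m)).
  by apply: filterS (good_y gxy) => z gxz; rewrite geodesic_dx.
apply: derD; first by apply: der_spray_dx.
apply: derD; last first.
  by apply: der_mul; [by apply: der_P_y|by apply: der_U_dx|by []].
apply: der_mul; [|exact: der_lin|by []].
apply: derD.
  by apply: der_mul; [by apply: der_Pq_y|by apply: der_q_dx|by []].
by apply: der_mul; [by apply: der_Pb_y|by apply: der_be_dx|by []].
Qed.

Lemma geodesic_dydy i x y m k : good x y ->
  dy k (dy m (geodesic_coef F i)) x y = Gam i m k x +
   ((2 * (Pqy k x y * low x y m + Pq x y * a x m k) + Pby k x y * b x ord0 m) * U i x y
    + P_dy m x y * s x i k + P_dy k x y * s x i m).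
Proof.
move=> gxy; apply: der_val.
apply: (@der_eq _ _ (fun y => spray_dy a i x y m + Ty i x y m)).
  by apply: filterS (good_y gxy) => z gxz; rewrite geodesic_dy.
apply: derD; first by apply: der_spray_dy.
apply: derD; last by apply: der_scaler; apply: der_P_y.
apply: der_mul; [|exact: der_lin|by []].
apply: derD; last by apply: der_scaler; apply: der_Pb_y.
apply: (@der_ext _ _ (fun y => 2 * (Pq x y * low x y m))).
  by move=> w; rewrite mulrA.
apply: der_scale; apply: der_mul; [by apply: der_Pq_y|by apply: der_lin|by []].
Qed.

Variables (C : R) (bu : 'rV[R]_3 -> 'I_3 -> R).
Hypothesis b_s : forall x n, \sum_m b x ord0 m * s x m n = 0.
Hypothesis s_s : forall x m n,
  \sum_l s x m l * s x l n = - (C * (m == n)%:R - bu x m * b x ord0 n).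
Hypothesis cov_s : forall x m n l,
  cov_s_up a b m n l x = (m == l)%:R * b x ord0 n - a x n l * bu x m.

(** [Pqy] and [Pby] occur in the intermediate second derivatives but cancel in the result, so that
    only their existence has to be established and no formula for them is computed. *)
Lemma riemann_perturbed i k x y : good x y ->
  riemann_curv F i k x y = spray_riemann a i k x y +
  (3 * (2 * P x y * Pq x y - Pb x y) * mulv (S x) (y ord0) k * U i x y
  + P x y * (2 * be x y * (i == k)%:R - low x y k * bu x i - y ord0 i * b x ord0 k)
  - P_dy k x y * (be x y * y ord0 i - q x y * bu x i)
  - P x y * P_dy k x y * (C * y ord0 i - be x y * bu x i)
  + P x y ^+ 2 * (C * (i == k)%:R - bu x i * b x ord0 k)).
Proof.
move=> gxy; rewrite /riemann_curv /spray_riemann.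
under [X in _ - X + _ - _ = _]eq_bigr do rewrite geodesic_dxdy //.
under [X in _ + 2 * X - _ = _]eq_bigr do rewrite geodesic_dydy // F_spray //.
under [X in _ + _ - X = _]eq_bigr do rewrite !geodesic_dy //.
rewrite geodesic_dx //.
rewrite -(@spray_curvature _ (fun i j k => christoffel a i j k x)
  (fun i j k => cov_s_up a b i j k x) (a x) (s x) (S x) (b x ord0) (bu x)
  (y ord0) (P x y) (Pq x y) (Pb x y) (Pqy k x y) (Pby k x y) C i k).
- have E (A B : R) (c1 c2 w g g' t t' n1 n1' n2 n2' : 'I_3 -> R) :
     2 * (A + B) - \sum_m (c1 m + c2 m) * w m + 2 * \sum_m (g m + t m) * (g' m + t' m)
       - \sum_m (n1 m + n1' m) * (n2 m + n2' m) =
     2 * A - \sum_m c1 m * w m + 2 * \sum_m g m * g' m - \sum_m n1 m * n2 m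
     + (2 * B - \sum_m c2 m * w m + 2 * \sum_m (g m * t' m + t m * g' m + t m * t' m)
        - \sum_m (n1 m * n2' m + n1' m * n2 m + n1' m * n2' m)) by rewrite !sum3; ring.
  exact: E.
- by move=> *; exact: christoffel_sym.
- exact: a_sym.
- by move=> *; exact: s_form_anti.
- by move=> *; exact: s_up_lower.
- exact: b_s.
- exact: s_s.
- exact: cov_s.
Qed.

End PerturbedCoordinates.

(** Here F^2 is regarded as a function of alpha^2 and beta with partial derivatives [A0] and [2 A1].
    The right-hand side is 4 times the fundamental tensor applied to Gbar + P u; the terms along u
    match when P = A1 / A0, whence P = alpha Q. *)
Lemma geodesic_algebra {R : realFieldType} (Gam : 'I_3 -> 'I_3 -> 'I_3 -> R)
    (a S : 'I_3 -> 'I_3 -> R) (b u y A0y A1y : 'I_3 -> R) (A0 A1 P : R) (l : 'I_3) :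
  (forall l m n, Gam l m n = Gam l n m) -> (forall m n, a m n = a n m) ->
  (forall m n, S m n = - S n m) ->
  (forall i, A0y i * mulv a y l + A1y i * b l = A0y l * mulv a y i + A1y l * b i) ->
  A1 = P * A0 ->
  (forall m, \sum_i a m i * u i = mulv S y m) ->
  \sum_m mulv a y m * u m = 0 -> \sum_m b m * u m = 0 ->
  let N m n := \sum_l Gam m n l * y l in
  let qx k := 2 * \sum_n mulv a y n * N n k in
  let bx k := \sum_n S n k * y n + \sum_n b n * N n k in
  \sum_k (A0y l * qx k + A0 * (2 * \sum_n (a l n * N n k + mulv a y n * Gam n l k))
     + 2 * (A1y l * bx k + A1 * (S l k + \sum_n Gam n l k * b n))) * y k
  - (A0 * qx l + 2 * (A1 * bx l)) =
  4 * \sum_i (A0 * a l i + (A0y i * mulv a y l + A1y i * b l)) *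
      (2^-1 * (\sum_n N i n * y n) + P * u i).
Proof.
move=> Gs a_sym S_anti g_sym A1E au yu bu N qx bx.
under [in RHS]eq_bigr do rewrite g_sym.
have S0 := antisym_zero S_anti.
transitivity (4 * (A0 * (\sum_i a l i * (2^-1 * \sum_n N i n * y n)) +
    A0 * P * mulv S y l + A0y l * \sum_i mulv a y i * (2^-1 * \sum_n N i n * y n)
    + A1y l * \sum_i b i * (2^-1 * \sum_n N i n * y n))).
  have -> : A0 * P * mulv S y l = A1 * mulv S y l by rewrite A1E; ring.
  have yS : \sum_k (\sum_n S n k * y n) * y k = 0.
    by rewrite !sum3 !S0 (S_anti o1 o0) (S_anti o2 o0) (S_anti o2 o1); ring.
  rewrite /qx /bx.
  transitivity (A0y l * (\sum_k 2 * (\sum_n mulv a y n * N n k) * y k)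
     + 2 * A0 * (\sum_n a l n * \sum_k N n k * y k)
     + 2 * A0 * (\sum_n mulv a y n * ((\sum_k Gam n l k * y k) - N n l))
     + 2 * A1y l * (\sum_k (\sum_n S n k * y n) * y k + \sum_n b n * \sum_k N n k * y k)
     + 2 * A1 * ((\sum_k S l k * y k) - (\sum_n S n l * y n) +
          \sum_n b n * ((\sum_k Gam n l k * y k) - N n l))).
    by move: (mulv a y) (N) => w N'; rewrite !sum3; ring.
  rewrite yS.
  have -> : \sum_n mulv a y n * ((\sum_k Gam n l k * y k) - N n l) = 0.
    by apply: big1 => n _; rewrite subrr mulr0.
  have -> : \sum_n b n * ((\sum_k Gam n l k * y k) - N n l) = 0.
    by apply: big1 => n _; rewrite subrr mulr0.
  have -> : \sum_n S n l * y n = - \sum_k S l k * y k.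
    by rewrite -sumrN; apply: eq_bigr => n _; rewrite S_anti mulNr.
  by rewrite /mulv; move: (N) => N'; rewrite !sum3; field.
have -> : A0 * P * mulv S y l = A0 * P * \sum_i a l i * u i by rewrite au.
transitivity (4 * ((A0 * (\sum_i a l i * (2^-1 * \sum_n N i n * y n)) +
    A0 * P * (\sum_i a l i * u i) + A0y l * \sum_i mulv a y i * (2^-1 * \sum_n N i n * y n)
    + A1y l * \sum_i b i * (2^-1 * \sum_n N i n * y n)) +
    P * (A0y l * (\sum_m mulv a y m * u m) + A1y l * (\sum_m b m * u m)))).
  by rewrite yu bu !mulr0 !addr0 mulr0 addr0.
by move: (mulv a y) (N) => w N'; rewrite !sum3; ring.
Qed.

Section GeodesicCoefficients.
Context {R : realType}.
Variables (a : 'rV[R]_3 -> 'M[R]_3) (b : 'rV[R]_3 -> 'rV[R]_3).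
Implicit Types (x y : 'rV[R]_3) (i j k l m n : 'I_3).

Hypothesis a_sym : forall x i j, a x i j = a x j i.
Hypothesis a_unit : forall x, a x \in unitmx.
Hypothesis b_s : forall x n, \sum_m b x ord0 m * s_up a b x m n = 0.

Local Notation e k := (delta_mx ord0 k).
Local Notation Gam := (christoffel a).
Local Notation s := (s_up a b).
Local Notation S := (s_form a b).
Local Notation low x y i := (mulv (a x) (y ord0) i).
Local Notation U i x y := (mulv (s x) (y ord0) i).

Variables (F A0 A1 P : 'rV[R]_3 -> 'rV[R]_3 -> R)
  (A0y A1y : 'I_3 -> 'rV[R]_3 -> 'rV[R]_3 -> R) (good : 'rV[R]_3 -> 'rV[R]_3 -> Prop).

Hypothesis good_y : forall x y, good x y -> \forall z \near y, good x z.
Hypothesis der_L_x : forall x y k, good x y -> is_derive x (e k)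
  (fun x => sq F x y) (A0 x y * q_dx a x y k + 2 * (A1 x y * be_dx a b x y k)).
Hypothesis der_L_y : forall x y k, good x y -> is_derive y (e k)
  (sq F x) (2 * (A0 x y * low x y k + A1 x y * b x ord0 k)).
Hypothesis der_A0_y : forall x y k, good x y -> is_derive y (e k) (A0 x) (A0y k x y).
Hypothesis der_A1_y : forall x y k, good x y -> is_derive y (e k) (A1 x) (A1y k x y).

Lemma fundamental_eq x y i j : good x y -> fundamental F x y i j =
  A0 x y * a x i j + (A0y j x y * low x y i + A1y j x y * b x ord0 i).
Proof.
move=> gxy; rewrite mxE.
suff -> : dy j (dy i (sq F)) x y =
  2 * (A0y j x y * low x y i + A0 x y * a x i j + A1y j x y * b x ord0 i) by field.
apply: der_val.
apply: (@der_eq _ _ (fun y => 2 * (A0 x y * low x y i + A1 x y * b x ord0 i))).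
  apply: filterS (good_y gxy) => z gxz; rewrite /dy /pd.
  by rewrite (der_val (der_L_y _ gxz)).
apply: der_scale; apply: derD; last by apply: der_scaler; apply: der_A1_y.
by apply: der_mul; [by apply: der_A0_y|by apply: der_lin|by []].
Qed.

Hypothesis A_sym : forall x y i l, good x y ->
  A0y i x y * low x y l + A1y i x y * b x ord0 l =
  A0y l x y * low x y i + A1y l x y * b x ord0 i.
Hypothesis F_unit : forall x y, good x y -> fundamental F x y \in unitmx.
Hypothesis P_eq : forall x y, good x y -> A1 x y = P x y * A0 x y.

(** The inverse of the fundamental tensor is never computed: by [geodesic_algebra] the candidate
    solves the linear system behind [geodesic_coef], and [invmx] cancels. *)
Lemma geodesic_perturbed x y i : good x y ->
  geodesic_coef F i x y = spray a i x y + P x y * U i x y.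
Proof.
move=> gxy; rewrite /geodesic_coef.
pose G := \col_j (spray a j x y + P x y * U j x y).
have E l : \sum_k dy l (dx k (sq F)) x y * y ord0 k - dx l (sq F) x y =
    4 * (fundamental F x y *m G) l ord0.
  have dxL k z : good x z -> dx k (sq F) x z =
      A0 x z * q_dx a x z k + 2 * (A1 x z * be_dx a b x z k).
    by move=> gxz; apply: der_val; exact: der_L_x.
  have dydxL k : dy l (dx k (sq F)) x y =
     A0y l x y * q_dx a x y k
     + A0 x y * (2 * \sum_n (a x l n * spray_dy a n x y k + low x y n * Gam n l k x))
     + 2 * (A1y l x y * be_dx a b x y k
            + A1 x y * (S x l k + \sum_n Gam n l k x * b x ord0 n)).
    apply: der_val.
    apply: (@der_eq _ _ (fun y => A0 x y * q_dx a x y k + 2 * (A1 x y * be_dx a b x y k))).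
      by apply: filterS (good_y gxy) => z gxz; rewrite dxL.
    apply: derD.
      by apply: der_mul; [by apply: der_A0_y|by apply: der_q_dx|by []].
    apply: der_scale.
    by apply: der_mul; [by apply: der_A1_y|by apply: der_be_dx|by []].
  rewrite dxL //; under eq_bigr do rewrite dydxL.
  rewrite mxE; under [in RHS]eq_bigr do rewrite fundamental_eq // mxE.
  have au m : \sum_j a x m j * U j x y = mulv (S x) (y ord0) m.
    rewrite /mulv; under [RHS]eq_bigr do rewrite -(s_up_lower b a_unit).
    by move: (s x) (a x) (y ord0) => s' a' y'; rewrite !sum3; ring.
  apply: (@geodesic_algebra _ (fun i j k => christoffel a i j k x) (a x) (S x)
    (b x ord0) (fun j => U j x y) (y ord0) (fun i => A0y i x y) (fun i => A1y i x y)
    (A0 x y) (A1 x y) (P x y) l) => //.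
  - by move=> *; exact: christoffel_sym.
  - by move=> *; exact: s_form_anti.
  - by move=> i'; apply: A_sym.
  - exact: P_eq.
  - transitivity (\sum_m mulv (a x) (y ord0) m * U m x y) => //.
    have E (a' : 'I_3 -> 'I_3 -> R) (u' y' : 'I_3 -> R) : (forall i j, a' i j = a' j i) ->
       \sum_m mulv a' y' m * u' m = \sum_m y' m * \sum_j a' m j * u' j.
      by move=> as'; rewrite /mulv !sum3 (as' o1 o0) (as' o2 o0) (as' o2 o1); ring.
    rewrite E //; under eq_bigr do rewrite au.
    have SN := s_form_anti a b x; have S0 := antisym_zero SN.
    rewrite /mulv !sum3 !S0 (SN o1 o0) (SN o2 o0) (SN o2 o1).
    by move: (S x) (y ord0) => S' y'; ring.
  - have -> : \sum_m b x ord0 m * U m x y = \sum_n y ord0 n * \sum_m b x ord0 m * s x m n.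
      by move: (s x) (b x ord0) (y ord0) => s' b' y'; rewrite /mulv !sum3; ring.
    by apply: big1 => n _; rewrite b_s mulr0.
under eq_bigr do rewrite E.
have -> : \sum_l invmx (fundamental F x y) i l * (4 * (fundamental F x y *m G) l ord0) =
  4 * (invmx (fundamental F x y) *m (fundamental F x y *m G)) i ord0.
  rewrite [in RHS]mxE mulr_sumr; apply: eq_bigr => l _; exact: mulrCA.
by rewrite mulmxA mulVmx ?F_unit // mul1mx mxE mulrA mulVf ?mul1r // pnatr_eq0.
Qed.

End GeodesicCoefficients.

(** * The fundamental tensor of an (alpha, beta)-metric *)

Section AlphaBetaForm.
Context {R : realFieldType}.
Variables (a : 'I_3 -> 'I_3 -> R) (b bu y : 'I_3 -> R) (al s C p0 p1 p2 : R).
Implicit Types u v w : 'I_3 -> R.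

Definition bil u v : R := pair3 u (mulv a v).

Hypothesis a_sym : forall i j, a i j = a j i.
Hypothesis a_pos : forall v, (exists i, v i != 0) -> 0 < bil v v.
Hypothesis a_bu : forall i, mulv a bu i = b i.
Hypothesis b_bu : pair3 b bu = C.
Hypothesis al_gt0 : 0 < al.
Hypothesis al_sq : al ^+ 2 = bil y y.
Hypothesis s_al : s * al = pair3 b y.

Lemma bil_ge0 v : 0 <= bil v v.
Proof.
have [[i vi]|H] := pselect (exists i, v i != 0); first by apply/ltW/a_pos; exists i.
rewrite /bil /pair3 big1 // => i _; have [->|ni] := eqVneq (v i) 0; first by rewrite mul0r.
by case: H; exists i.
Qed.

Lemma bilC u v : bil u v = bil v u.
Proof. by rewrite /bil /pair3 /mulv !sum3 (a_sym o1 o0) (a_sym o2 o0) (a_sym o2 o1); ring. Qed.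

Lemma bil_comb u v (c d : R) : bil (fun i => c * u i + d * v i) (fun i => c * u i + d * v i) =
  c ^+ 2 * bil u u + 2 * (c * d) * bil u v + d ^+ 2 * bil v v.
Proof. by rewrite /bil /pair3 /mulv !sum3 (a_sym o1 o0) (a_sym o2 o0) (a_sym o2 o1); ring. Qed.

Lemma bil_cauchy u v : bil u v ^+ 2 <= bil u u * bil v v.
Proof.
have [[i vi]|H] := pselect (exists i, v i != 0); last first.
  have v0 i : v i = 0 by apply/eqP; apply: contra_notT H => ?; exists i.
  have z w : bil v w = 0 by rewrite /bil /pair3 big1 // => i _; rewrite v0 mul0r.
  by rewrite bilC !z expr0n mulr0.
have vv : 0 < bil v v by apply: a_pos; exists i.
have := bil_ge0 (fun i => bil v v * u i + - bil u v * v i); rewrite bil_comb.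
set uu := bil u u; set uv := bil u v; set w := bil v v in vv *.
have -> : w ^+ 2 * uu + 2 * (w * - uv) * uv + (- uv) ^+ 2 * w = w * (uu * w - uv ^+ 2) by ring.
by rewrite pmulr_rge0 // subr_ge0.
Qed.

Lemma bil_bu v : bil bu v = pair3 b v.
Proof. by rewrite bilC /bil /pair3; apply: eq_bigr => i _; rewrite a_bu mulrC. Qed.

(* The component of b^# orthogonal to y. *)
Let h i := 1 * bu i + - (s / al) * y i.

Let h_norm : bil h h = C - s ^+ 2.
Proof.
rewrite bil_comb bil_bu bil_bu b_bu -al_sq -s_al.
by field; rewrite gt_eqF.
Qed.

Lemma s_le_norm : s ^+ 2 <= C.
Proof. by rewrite -subr_ge0 -h_norm bil_ge0. Qed.

Let delta := p0 - s * p1 + (C - s ^+ 2) * p2.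

(* The fundamental tensor of al phi (be / al), with p0, p1, p2 the values of
   phi and its first two derivatives at s. *)
Definition ab_form v : R :=
  let t := pair3 v (mulv a y) in let bv := pair3 b v in
  p0 * (p0 - s * p1) * bil v v
  + (p0 * p1 - s * (p1 ^+ 2 + p0 * p2)) * (bv / al - s * t / al ^+ 2) * t
  + (t / al * (p0 * p1) + (p1 ^+ 2 + p0 * p2) * (bv - s * t / al)) * bv.

(** Split v into a component t along y / alpha and an orthogonal part w with b(w) = [bw]; then
    [bil v v - t ^+ 2] is the squared length of w, and completing the square in t absorbs the terms
    mixing the two parts. *)
Lemma ab_formE v : let t := pair3 v (mulv a y) / al in let bw := pair3 b v - t * s in
  ab_form v = (p0 * t + p1 * bw) ^+ 2 + p0 * p2 * bw ^+ 2
   + p0 * (p0 - s * p1) * (bil v v - t ^+ 2).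
Proof. by rewrite /ab_form /=; field; rewrite gt_eqF. Qed.

Hypothesis p0_gt0 : 0 < p0.
Hypothesis p1_gt0 : 0 < p0 - s * p1.

(** The Cauchy-Schwarz inequality for w and the part h of b^# orthogonal to y bounds bw^2 by (C -
    s^2) |w|^2; it is needed when p2 < 0, and its extreme case produces [delta]. *)
Lemma ab_form_gt0 v : 0 < delta -> (exists i, v i != 0) -> 0 < ab_form v.
Proof.
move=> d0 v0; rewrite ab_formE /=; set t := _ / al; set bw := _ - t * s.
pose w i := 1 * v i + - (t / al) * y i.
have ww : bil w w = bil v v - t ^+ 2.
  by rewrite bil_comb -al_sq /t /bil; field; rewrite gt_eqF.
have bww : pair3 b w = bw.
  have -> : pair3 b w = pair3 b v - t / al * pair3 b y by rewrite /pair3 /w !sum3; ring.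
  by rewrite -s_al /bw; field; rewrite gt_eqF.
have hw : bil h w = bw.
  rewrite -bww.
  have -> : bil h w = bil bu w - s / al * bil y w.
    by rewrite /bil /pair3 /h !sum3; ring.
  have -> : bil y w = 0.
    have -> : bil y w = bil y v - t / al * bil y y.
      by rewrite /bil /w /pair3 /mulv !sum3; ring.
    by rewrite -al_sq bilC /bil /t; field; rewrite gt_eqF.
  by rewrite mulr0 subr0 bil_bu.
have cs : bw ^+ 2 <= (C - s ^+ 2) * bil w w by rewrite -hw -h_norm; exact: bil_cauchy.
rewrite -ww; have [ww0|ww0] := eqVneq (bil w w) 0.
  have bw0 : bw = 0.
    by move: cs; rewrite ww0 mulr0 => /(conj (sqr_ge0 bw))/andP/le_anti/eqP; rewrite eq_sym sqrf_eq0 => /eqP.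
  rewrite ww0 bw0 !(mulr0, expr0n, addr0) exprn_even_gt0 //= mulf_eq0 negb_or (gt_eqF p0_gt0) /=.
  apply/negP => /eqP t0; have := a_pos v0; move: ww; rewrite ww0 t0 expr0n subr0 => <-.
  by rewrite ltxx.
have {}ww0 : 0 < bil w w by rewrite lt_neqAle eq_sym ww0 bil_ge0.
rewrite -addrA ltr_wpDl ?sqr_ge0 //.
move: (bil w w) ww0 cs => W W0 cs.
have -> : p0 * p2 * bw ^+ 2 + p0 * (p0 - s * p1) * W =
   p0 * (p2 * bw ^+ 2 + (p0 - s * p1) * W) by ring.
rewrite mulr_gt0 //; have [p2_ge0|p2_lt0] := leP 0 p2.
  by apply: ltr_wpDl; [rewrite mulr_ge0 ?sqr_ge0|exact: mulr_gt0].
apply: (@lt_le_trans _ _ (delta * W)); first exact: mulr_gt0.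
have : p2 * ((C - s ^+ 2) * W) <= p2 * bw ^+ 2 by rewrite ler_wnM2l // ltW.
rewrite /delta; move: (p2 * bw ^+ 2) => X; lra.
Qed.

(** Test vector: orthogonal part h, for which Cauchy-Schwarz is an equality, with the component t
    along y chosen to annihilate the square p0 t + p1 bw. When s^2 = C the vector h vanishes, but
    then delta is just p0 - s p1. *)
Lemma ab_form_delta : (forall v, (exists i, v i != 0) -> 0 < ab_form v) -> 0 < delta.
Proof.
move=> H; have := s_le_norm; rewrite le_eqVlt => /orP[/eqP E|lt_sC].
  by rewrite /delta -E subrr mul0r addr0.
pose t := - (p1 * (C - s ^+ 2)) / p0.
pose v i := 1 * h i + t / al * y i.
have yh : pair3 h (mulv a y) = 0.
  have -> : pair3 h (mulv a y) = bil bu y - s / al * bil y y.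
    by rewrite /bil /pair3 /h !sum3; ring.
  by rewrite bil_bu -s_al -al_sq; field; rewrite gt_eqF.
have tv : pair3 v (mulv a y) / al = t.
  have -> : pair3 v (mulv a y) = pair3 h (mulv a y) + t / al * bil y y.
    by rewrite /bil /pair3 /v !sum3; ring.
  by rewrite yh -al_sq; field; rewrite !gt_eqF.
have bv : pair3 b v - t * s = C - s ^+ 2.
  have -> : pair3 b v = pair3 b bu - s / al * pair3 b y + t / al * pair3 b y.
    by rewrite /pair3 /v /h !sum3; ring.
  by rewrite b_bu -s_al; field; rewrite !gt_eqF.
have vv : bil v v - t ^+ 2 = C - s ^+ 2.
  rewrite bil_comb h_norm /bil yh -/(bil y y) -al_sq; field; rewrite !gt_eqF //.
have v0 : exists i, v i != 0.
  have [//|N] := pselect (exists i, v i != 0); exfalso.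
  have v0 i : v i = 0 by apply/eqP; apply: contra_notT N => ?; exists i.
  have vv0 : bil v v = 0 by rewrite /bil /pair3 big1 // => i _; rewrite v0 mul0r.
  have := sqr_ge0 t; move: vv; rewrite vv0 => vv t0; lra.
have := H v v0; rewrite ab_formE /= tv bv vv.
have -> : p0 * t + p1 * (C - s ^+ 2) = 0 by rewrite /t; field; rewrite gt_eqF.
rewrite expr0n /= add0r.
have -> : p0 * p2 * (C - s ^+ 2) ^+ 2 + p0 * (p0 - s * p1) * (C - s ^+ 2) =
  p0 * (C - s ^+ 2) * delta by rewrite /delta; ring.
by rewrite pmulr_rgt0 // mulr_gt0 // subr_gt0.
Qed.

End AlphaBetaForm.

(** * Killing forms of constant length *)

Local Opaque pd christoffel cov_form s_form s_up cov_s_up.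

(** Data of one chart from which the curvature formulas follow. The Ricci identity is kept apart, so
    that the round metric with its Hopf form (C = 1), whose Ricci curvature is different, is an
    instance too and the same formulas yield the Ricci curvature of the Berger metrics. *)
Record killing_chart {R : realType} (a : 'rV[R]_3 -> 'M[R]_3) (b : 'rV[R]_3 -> 'rV[R]_3)
    (C : R) : Prop := KillingChart {
  kc_a_smooth : forall i j, smooth (fun x => a x i j);
  kc_a_sym : forall x i j, a x i j = a x j i;
  kc_a_pos : forall x (v : 'I_3 -> R), (exists i, v i != 0) -> 0 < bil (a x) v v;
  kc_b_smooth : forall i, smooth (fun x => b x ord0 i);
  kc_killing : forall x, r_form a b x = 0;
  kc_norm : forall x, dot (b x *m invmx (a x)) (b x) = C;
  kc_ss : forall x y, s0s0 a b x y =
    - (C * bil (a x) (y ord0) (y ord0) - pair3 (b x ord0) (y ord0) ^+ 2)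
}.

Lemma dot_mul {R : realType} n (u v : 'rV[R]_n) (M : 'M[R]_n) :
  dot (u *m M) v = \sum_j (\sum_i u ord0 i * M i j) * v ord0 j.
Proof. by rewrite /dot mxE; apply: eq_bigr => j _; rewrite [(_ *m _) _ _]mxE [v^T _ _]mxE. Qed.

Lemma pos_unitmx {R : realType} (M : 'M[R]_3) :
  (forall v : 'I_3 -> R, (exists i, v i != 0) -> 0 < bil M v v) -> M \in unitmx.
Proof.
move=> pos; rewrite -row_free_unit -kermx_eq0; apply/negPn/negP => /matrix0Pn[i [j H]].
have := pos (fun j => kermx M i j); rewrite ltNge => /(_ (ex_intro _ j H))/negP; apply.
have /matrixP K := mulmx_ker M.
have E (k : 'I_3 -> R) : bil M k k = \sum_j (\sum_l k l * M l j) * k j.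
  by rewrite /bil /pair3 /mulv !sum3; ring.
by rewrite E big1 // => l _; have := K i l; rewrite mxE [RHS]mxE => ->; rewrite mul0r.
Qed.

(** Positivity of nested minors, starting from the lower right corner: the vector (0, a22, -a21) has
    squared length [a o2 o2 * m], and the first row of the adjugate has squared length
    [m * det3 a]. *)
Lemma pos_det3 {R : realFieldType} (a : 'I_3 -> 'I_3 -> R) :
  (forall i j, a i j = a j i) ->
  (forall v : 'I_3 -> R, (exists i, v i != 0) -> 0 < bil a v v) -> det3 a != 0.
Proof.
move=> a_sym pos; apply/negP => /eqP d0.
pose e (k i : 'I_3) : R := (i == k)%:R.
have a22 : 0 < a o2 o2.
  have := pos (e o2); rewrite /bil /pair3 /mulv !sum3 /e /= !(mulr0, mul0r, mulr1, mul1r, addr0, add0r).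
  by apply; exists o2; rewrite eqxx oner_neq0.
pose m := adj3 a o0 o0.
have m0 : 0 < m.
  have := pos (fun i => a o2 o2 * e o1 i + - a o2 o1 * e o2 i).
  have -> : bil a (fun i => a o2 o2 * e o1 i + - a o2 o1 * e o2 i)
                  (fun i => a o2 o2 * e o1 i + - a o2 o1 * e o2 i) = a o2 o2 * m.
    by rewrite /bil /pair3 /mulv !sum3 /e /m /adj3 /= (a_sym o2 o1); ring.
  rewrite pmulr_rgt0 //; apply; exists o1; rewrite /e /= mulr0 addr0 mulr1.
  by rewrite gt_eqF.
have := pos (fun i => adj3 a o0 i).
have -> : bil a (fun i => adj3 a o0 i) (fun i => adj3 a o0 i) = m * det3 a.
  rewrite /bil /pair3 /mulv !sum3 /m /det3 /adj3 /= (a_sym o1 o0) (a_sym o2 o0) (a_sym o2 o1).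
  by ring.
rewrite d0 mulr0 ltxx => H; suff : false by []; apply: H.
by exists o0; rewrite gt_eqF.
Qed.

Section KillingChart.
Context {R : realType}.
Variables (a : 'rV[R]_3 -> 'M[R]_3) (b : 'rV[R]_3 -> 'rV[R]_3) (C : R).
Hypothesis K : killing_chart a b C.
Implicit Types (x y : 'rV[R]_3) (i j k l m n : 'I_3).

Local Notation e k := (delta_mx ord0 k).
Local Notation Gam := (christoffel a).
Local Notation s := (s_up a b).
Local Notation S := (s_form a b).

Let a_sym := kc_a_sym K.

Lemma kc_unit x : a x \in unitmx.
Proof. by apply: pos_unitmx; exact: (kc_a_pos K). Qed.

Lemma kc_det x : det3 (a x) != 0.
Proof. by apply: pos_det3 => //; exact: (kc_a_pos K). Qed.

Definition sharp x i : R := \sum_j invmx (a x) i j * b x ord0 j.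

Lemma sharp_low x i : mulv (a x) (sharp x) i = b x ord0 i.
Proof.
rewrite /mulv /sharp.
have E (A B : 'I_3 -> 'I_3 -> R) (c : 'I_3 -> R) :
  \sum_j A i j * (\sum_k B j k * c k) = \sum_k (\sum_j A i j * B j k) * c k.
  by rewrite !sum3; ring.
rewrite (E (a x) (invmx (a x))); under eq_bigr do rewrite (invmx_sum kc_unit).
exact: sum_delta.
Qed.

Lemma sharp_norm x : pair3 (b x ord0) (sharp x) = C.
Proof.
rewrite -(kc_norm K x) dot_mul /pair3 /sharp.
have E (A : 'I_3 -> 'I_3 -> R) (c : 'I_3 -> R) :
  \sum_i c i * (\sum_j A i j * c j) = \sum_j (\sum_i c i * A i j) * c j.
  by rewrite !sum3; ring.
exact: E.
Qed.

Lemma adj3_norm x :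
  \sum_i \sum_j adj3 (a x) i j * (b x ord0 i * b x ord0 j) = det3 (a x) * C.
Proof.
under eq_bigr do under eq_bigr do rewrite -!sharp_low.
rewrite adj3_trace // -(sharp_norm x) /pair3; congr (_ * _).
by apply: eq_bigr => i _; rewrite sharp_low mulrC.
Qed.

Definition row3 (u v w : R) : 'rV[R]_3 :=
  \row_i match val i with 0%N => u | 1%N => v | _ => w end.

Lemma sym_quadratic_eq0 (D : 'I_3 -> 'I_3 -> R) : (forall i j, D i j = D j i) ->
  (forall y, \sum_j (\sum_i y ord0 i * D i j) * y ord0 j = 0) -> forall i j, D i j = 0.
Proof.
move=> D_sym H i j.
have [|[h1 h2 h3] [h4 h5 h6]] := @quadratic_form_eq0 R (D o0 o0) (D o1 o1) (D o2 o2)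
  (2 * D o0 o1) (2 * D o0 o2) (2 * D o1 o2).
  move=> u v w; rewrite -(H (row3 u v w)) !sum3 !mxE /=.
  by rewrite (D_sym o1 o0) (D_sym o2 o0) (D_sym o2 o1); ring.
have halve t : 2 * t = 0 -> t = 0 :> R by move=> ?; lra.
have := halve _ h4; have := halve _ h5; have := halve _ h6 => e12 e02 e01.
by cases3 i; cases3 j; rewrite ?h1 ?h2 ?h3 ?e01 ?e02 ?e12 // D_sym ?e01 ?e02 ?e12.
Qed.

(** [kc_ss] gives this tensor only as a quadratic form in y; both sides are symmetric in [i] and
    [j], the left one because S is antisymmetric, so the forms can be polarized. *)
Lemma s_form_up x i j : \sum_m S x i m * s x m j =
  - (C * a x i j - b x ord0 i * b x ord0 j).
Proof.
pose M i j := \sum_m S x i m * s x m j.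
pose N i j := - (C * a x i j - b x ord0 i * b x ord0 j).
have M_sym i' j' : M i' j' = M j' i'.
  have E p r : M p r = - \sum_m (\sum_l a x m l * s x l p) * s x m r.
    rewrite -sumrN; apply: eq_bigr => m _.
    by rewrite (s_up_lower b kc_unit) s_form_anti mulNr.
  rewrite !E; have as' := a_sym x; move: (s x) (a x) as' => s' a' as'.
  by rewrite !sum3 (as' o1 o0) (as' o2 o0) (as' o2 o1); ring.
apply/eqP; rewrite -subr_eq0; apply/eqP.
apply: (@sym_quadratic_eq0 (fun i j => M i j - N i j)) => [i' j'|y].
  by rewrite M_sym /N (a_sym _ i' j'); ring.
have := kc_ss K x y; rewrite /s0s0 dot_mul => H.
transitivity ((\sum_j (\sum_i y ord0 i * M i j) * y ord0 j) -
   - (C * bil (a x) (y ord0) (y ord0) - pair3 (b x ord0) (y ord0) ^+ 2)).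
  rewrite /N /bil /pair3 /mulv.
  have as' := a_sym x; move: (b x ord0) (a x) as' (y ord0) (M) => b' a' as' y' M'.
  by rewrite !sum3 (as' o1 o0) (as' o2 o0) (as' o2 o1); ring.
rewrite -H; apply/eqP; rewrite subr_eq0; apply/eqP; apply: eq_bigr => l _.
congr (_ * _); apply: eq_bigr => m _; congr (_ * _).
by rewrite [RHS]mxE.
Qed.

Lemma form_s_up x n : \sum_m b x ord0 m * s x m n = 0.
Proof.
apply: (@form_contract_U _ (a x) (S x) (s x) (b x ord0) C) => //.
- exact: kc_det.
- exact: s_form_anti.
- by move=> *; exact: s_up_lower kc_unit _ _ _.
- by move=> *; exact: s_form_up.
- exact: adj3_norm.
Qed.

Lemma s_form_gram x y i k :
  mulv (S x) (y ord0) i * mulv (S x) (y ord0) k =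
  let z := mulv (a x) (y ord0) in let q := pair3 (y ord0) z in
  let be := pair3 (b x ord0) (y ord0) in
  a x i k * (C * q - be ^+ 2) - C * (z i * z k)
  - q * (b x ord0 i * b x ord0 k) + be * (z i * b x ord0 k + b x ord0 i * z k).
Proof.
apply: (@killing_gram _ (a x) (S x) (s x) (b x ord0) C) => //.
- exact: kc_det.
- exact: s_form_anti.
- by move=> *; exact: s_up_lower kc_unit _ _ _.
- by move=> *; exact: s_form_up.
- exact: adj3_norm.
Qed.

Lemma metric_cancel x (u : 'I_3 -> R) i :
  \sum_j invmx (a x) i j * mulv (a x) u j = u i.
Proof.
have E (A B : 'I_3 -> 'I_3 -> R) (c : 'I_3 -> R) :
  \sum_j A i j * (\sum_k B j k * c k) = \sum_k (\sum_j A i j * B j k) * c k.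
  by rewrite !sum3; ring.
rewrite /mulv (E (invmx (a x)) (a x)); under eq_bigr do rewrite (invmx_sum' kc_unit).
exact: sum_delta.
Qed.

Lemma metric_inj x (u v : 'I_3 -> R) :
  (forall i, mulv (a x) u i = mulv (a x) v i) -> forall i, u i = v i.
Proof.
by move=> H i; rewrite -(metric_cancel x u) -(metric_cancel x v); apply: eq_bigr => j _; rewrite H.
Qed.

Lemma s_up_sq x m n : \sum_l s x m l * s x l n =
  - (C * (m == n)%:R - sharp x m * b x ord0 n).
Proof.
move: m; apply: (@metric_inj x) => i.
transitivity (\sum_l (\sum_m a x i m * s x m l) * s x l n).
  by move: (a x) (s x) => a' s'; rewrite /mulv !sum3; ring.
under eq_bigr do rewrite (s_up_lower b kc_unit).
rewrite s_form_up -{1}sharp_low.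
have -> : a x i n = \sum_m a x i m * (m == n)%:R.
  by under eq_bigr do rewrite mulrC eq_sym; rewrite sum_delta.
by move: (a x) (sharp x) (b x ord0) => a' h' b'; rewrite /mulv !sum3; ring.
Qed.

Lemma cov_s_up_lower x i j k : \sum_m a x i m * cov_s_up a b m j k x =
  pd k (fun z => S z i j) x - \sum_l Gam l i k x * S x l j - \sum_l Gam l j k x * S x i l.
Proof.
have -> : pd k (fun z => S z i j) x =
    \sum_m (pd k (fun z => a z i m) x * s x m j + a x i m * pd k (fun z => s z m j) x).
  apply: der_val; apply: (@der_ext _ _ (fun z => \sum_m a z i m * s z m j)).
    by move=> w; rewrite (s_up_lower b kc_unit).
  apply: der_sum => m; apply: derM; first by apply: der_pd; exact: (kc_a_smooth K).
  apply: der_pd; apply: s_up_smooth; [exact: (kc_a_smooth K)|exact: kc_unit|exact: (kc_b_smooth K)].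
under [in RHS]eq_bigr do rewrite (pd_metric (kc_a_sym K) kc_unit) pd_s_up.
under [X in _ - X - _]eq_bigr do rewrite -(s_up_lower b kc_unit).
under [X in _ - _ - X]eq_bigr do rewrite -(s_up_lower b kc_unit).
have E (A s' Z : 'I_3 -> 'I_3 -> R) (G : 'I_3 -> 'I_3 -> R) : (forall i j, A i j = A j i) ->
  \sum_m A i m * Z m j =
  \sum_m ((\sum_l (A i l * G l m + A m l * G l i)) * s' m j +
     A i m * (Z m j - \sum_l G m l * s' l j + \sum_l G l j * s' m l))
  - \sum_l G l i * (\sum_m A l m * s' m j) - \sum_l G l j * (\sum_m A i m * s' m l).
  by move=> As; rewrite !sum3 (As o1 o0) (As o2 o0) (As o2 o1); ring.
exact: (E (a x) (s x) (fun m j => cov_s_up a b m j k x) (fun l i => Gam l i k x) (a_sym x)).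
Qed.

Lemma cov_s_up_anti x i j k : \sum_m a x i m * cov_s_up a b m j k x =
  - \sum_m a x j m * cov_s_up a b m i k x.
Proof.
rewrite !cov_s_up_lower.
have -> : pd k (fun z => S z i j) x = - pd k (fun z => S z j i) x.
  apply: der_val; apply: (@der_ext _ _ (fun z => - S z j i)).
    by move=> w; rewrite s_form_anti opprK.
  apply: derN; apply: der_pd; apply: s_form_smooth.
  - exact: (kc_a_smooth K).
  - exact: kc_unit.
  - exact: (kc_b_smooth K).
have E (S' : 'I_3 -> 'I_3 -> R) (G : 'I_3 -> 'I_3 -> R) (t : R) : (forall i j, S' i j = - S' j i) ->
  - t - \sum_l G l i * S' l j - \sum_l G l j * S' i l =
  - (t - \sum_l G l j * S' l i - \sum_l G l i * S' j l).
  by move=> SN; rewrite !sum3 !(SN _ i) !(SN _ j); ring.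
exact: (E (S x) (fun l i => Gam l i k x) _ (s_form_anti a b x)).
Qed.

(** Covariant derivative of [s_form_up] in direction [k]: the metric is parallel, and b_{i;k} = s_ik
    by the Killing equation. *)
Lemma cov_s_up_eq x i j k :
  \sum_m ((\sum_l a x i l * cov_s_up a b l m k x) * s x m j +
          S x i m * cov_s_up a b m j k x) =
  S x i k * b x ord0 j + b x ord0 i * S x j k.
Proof.
have D : \sum_m (pd k (fun z => S z i m) x * s x m j + S x i m * pd k (fun z => s z m j) x) =
    - (C * pd k (fun z => a z i j) x -
       (pd k (fun z => b z ord0 i) x * b x ord0 j + b x ord0 i * pd k (fun z => b z ord0 j) x)).
  transitivity (pd k (fun z => \sum_m S z i m * s z m j) x).
    apply/esym; apply: der_val; apply: der_sum => m; apply: derM; apply: der_pd.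
      by apply: s_form_smooth; [exact: (kc_a_smooth K)|exact: kc_unit|exact: (kc_b_smooth K)].
    by apply: s_up_smooth; [exact: (kc_a_smooth K)|exact: kc_unit|exact: (kc_b_smooth K)].
  apply: der_val; apply: (@der_ext _ _ (fun z => - (C * a z i j - b z ord0 i * b z ord0 j))).
    by move=> w; rewrite s_form_up.
  apply: derN; apply: derB.
    by apply: der_scale; apply: der_pd; exact: (kc_a_smooth K).
  by apply: derM; apply: der_pd; exact: (kc_b_smooth K).
move: D; rewrite (pd_metric (kc_a_sym K) kc_unit) !(pd_form (kc_killing K)).
under eq_bigr do rewrite pd_s_up.
move=> D.
under eq_bigr do rewrite cov_s_up_lower.
have SU := s_form_up x.
have E (S' s' Z A : 'I_3 -> 'I_3 -> R) (G : 'I_3 -> 'I_3 -> R) (dS b' : 'I_3 -> R) :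
  (forall i j, A i j = A j i) ->
  (forall i j, \sum_m S' i m * s' m j = - (C * A i j - b' i * b' j)) ->
  \sum_m (dS m * s' m j + S' i m * (Z m j - \sum_l G m l * s' l j + \sum_l G l j * s' m l)) =
    - (C * (\sum_l (A i l * G l j + A j l * G l i)) -
      ((S' i k + \sum_n G n i * b' n) * b' j + b' i * (S' j k + \sum_n G n j * b' n))) ->
  \sum_m ((dS m - \sum_l G l i * S' l m - \sum_l G l m * S' i l) * s' m j + S' i m * Z m j) =
  S' i k * b' j + b' i * S' j k.
  move=> As SU' D'.
  transitivity (\sum_m (dS m * s' m j + S' i m * (Z m j - \sum_l G m l * s' l j + \sum_l G l j * s' m l))
    - \sum_l G l i * (\sum_m S' l m * s' m j) - \sum_l G l j * \sum_m S' i m * s' m l).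
    by rewrite !sum3; ring.
  rewrite D'; under [X in _ - X - _]eq_bigr do rewrite SU'.
  under [X in _ - _ - X]eq_bigr do rewrite SU'.
  by rewrite !sum3 !(As _ j); ring.
exact: (E (S x) (s x) (fun m j => cov_s_up a b m j k x) (a x) (fun l i => Gam l i k x)
   (fun m => pd k (fun z => S z i m) x) (b x ord0) (a_sym x) SU D).
Qed.

Lemma cov_s_up_killing x m n l :
  cov_s_up a b m n l x = (m == l)%:R * b x ord0 n - a x n l * sharp x m.
Proof.
(* For C = 0 the form b vanishes identically and s with it, so both sides are 0; [cov_killing]
   covers C nonzero. *)
have [C0|C0] := eqVneq C 0.
  have b0 z i : b z ord0 i = 0.
    have sh0 j : sharp z j = 0.
      apply: contra_eq (sharp_norm z) => Hj; rewrite C0 gt_eqF //.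
      have -> : pair3 (b z ord0) (sharp z) = bil (a z) (sharp z) (sharp z).
        by rewrite /bil /pair3; apply: eq_bigr => p _; rewrite sharp_low mulrC.
      by apply: (kc_a_pos K); exists j.
    by rewrite -sharp_low /mulv big1 // => j _; rewrite sh0 mulr0.
  have s0 z i j : s z i j = 0.
    have [//|sn0] := eqVneq (s z i j) 0; exfalso.
    have pos : 0 < bil (a z) (s z ^~ j) (s z ^~ j) by apply: (kc_a_pos K); exists i.
    have : bil (a z) (s z ^~ j) (s z ^~ j) = - \sum_m0 S z j m0 * s z m0 j.
      rewrite -sumrN; apply: eq_bigr => p _.
      by rewrite s_form_anti mulNr opprK /mulv (s_up_lower b kc_unit) mulrC.
    by rewrite s_form_up C0 b0 !mul0r subrr !oppr0 => E; rewrite E ltxx in pos.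
  have := pd_s_up a b x m n l.
  have -> : (fun z => s z m n) = fun=> 0 by apply/funext => z; exact: s0.
  have -> : pd l (fun=> 0 : R) x = 0 by apply: der_val; exact: derC.
  rewrite !b0 /sharp.
  rewrite [X in _ - X + _]big1; last by move=> j _; rewrite s0 mulr0.
  rewrite [X in _ + X]big1; last by move=> j _; rewrite s0 mulr0.
  rewrite subr0 addr0 => <-; rewrite big1 ?mulr0 ?subr0 // => j _.
  by rewrite b0 mulr0.
move: m; apply: (@metric_inj x) => i.
have := @cov_killing _ (a x) (S x) (s x) (b x ord0) C (a_sym x) (kc_det x)
  (s_form_anti a b x) (s_up_lower b kc_unit x) (s_form_up x) (adj3_norm x) l
  (fun i j => \sum_m a x i m * cov_s_up a b m j l x)
  (fun m j => cov_s_up a b m j l x) (fun i j => cov_s_up_anti x i j l)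
  (fun i j => erefl) (fun i j => cov_s_up_eq x i j l) C0 i n.
rewrite /mulv => ->.
have -> : a x i l = \sum_m a x i m * (m == l)%:R.
  by under eq_bigr do rewrite mulrC eq_sym; rewrite sum_delta.
rewrite -{1}(sharp_low x i) /mulv.
by move: (a x) (sharp x) (b x ord0) => a' h' b'; rewrite !sum3; ring.
Qed.

End KillingChart.

Local Transparent pd christoffel cov_form s_form s_up cov_s_up.

(** * Chain rules for functions of alpha^2 and beta *)

Section PhiFunction.
Context {R : realType}.
Variables (phi : R -> R) (b0 : R).
Hypothesis adm : admissible b0 phi.

Local Notation p1 := (derive1 phi).
Local Notation p2 := (derive1n 2 phi).

Lemma der_phi (n : nat) (s : R) : `|s| < b0 ->
  is_derive s 1 (derive1n n phi) (derive1n n.+1 phi s).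
Proof.
case: adm => _ H _ _ sb; have D := H n s sb.
by rewrite derive1nS derive1E; exact: derivableP.
Qed.

Lemma phi_pos (s : R) : `|s| < b0 -> 0 < phi s.
Proof. by case: adm => _ _ H _; exact: H. Qed.

Lemma phi_den_pos (s : R) : `|s| < b0 -> 0 < phi s - s * p1 s.
Proof.
(* The extreme case c = |s| of admissibility, where the second derivative drops out. *)
case: adm => _ _ _ H sb; have := H s `|s| (lexx _) sb.
by rewrite real_normK ?num_real // subrr mul0r addr0.
Qed.

Lemma near_norm_lt (s : R) : `|s| < b0 -> \forall t \near s, `|t| < b0.
Proof.
move=> sb; have H : `|t| @[t --> s] --> `|s| by apply: norm_continuous.
exact: (cvgr_lt _ H).
Qed.

(** Closed form of dQ/ds, through which [derive1 (Qfun phi)] can be differentiated once more. *)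
Definition Qfun' (s : R) : R := phi s * p2 s / (phi s - s * p1 s) ^+ 2.

Lemma der_den (s : R) : `|s| < b0 ->
  is_derive s 1 (fun t => phi t - t * p1 t) (- (s * p2 s)).
Proof.
move=> sb; eapply derE.
  apply: derB (der_phi 0 sb) _; apply: derM (derId s) (der_phi 1 sb).
by rewrite /=; ring.
Qed.

Lemma der_Qfun (s : R) : `|s| < b0 -> is_derive s 1 (Qfun phi) (Qfun' s).
Proof.
move=> sb; have d0 := phi_den_pos sb; eapply derE.
  apply: derM (der_phi 1 sb) _; apply: (derV _ (der_den sb)); exact: lt0r_neq0.
by rewrite /Qfun' /=; move: (p1 s) (p2 s) d0 => u w d0; field; rewrite gt_eqF.
Qed.

Lemma derive1_Qfun (s : R) : `|s| < b0 -> derive1 (Qfun phi) s = Qfun' s.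
Proof. by move=> sb; rewrite derive1E (der_val (der_Qfun sb)). Qed.

Lemma der_Qfun' (s : R) : `|s| < b0 -> exists d, is_derive s 1 (derive1 (Qfun phi)) d.
Proof.
move=> sb; have d0 := phi_den_pos sb; eexists; apply: (@der_eq _ _ Qfun').
  by apply: filterS (near_norm_lt sb) => t tb; rewrite derive1_Qfun.
apply: derM (derM (der_phi 0 sb) (der_phi 2 sb)) _.
apply: derV (derX 2 (der_den sb)); exact/lt0r_neq0/exprn_gt0.
Qed.

Definition ab_delta (C s : R) : R := phi s - s * p1 s + (C - s ^+ 2) * p2 s.

Lemma ab_delta_continuous (C s : R) : `|s| < b0 -> {for s, continuous (ab_delta C)}.
Proof.
move=> sb; apply: differentiable_continuous; apply/derivable1_diffP.
suff [d [H _]] : exists d, is_derive s 1 (ab_delta C) d by [].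
by eexists; apply: derD (der_den sb) (derM (derB (derC C s 1) (derX 2 (derId s))) (der_phi 2 sb)).
Qed.

Section Chain.
Variables (V : normedModType R) (q be : V -> R) (z v : V) (dq db : R).
Hypothesis q0 : 0 < q z.
Hypothesis sb : `|be z| < b0 * Num.sqrt (q z).
Hypothesis der_q : is_derive z v q dq.
Hypothesis der_b : is_derive z v be db.

Local Notation al w := (Num.sqrt (q w)).
Local Notation s w := (be w / al w).

Let al0 : 0 < al z. Proof. by rewrite sqrtr_gt0. Qed.
Let alK : al z ^+ 2 = q z. Proof. by rewrite sqr_sqrtr // ltW. Qed.

Lemma ratio_lt : `|s z| < b0.
Proof. by rewrite normrM normfV (gtr0_norm al0) ltr_pdivrMr. Qed.

Lemma der_al : is_derive z v (fun w => al w) (dq / (2 * al z)).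
Proof. by apply: derE (der_sqrt q0 der_q) _; rewrite mulrC. Qed.

Definition ratio_d : R := db / al z - s z * dq / (2 * q z).

Lemma der_ratio : is_derive z v (fun w => s w) ratio_d.
Proof.
have a0 := lt0r_neq0 al0; apply: derE (derM der_b (derV (f := fun w => al w) a0 der_al)) _.
by rewrite /ratio_d; move: alK a0; move: (al z) => A <- a0; field.
Qed.

Lemma der_ratio_comp (f : R -> R) d : is_derive (s z) 1 f d ->
  is_derive z v (fun w => f (s w)) (d * ratio_d).
Proof. by move=> hf; exact: (der_comp (g := fun w => s w) hf der_ratio). Qed.

Let ratio_dE : ratio_d = (db - s z * dq / (2 * al z)) / al z.
Proof.
have a0 := lt0r_neq0 al0.
by rewrite /ratio_d; move: alK a0; move: (al z) => A <- a0; field.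
Qed.

Definition ab_A0 (s : R) : R := phi s * (phi s - s * p1 s).
Definition ab_A1 (s : R) : R := phi s * p1 s.

(** The derivative is along a vector of an arbitrary normed space, so that one chain rule serves
    both x and y. In it [ab_A0] is the partial derivative of F^2 by alpha^2, and alpha times [ab_A1]
    is half of the one by beta. *)
Lemma der_ab_sq : is_derive z v (fun w => (al w * phi (s w)) ^+ 2)
  (ab_A0 (s z) * dq + 2 * (al z * ab_A1 (s z) * db)).
Proof.
apply: derE (derX 2 (derM der_al (der_ratio_comp (der_phi 0 ratio_lt)))) _.
have E (f u r A : R) : A != 0 -> 2 * (A * f) ^+ 1 *
    (dq / (2 * A) * f + A * (u * ((db - r * dq / (2 * A)) / A))) =
    f * (f - r * u) * dq + 2 * (A * (f * u) * db) by move=> A0; field.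
by rewrite ratio_dE; exact: (E _ _ _ _ (lt0r_neq0 al0)).
Qed.

Lemma der_ab_A0 : is_derive z v (fun w => ab_A0 (s w))
  ((ab_A1 (s z) - s z * (p1 (s z) ^+ 2 + phi (s z) * p2 (s z))) * ratio_d).
Proof.
have sb' := ratio_lt; apply: der_ratio_comp.
apply: derE (derM (der_phi 0 sb') (der_den sb')) _.
by rewrite /ab_A1 /= expr2; ring.
Qed.

Lemma der_ab_A1 : is_derive z v (fun w => al w * ab_A1 (s w))
  (dq / (2 * al z) * ab_A1 (s z) +
   al z * ((p1 (s z) ^+ 2 + phi (s z) * p2 (s z)) * ratio_d)).
Proof.
have sb' := ratio_lt; apply: derM der_al _; apply: der_ratio_comp.
by apply: derE (derM (der_phi 0 sb') (der_phi 1 sb')) _; rewrite expr2.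
Qed.

(** The factor P = alpha Q(s) of the spray; [ab_Pq] and [ab_Pb] are its partial derivatives by
    alpha^2 and by beta. *)
Definition ab_P w : R := al w * Qfun phi (s w).
Definition ab_Pq w : R := (Qfun phi (s w) - s w * derive1 (Qfun phi) (s w)) / (2 * al w).
Definition ab_Pb w : R := derive1 (Qfun phi) (s w).

Lemma der_ab_P : is_derive z v ab_P (ab_Pq z * dq + ab_Pb z * db).
Proof.
have sb' := ratio_lt; apply: derE (derM der_al (der_ratio_comp (der_Qfun sb'))) _.
have E (f u r A : R) : A != 0 ->
    dq / (2 * A) * f + A * (u * ((db - r * dq / (2 * A)) / A)) =
    (f - r * u) / (2 * A) * dq + u * db by move=> A0; field.
by rewrite ratio_dE /ab_Pq /ab_Pb derive1_Qfun //; exact: (E _ _ _ _ (lt0r_neq0 al0)).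
Qed.

Lemma der_ab_Pb : is_derive z v ab_Pb ('D_v ab_Pb z).
Proof.
have [d dE] := der_Qfun' ratio_lt.
have [H _] := der_ratio_comp dE; exact: derivableP.
Qed.

Lemma der_ab_Pq : is_derive z v ab_Pq ('D_v ab_Pq z).
Proof.
have [d dE] := der_Qfun' ratio_lt; apply: derivableP.
have H1 := derB (der_ratio_comp (der_Qfun ratio_lt)) (derM der_ratio (der_ratio_comp dE)).
have a0 : 2 * al z != 0 by rewrite mulf_neq0 ?pnatr_eq0 // gt_eqF.
by have [] := derM H1 (derV (f := fun w => 2 * al w) a0 (der_scale 2 der_al)).
Qed.

End Chain.

Definition ab_domain (q be : R) := 0 < q /\ `|be| < b0 * Num.sqrt q.

Lemma near_ab_domain (V : normedModType R) (q be : V -> R) z :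
  {for z, continuous q} -> {for z, continuous be} ->
  ab_domain (q z) (be z) -> \forall w \near z, ab_domain (q w) (be w).
Proof.
move=> qc bc [q0 sb].
have H1 : \forall w \near z, 0 < q w by apply: (cvgr_gt _ qc).
have H2 : \forall w \near z, `|be w| - b0 * Num.sqrt (q w) < 0.
  apply: (@cvgr_lt _ _ _ _ _ (`|be z| - b0 * Num.sqrt (q z))); last by rewrite subr_lt0.
  apply: cvgB; first exact: (continuous_comp bc (@norm_continuous _ _ _)).
  by apply: cvgMr; apply: (continuous_comp qc (@sqrt_continuous _ _)).
by apply: filterS2 H1 H2 => w ? ?; split=> //; rewrite -subr_lt0.
Qed.

Lemma near_ab_delta (C : R) (V : normedModType R) (q be : V -> R) z :
  {for z, continuous q} -> {for z, continuous be} ->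
  ab_domain (q z) (be z) -> 0 < ab_delta C (be z / Num.sqrt (q z)) ->
  \forall w \near z, 0 < ab_delta C (be w / Num.sqrt (q w)).
Proof.
move=> qc bc [q0 sb] d0.
have sb' := ratio_lt q0 sb.
have sc : be w / Num.sqrt (q w) @[w --> z] --> be z / Num.sqrt (q z).
  apply: cvgM => //; apply: cvgV; first by rewrite gt_eqF // sqrtr_gt0.
  exact: (continuous_comp qc (@sqrt_continuous _ _)).
have cd : ab_delta C (be w / Num.sqrt (q w)) @[w --> z] -->
    ab_delta C (be z / Num.sqrt (q z)).
  exact: (cvg_comp _ _ sc (@ab_delta_continuous C _ sb')).
exact: (cvgr_gt _ cd).
Qed.

End PhiFunction.

Section AlphaBetaMetric.
Context {R : realType}.
Variables (a : 'rV[R]_3 -> 'M[R]_3) (b : 'rV[R]_3 -> 'rV[R]_3) (C : R).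
Hypothesis K : killing_chart a b C.
Variables (phi : R -> R) (b0 : R) (F : 'rV[R]_3 -> 'rV[R]_3 -> R).
Hypothesis adm : admissible b0 phi.
Implicit Types (x y : 'rV[R]_3) (i j k l m n : 'I_3).

Local Notation e k := (delta_mx ord0 k).
Local Notation q x y := (pair3 (y ord0) (mulv (a x) (y ord0))).
Local Notation be x y := (pair3 (b x ord0) (y ord0)).
Local Notation low x y i := (mulv (a x) (y ord0) i).
Local Notation al x y := (Num.sqrt (q x y)).
Local Notation s x y := (be x y / al x y).
Local Notation p1 := (derive1 phi).
Local Notation p2 := (derive1n 2 phi).

Hypothesis F_eq : forall x y, F x y = al x y * phi (s x y).

Definition ab_dom x y := ab_domain b0 (q x y) (be x y).
(** On [ab_dom] this is equivalent to [finsler_at], by [ab_good_finsler] and [finsler_ab_good]; as a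
    strict inequality between continuous functions it visibly defines an open set. *)
Definition ab_good x y := ab_dom x y /\ 0 < ab_delta phi C (s x y).

Let a_smooth := kc_a_smooth K.
Let a_sym := kc_a_sym K.
Let b_smooth := kc_b_smooth K.
Let killing := kc_killing K.
Let a_unit := kc_unit K.

Let der_qx x y k : is_derive x (e k) (fun x => q x y) (q_dx a x y k).
Proof. exact: der_q_x. Qed.
Let der_qy x y k : is_derive y (e k) (fun y => q x y) (2 * low x y k).
Proof. exact: der_q_y. Qed.
Let der_bx x y k : is_derive x (e k) (fun x => be x y) (be_dx a b x y k).
Proof. exact: der_be_x. Qed.
Let der_by x y k : is_derive y (e k) (fun y => be x y) (b x ord0 k).
Proof. exact: der_be_y. Qed.

Let q_cont_x x y : {for x, continuous (fun x => q x y)}.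
Proof.
apply: smooth_continuous; apply: smooth_sum => i _; apply: smoothM; first exact: smooth_cst.
by apply: smooth_sum => j _; apply: smoothM => //; exact: smooth_cst.
Qed.
Let be_cont_x x y : {for x, continuous (fun x => be x y)}.
Proof.
apply: smooth_continuous; apply: smooth_sum => i _; apply: smoothM => //; exact: smooth_cst.
Qed.
Let q_cont_y x y : {for y, continuous (fun y => q x y)}.
Proof.
apply: smooth_continuous; apply: smooth_sum => i _; apply: smoothM; first exact: smooth_coord.
by apply: smooth_sum => j _; apply: smoothM; [exact: smooth_cst|exact: smooth_coord].
Qed.
Let be_cont_y x y : {for y, continuous (fun y => be x y)}.
Proof.
apply: smooth_continuous; apply: smooth_sum => i _; apply: smoothM; [exact: smooth_cst|exact: smooth_coord].
Qed.

Lemma ab_dom_y x y : ab_dom x y -> \forall z \near y, ab_dom x z.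
Proof.
exact: (near_ab_domain (q := fun y => q x y) (be := fun y => be x y) (@q_cont_y x y) (@be_cont_y x y)).
Qed.

Lemma ab_good_y x y : ab_good x y -> \forall z \near y, ab_good x z.
Proof.
move=> [d g]; have H1 := ab_dom_y d.
have H2 := near_ab_delta adm (q := fun y => q x y) (be := fun y => be x y) (@q_cont_y x y) (@be_cont_y x y) d g.
exact: filterS2 H1 H2.
Qed.

Lemma ab_good_x x y : ab_good x y -> \forall z \near x, ab_good z y.
Proof.
move=> [d g]; have H1 := near_ab_domain (q := fun x => q x y) (be := fun x => be x y) (@q_cont_x x y) (@be_cont_x x y) d.
have H2 := near_ab_delta adm (q := fun x => q x y) (be := fun x => be x y) (@q_cont_x x y) (@be_cont_x x y) d g.
exact: filterS2 H1 H2.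
Qed.

Let A0 x y := ab_A0 phi (s x y).
Let A1 x y := al x y * ab_A1 phi (s x y).
Let rd j x y := ratio_d (fun y => q x y) (fun y => be x y) y (2 * low x y j) (b x ord0 j).
Let A0y j x y :=
  (ab_A1 phi (s x y) - s x y * (p1 (s x y) ^+ 2 + phi (s x y) * p2 (s x y))) * rd j x y.
Let A1y j x y := 2 * low x y j / (2 * al x y) * ab_A1 phi (s x y)
  + al x y * ((p1 (s x y) ^+ 2 + phi (s x y) * p2 (s x y)) * rd j x y).

Let sqF x y : sq F x y = (al x y * phi (s x y)) ^+ 2.
Proof. by rewrite /sq F_eq. Qed.

Let der_Lx x y k : ab_dom x y -> is_derive x (e k)
  (fun x => sq F x y) (A0 x y * q_dx a x y k + 2 * (A1 x y * be_dx a b x y k)).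
Proof.
move=> [q0 sb]; apply: (@der_ext _ _ (fun x => (al x y * phi (s x y)) ^+ 2)).
  by move=> z; rewrite sqF.
exact: (der_ab_sq adm (q := fun x => q x y) (be := fun x => be x y) q0 sb (der_qx x y k) (der_bx x y k)).
Qed.

Let der_Ly x y k : ab_dom x y -> is_derive y (e k)
  (sq F x) (2 * (A0 x y * low x y k + A1 x y * b x ord0 k)).
Proof.
move=> [q0 sb]; apply: (@der_ext _ _ (fun y => (al x y * phi (s x y)) ^+ 2)).
  by move=> z; rewrite sqF.
have H := der_ab_sq adm (q := fun y => q x y) (be := fun y => be x y) q0 sb (der_qy x y k) (der_by x y k).
by apply: derE H _; rewrite /A0 /A1; ring.
Qed.

Let der_A0y x y k : ab_dom x y -> is_derive y (e k) (A0 x) (A0y k x y).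
Proof.
move=> [q0 sb].
exact: (der_ab_A0 adm (q := fun y => q x y) (be := fun y => be x y) q0 sb (der_qy x y k) (der_by x y k)).
Qed.

Let der_A1y x y k : ab_dom x y -> is_derive y (e k) (A1 x) (A1y k x y).
Proof.
move=> [q0 sb].
exact: (der_ab_A1 adm (q := fun y => q x y) (be := fun y => be x y) q0 sb (der_qy x y k) (der_by x y k)).
Qed.

Let fund x y i j : ab_dom x y -> fundamental F x y i j =
  A0 x y * a x i j + (A0y j x y * low x y i + A1y j x y * b x ord0 i).
Proof.
apply: (@fundamental_eq _ a b F A0 A1 A0y A1y ab_dom) => //.
exact: ab_dom_y.
Qed.

Let al_gt0 x y : 0 < q x y -> 0 < al x y. Proof. by rewrite sqrtr_gt0. Qed.
Let al_sq x y : 0 < q x y -> al x y ^+ 2 = q x y.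
Proof. by move=> q0; rewrite sqr_sqrtr // ltW. Qed.

Lemma fundamental_form x y v : ab_dom x y ->
  dot (v *m fundamental F x y) v =
  ab_form (a x) (b x ord0) (y ord0) (al x y) (s x y) (phi (s x y)) (p1 (s x y))
    (p2 (s x y)) (v ord0).
Proof.
move=> d; have [q0 _] := d; rewrite dot_mul.
under eq_bigr do under eq_bigr do rewrite fund //.
have A0' := lt0r_neq0 (al_gt0 q0); have := al_sq q0.
rewrite /A0y /A1y /rd /ratio_d /A0 /ab_A0 /ab_A1 /ab_form /bil.
move: A0'; move: (al x y) => A; move: (q x y) => Q A0' <-.
move: (v ord0) (y ord0) (b x ord0) (a x) (be x y / A) (p2 _) (p1 _) (phi _).
by move=> v' y' b' a' r u2 u1 u0; rewrite /pair3 /mulv !sum3; field.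
Qed.

Let form_side x y : ab_dom x y -> [/\ 0 < al x y, al x y ^+ 2 = bil (a x) (y ord0) (y ord0),
  s x y * al x y = pair3 (b x ord0) (y ord0), 0 < phi (s x y) & 0 < phi (s x y) - s x y * p1 (s x y)].
Proof.
move=> [q0 sb]; have sb' : `|s x y| < b0.
  exact: (@ratio_lt _ b0 _ (fun y => q x y) (fun y => be x y) y).
split; first exact: al_gt0.
- exact: al_sq.
- by rewrite divfK // gt_eqF // al_gt0.
- exact: (phi_pos adm).
- exact: (phi_den_pos adm).
Qed.

Let row_of (v : 'I_3 -> R) : 'rV[R]_3 := \row_i v i.
Let row_ofE v i : row_of v ord0 i = v i. Proof. by rewrite mxE. Qed.

Lemma ab_good_posdef x y : ab_good x y -> posdef (fundamental F x y).
Proof.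
move=> [d g] v v0; rewrite fundamental_form //.
have [h1 h2 h3 h4 h5] := form_side d.
apply: (@ab_form_gt0 _ (a x) (b x ord0) (sharp a b x) (y ord0) _ _ C) => //.
- exact: (kc_a_pos K).
- by move=> i; apply: sharp_low K _ _.
- by apply: sharp_norm K _.
- by have /matrix0Pn[i [j H]] := v0; exists j; move: H; rewrite [i]ord1.
Qed.

Lemma finsler_ab_good x y : ab_dom x y -> finsler_at F x y -> ab_good x y.
Proof.
move=> d [_ P]; split=> //; have [h1 h2 h3 h4 h5] := form_side d.
apply: (@ab_form_delta _ (a x) (b x ord0) (sharp a b x) (y ord0) (al x y) _ C) => //.
- exact: (kc_a_pos K).
- by move=> i; apply: sharp_low K _ _.
- by apply: sharp_norm K _.
- move=> v [i vi]; have := P (row_of v); rewrite fundamental_form //.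
  have -> : row_of v ord0 = v by apply/funext => j; rewrite row_ofE.
  apply; apply/matrix0Pn; exists ord0, i; by rewrite row_ofE.
Qed.

Lemma ab_good_finsler x y : ab_good x y -> finsler_at F x y.
Proof.
move=> g; split; last exact: ab_good_posdef.
by have [d _] := g; have [h1 h2 h3 h4 h5] := form_side d; rewrite F_eq mulr_gt0.
Qed.

Lemma posdef_unit (M : 'M[R]_3) : posdef M -> M \in unitmx.
Proof.
move=> P; apply: pos_unitmx => v [i vi].
have := P (row_of v); rewrite dot_mul => H.
have -> : bil M v v = \sum_j (\sum_i row_of v ord0 i * M i j) * row_of v ord0 j.
  under eq_bigr do under eq_bigr do rewrite row_ofE.
  under [in RHS]eq_bigr do rewrite row_ofE.
  by rewrite /bil /pair3 /mulv !sum3; ring.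
by apply: H; apply/matrix0Pn; exists ord0, i; rewrite row_ofE.
Qed.

Let A_sym x y i l : ab_good x y ->
  A0y i x y * low x y l + A1y i x y * b x ord0 l =
  A0y l x y * low x y i + A1y l x y * b x ord0 i.
Proof.
move=> [d _]; have [q0 _] := d.
have A0' := lt0r_neq0 (al_gt0 q0); have := al_sq q0.
rewrite /A0y /A1y /rd /ratio_d /ab_A1.
move: A0'; move: (al x y) => A; move: (q x y) => Q A0' <-.
move: (b x ord0 i) (b x ord0 l) (low x y i) (low x y l) (be x y / A) (p2 _) (p1 _) (phi _).
by move=> t1 t2 t3 t4 r u2 u1 u0; field.
Qed.

Local Notation P x y := (ab_P phi (fun w : 'rV[R]_3 => q x w) (fun w : 'rV[R]_3 => be x w) y).
Local Notation Pq x y := (ab_Pq phi (fun w : 'rV[R]_3 => q x w) (fun w : 'rV[R]_3 => be x w) y).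
Local Notation Pb x y := (ab_Pb phi (fun w : 'rV[R]_3 => q x w) (fun w : 'rV[R]_3 => be x w) y).

Lemma ab_geodesic x y i : ab_good x y ->
  geodesic_coef F i x y = spray a i x y + P x y * mulv (s_up a b x) (y ord0) i.
Proof.
move=> g; apply: (@geodesic_perturbed _ a b a_sym a_unit (form_s_up K) F A0 A1
   (fun x y => P x y) A0y A1y ab_good) => //.
- by move=> x' y' /ab_good_y.
- by move=> x' y' k [d _]; exact: der_Lx.
- by move=> x' y' k [d _]; exact: der_Ly.
- by move=> x' y' k [d _]; exact: der_A0y.
- by move=> x' y' k [d _]; exact: der_A1y.
- by move=> x' y' g'; apply: posdef_unit; exact: ab_good_posdef.
- move=> x' y' [d _]; have [h1 h2 h3 h4 h5] := form_side d.
  rewrite /A1 /A0 /ab_P /ab_A0 /ab_A1 /Qfun.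
  by move: (al x' y') (s x' y') (p1 _) (phi _) h5 => A r w u h5; field; rewrite gt_eqF.
Qed.

Definition P_fiber k x y : R := 2 * Pq x y * low x y k + Pb x y * b x ord0 k.

Lemma ab_riemann i k x y : ab_good x y ->
  riemann_curv F i k x y = spray_riemann a i k x y +
  (3 * (2 * P x y * Pq x y - Pb x y) * mulv (s_form a b x) (y ord0) k
     * mulv (s_up a b x) (y ord0) i
  + P x y * (2 * be x y * (i == k)%:R - low x y k * sharp a b x i - y ord0 i * b x ord0 k)
  - P_fiber k x y * (be x y * y ord0 i - q x y * sharp a b x i)
  - P x y * P_fiber k x y * (C * y ord0 i - be x y * sharp a b x i)
  + P x y ^+ 2 * (C * (i == k)%:R - sharp a b x i * b x ord0 k)).
Proof.
move=> g; apply: (@riemann_perturbed _ a b a_smooth a_sym a_unit b_smooth F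
  (fun x y => P x y) (fun x y => Pq x y) (fun x y => Pb x y)
  (fun k x y => 'D_(e k) (fun y => Pq x y) y) (fun k x y => 'D_(e k) (fun y => Pb x y) y)
  ab_good) => //.
- by move=> x' y' /ab_good_x.
- by move=> x' y' /ab_good_y.
- by move=> x' y' j g'; exact: ab_geodesic.
- move=> x' y' j [[q0 sb] _].
  exact: (der_ab_P adm (q := fun x => q x y') (be := fun x => be x y') q0 sb (der_qx x' y' j) (der_bx x' y' j)).
- move=> x' y' j [[q0 sb] _].
  have H := der_ab_P adm (q := fun y => q x' y) (be := fun y => be x' y) q0 sb (der_qy x' y' j) (der_by x' y' j).
  by apply: derE H _; rewrite /P_dy; ring.
- move=> x' y' j [[q0 sb] _].
  exact: (der_ab_Pq adm (q := fun y => q x' y) (be := fun y => be x' y) q0 sb (der_qy x' y' j) (der_by x' y' j)).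
- move=> x' y' j [[q0 sb] _].
  exact: (der_ab_Pb adm (q := fun y => q x' y) (be := fun y => be x' y) q0 sb (der_qy x' y' j) (der_by x' y' j)).
- exact: (form_s_up K).
- exact: (s_up_sq K).
- exact: (cov_s_up_killing K).
Qed.

End AlphaBetaMetric.

(** * Curvature of alpha and of F *)

Local Opaque pd christoffel.

Section RiemannianCurvature.
Context {R : realType}.
Variable a : 'rV[R]_3 -> 'M[R]_3.
Implicit Types (x y : 'rV[R]_3) (i j k l m n : 'I_3).
Hypothesis a_smooth : forall i j, smooth (fun x => a x i j).
Hypothesis a_sym : forall x i j, a x i j = a x j i.
Hypothesis a_unit : forall x, a x \in unitmx.

Local Notation e k := (delta_mx ord0 k).
Local Notation Gam := (christoffel a).
Local Notation q x y := (pair3 (y ord0) (mulv (a x) (y ord0))).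

Section Alpha.
Variable F : 'rV[R]_3 -> 'rV[R]_3 -> R.
Hypothesis F_sq : forall x y, sq F x y = q x y.

(** The perturbed spray with b = 0, P = 0 and F^2 = alpha^2, that is A0 = 1 and A1 = 0, every point
    being good. *)
Lemma alpha_geodesic i x y : geodesic_coef F i x y = spray a i x y.
Proof.
have b_s x' n : \sum_m (0 : 'rV[R]_3) ord0 m * s_up a (fun=> 0) x' m n = 0.
  by apply: big1 => m _; rewrite mxE mul0r.
have fund x' y' i' j' : fundamental F x' y' i' j' = 1 * a x' i' j' + (0 * mulv (a x') (y' ord0) i' + 0 * (0 : 'rV[R]_3) ord0 i').
  apply: (@fundamental_eq _ a (fun=> 0) F (fun _ _ => 1) (fun _ _ => 0) (fun _ _ _ => 0)
    (fun _ _ _ => 0) (fun _ _ => True)) => //.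
  - by move=> *; exact: filterE.
  - move=> x0 y0 k _; apply: (@der_ext _ _ (fun y => q x0 y)) => [w|]; first by rewrite F_sq.
    apply: derE; first exact: der_q_y.
    by rewrite mul1r mul0r addr0.
transitivity (spray a i x y + 0 * mulv (s_up a (fun=> 0) x) (y ord0) i);
  last by rewrite mul0r addr0.
apply: (@geodesic_perturbed _ a (fun=> 0) a_sym a_unit b_s F (fun _ _ => 1) (fun _ _ => 0)
  (fun _ _ => 0) (fun _ _ _ => 0) (fun _ _ _ => 0) (fun _ _ => True)) => //.
- by move=> *; exact: filterE.
- move=> x0 y0 k _; apply: (@der_ext _ _ (fun x => q x y0)) => [w|]; first by rewrite F_sq.
  apply: derE; first exact: der_q_x.
  by rewrite mul1r mul0r mulr0 addr0.
- move=> x0 y0 k _; apply: (@der_ext _ _ (fun y => q x0 y)) => [w|]; first by rewrite F_sq.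
  apply: derE; first exact: der_q_y.
  by rewrite mul1r mul0r addr0.
- by move=> *; rewrite !mul0r.
- move=> x0 y0 _; suff -> : fundamental F x0 y0 = a x0 by [].
  by apply/matrixP => i' j'; rewrite fund; ring.
- by move=> *; rewrite mul0r.
Qed.

Lemma alpha_riemann i k x y : riemann_curv F i k x y = spray_riemann a i k x y.
Proof.
have G : geodesic_coef F = fun i => spray a i.
  by apply/funext => j; apply/funext => x'; apply/funext => y'; exact: alpha_geodesic.
have Gx j m : dx m (spray a j) = fun x y => spray_dx a j x y m.
  apply/funext => x'; apply/funext => y'; apply: der_val; exact: der_spray_x.
have Gy j m : dy m (spray a j) = fun x y => spray_dy a j x y m.
  apply/funext => x'; apply/funext => y'; apply: der_val; exact: der_spray_y.
rewrite /riemann_curv G /spray_riemann Gx.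
congr (_ - _ + 2 * _ - _); apply: eq_bigr => m _.
- by congr (_ * _); rewrite Gx; apply: der_val; exact: der_spray_dx.
- by congr (_ * _); rewrite Gy; apply: der_val; exact: der_spray_dy.
- by rewrite !Gy.
Qed.

End Alpha.

(** The identity holds for arbitrary arrays in place of the Christoffel symbols and their
    derivatives: it belongs to sprays, not to metrics. *)
Lemma spray_riemann_ker i x y : \sum_k spray_riemann a i k x y * y ord0 k = 0.
Proof.
rewrite /spray_riemann /spray_dx /spray_dy /spray.
have E (D : 'I_3 -> 'I_3 -> 'I_3 -> R) (G : 'I_3 -> 'I_3 -> 'I_3 -> R) (w : 'I_3 -> R) :
  \sum_k (2 * (2^-1 * \sum_n (\sum_l D k n l * w l) * w n)
    - \sum_m 2^-1 * (\sum_n (D m k n + D m n k) * w n) * w m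
    + 2 * \sum_m (2^-1 * \sum_n (\sum_l G m n l * w l) * w n) * G i m k
    - \sum_m (\sum_l G i m l * w l) * (\sum_l G m k l * w l)) * w k = 0.
  by rewrite !sum3; field.
exact: (E (fun k n l => pd k (christoffel a i n l) x) (fun i j k => christoffel a i j k x)).
Qed.

Definition spray_riemann_coef i k j l x : R :=
  pd k (Gam i j l) x - 2^-1 * (pd l (Gam i k j) x + pd l (Gam i j k) x)
  + \sum_m Gam m j l x * Gam i m k x - \sum_m Gam i m j x * Gam m k l x.

Lemma spray_riemann_quad i k x y : spray_riemann a i k x y =
  \sum_j \sum_l spray_riemann_coef i k j l x * (y ord0 j * y ord0 l).
Proof.
rewrite /spray_riemann /spray_dx /spray_dy /spray /spray_riemann_coef.
have E (D : 'I_3 -> 'I_3 -> 'I_3 -> R) (G : 'I_3 -> 'I_3 -> 'I_3 -> R) (w : 'I_3 -> R) :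
  2 * (2^-1 * \sum_n (\sum_l D k n l * w l) * w n)
    - \sum_m 2^-1 * (\sum_n (D m k n + D m n k) * w n) * w m
    + 2 * \sum_m (2^-1 * \sum_n (\sum_l G m n l * w l) * w n) * G i m k
    - \sum_m (\sum_l G i m l * w l) * (\sum_l G m k l * w l) =
  \sum_j \sum_l (D k j l - 2^-1 * (D l k j + D l j k) + \sum_m G m j l * G i m k
     - \sum_m G i m j * G m k l) * (w j * w l).
  by rewrite !sum3; field.
exact: (E (fun k n l => pd k (christoffel a i n l) x) (fun i j k => christoffel a i j k x)).
Qed.

Let dd k j i l x : R := pd k (pd j (fun z => a z i l)) x.

Let ddC k j i l x : dd k j i l x = dd j k i l x.
Proof. exact: pdC. Qed.

Let dd_sym k j i l x : dd k j i l x = dd k j l i x.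
Proof.
rewrite /dd; congr (pd k (pd j _) x); apply/funext => z; exact: a_sym.
Qed.

Lemma pd_christoffel_lower x k i j l : \sum_m a x i m * pd k (Gam m j l) x =
  2^-1 * (dd k j i l x + dd k l i j x - dd k i j l x)
  - \sum_m (\sum_n (a x i n * Gam n m k x + a x m n * Gam n i k x)) * Gam m j l x.
Proof.
under [X in _ - X]eq_bigr do rewrite -(pd_metric a_sym a_unit).
have D : pd k (fun z => \sum_m a z i m * Gam m j l z) x =
    \sum_m (pd k (fun z => a z i m) x * Gam m j l x + a x i m * pd k (Gam m j l) x).
  apply: der_val; apply: der_sum => m; apply: derM; apply: der_pd; first exact: a_smooth.
  exact: christoffel_smooth.
have D' : pd k (fun z => \sum_m a z i m * Gam m j l z) x =
    2^-1 * (dd k j i l x + dd k l i j x - dd k i j l x).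
  apply: der_val; apply: (@der_ext _ _ (fun z => 2^-1 * (pd j (fun z => a z i l) z
     + pd l (fun z => a z i j) z - pd i (fun z => a z j l) z))).
    by move=> w; rewrite (christoffel_lower a_unit).
  by apply: der_scale; apply: derB; first apply: derD; apply: der_pd; apply: smooth_pd.
by rewrite -D' D big_split /= addrAC subrr add0r.
Qed.

(** Lowering the index replaces derivatives of Christoffel symbols by second derivatives of [a]; in
    the resulting expression [L] the exchange of [i] and [k] only permutes summands, by [pdC] and
    the symmetry of [a] and of the Christoffel symbols. *)
Lemma spray_riemann_sym x y i k :
  \sum_m a x i m * spray_riemann a m k x y = \sum_m a x k m * spray_riemann a m i x y.
Proof.
pose w := y ord0.
pose g m := 2^-1 * \sum_n (\sum_l Gam m n l x * w l) * w n.
pose N m n := \sum_l Gam m n l x * w l.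
have L i' k' : \sum_m a x i' m * spray_riemann a m k' x y =
  2^-1 * (\sum_j \sum_l dd k' j i' l x * (w j * w l) - \sum_j \sum_l dd k' i' j l x * (w j * w l)
    - \sum_j \sum_l dd l j i' k' x * (w j * w l) + \sum_j \sum_l dd i' j k' l x * (w j * w l))
  - 2 * \sum_m \sum_n g m * (a x m n * Gam n i' k' x)
  + \sum_m \sum_n a x m n * (N n i' * N m k').
  have E (D : 'I_3 -> 'I_3 -> 'I_3 -> 'I_3 -> R) (A : 'I_3 -> 'I_3 -> R)
      (G : 'I_3 -> 'I_3 -> 'I_3 -> R) : (forall m p n l, D m p n l = D m p l n) ->
    \sum_m A i' m * (2 * (2^-1 * \sum_n (\sum_l D m k' n l * w l) * w n)
      - \sum_p 2^-1 * (\sum_n (D m p k' n + D m p n k') * w n) * w p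
      + 2 * \sum_p (2^-1 * \sum_n (\sum_l G p n l * w l) * w n) * G m p k'
      - \sum_p (\sum_l G m p l * w l) * (\sum_l G p k' l * w l)) =
    \sum_j \sum_l (\sum_m A i' m * D m k' j l) * (w j * w l)
    - \sum_j \sum_l (\sum_m A i' m * D m l j k') * (w j * w l)
    + 2 * \sum_p (2^-1 * \sum_n (\sum_l G p n l * w l) * w n) * (\sum_m A i' m * G m p k')
    - \sum_m \sum_p A i' m * ((\sum_l G m p l * w l) * (\sum_l G p k' l * w l)).
    by move=> Ds; rewrite !sum3 !(Ds _ _ k'); field.
  have Gs := christoffel_sym a_sym.
  transitivity (\sum_j \sum_l (\sum_m a x i' m * pd k' (Gam m j l) x) * (w j * w l)
    - \sum_j \sum_l (\sum_m a x i' m * pd l (Gam m j k') x) * (w j * w l)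
    + 2 * \sum_p g p * (\sum_m a x i' m * Gam m p k' x)
    - \sum_m \sum_p a x i' m * (N m p * N p k')).
    apply: (E (fun m k n l => pd k (Gam m n l) x) (a x) (fun i j k => Gam i j k x)).
    by move=> m p n l; congr (pd p _ x); apply/funext => z; exact: Gs.
  have E2 (D : 'I_3 -> 'I_3 -> 'I_3 -> 'I_3 -> R) (A : 'I_3 -> 'I_3 -> R)
      (G : 'I_3 -> 'I_3 -> 'I_3 -> R) (X1 X2 : 'I_3 -> 'I_3 -> R) :
    (forall m n, A m n = A n m) -> (forall l m n, G l m n = G l n m) ->
    (forall j l, X1 j l = 2^-1 * (D k' j i' l + D k' l i' j - D k' i' j l)
       - \sum_m (\sum_n (A i' n * G n m k' + A m n * G n i' k')) * G m j l) ->
    (forall j l, X2 j l = 2^-1 * (D l j i' k' + D k' l i' j - D i' l k' j)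
       - \sum_m (\sum_n (A i' n * G n m l + A m n * G n i' l)) * G m j k') ->
    let g' m := 2^-1 * \sum_n (\sum_l G m n l * w l) * w n in
    let N' m n := \sum_l G m n l * w l in
    \sum_j \sum_l X1 j l * (w j * w l) - \sum_j \sum_l X2 j l * (w j * w l)
    + 2 * \sum_p g' p * (\sum_m A i' m * G m p k')
    - \sum_m \sum_p A i' m * (N' m p * N' p k') =
    2^-1 * (\sum_j \sum_l D k' j i' l * (w j * w l) - \sum_j \sum_l D k' i' j l * (w j * w l)
      - \sum_j \sum_l D l j i' k' * (w j * w l) + \sum_j \sum_l D i' j k' l * (w j * w l))
    - 2 * \sum_m \sum_n g' m * (A m n * G n i' k')
    + \sum_m \sum_n A m n * (N' n i' * N' m k').
    move=> As Gs' X1E X2E g' N'; rewrite /g' /N' !sum3 !X1E !X2E !sum3.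
    rewrite !(Gs' _ _ k') !(Gs' _ _ i') !(Gs' _ o1 o0) !(Gs' _ o2 o0) !(Gs' _ o2 o1).
    by rewrite (As o1 o0) (As o2 o0) (As o2 o1); field.
  apply: (E2 (fun k j i l => dd k j i l x) (a x) (fun i j k => Gam i j k x)).
  - exact: a_sym.
  - by move=> l m n; exact: Gs.
  - by move=> j l; exact: pd_christoffel_lower.
  - by move=> j l; rewrite pd_christoffel_lower (ddC l k') (ddC l i') (dd_sym i' l j k').
apply: (etrans (L i k)); apply: (etrans _ (esym (L k i))).
have E (t1 t6 t3 t3' t5 t5' u u' v v' : R) : t3 = t3' -> t5 = t5' -> u = u' -> v = v' ->
  2^-1 * (t1 - t3 - t5 + t6) - 2 * u + v = 2^-1 * (t6 - t3' - t5' + t1) - 2 * u' + v'.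
  by move=> -> -> -> ->; ring.
apply: E.
- by apply: eq_bigr => j _; apply: eq_bigr => l _; exact: (congr1 ( *%R^~ _) (ddC _ _ _ _ _)).
- by apply: eq_bigr => j _; apply: eq_bigr => l _; exact: (congr1 ( *%R^~ _) (dd_sym _ _ _ _ _)).
- apply: eq_bigr => m _; apply: eq_bigr => n _.
  by rewrite (christoffel_sym a_sym).
- rewrite exchange_big; apply: eq_bigr => m _; apply: eq_bigr => n _.
  by rewrite a_sym; congr (_ * _); exact: mulrC.
Qed.

End RiemannianCurvature.

Local Transparent pd christoffel.

(** * Curvature of alpha from its Ricci curvature *)

Section RicciDeterminesCurvature.
Context {R : realType}.
Variables (a : 'rV[R]_3 -> 'M[R]_3) (b : 'rV[R]_3 -> 'rV[R]_3) (C : R).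
Hypothesis K : killing_chart a b C.
Implicit Types (x y : 'rV[R]_3) (i j k l m n : 'I_3).

Local Notation q x y := (pair3 (y ord0) (mulv (a x) (y ord0))).
Local Notation be x y := (pair3 (b x ord0) (y ord0)).
Local Notation low x y i := (mulv (a x) (y ord0) i).

Hypothesis Ric : forall x y, \sum_m spray_riemann a m m x y =
  2 * q x y - 4 * (C * q x y - be x y ^+ 2).

Let a_sym := kc_a_sym K.
Let a_unit := kc_unit K.

(** The curvature with the prescribed Ricci form: the Kulkarni-Nomizu product of the metric with the
    Schouten tensor (1 - 4C)/2 a + 4 b b, contracted twice with [w]. *)
Let model (A : 'I_3 -> 'I_3 -> R) (c w : 'I_3 -> R) i k : R :=
  let z := mulv A w in let q := pair3 w z in let be := pair3 c w in
  (1 - 4 * C) * (q * A i k - z i * z k)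
  + 4 * (q * (c i * c k) - be * (c i * z k + z i * c k) + be ^+ 2 * A i k).

Let coef (A : 'I_3 -> 'I_3 -> R) (c : 'I_3 -> R) i k j l : R :=
  (1 - 4 * C) * (A j l * A i k - A i j * A k l)
  + 4 * (A j l * (c i * c k) - c j * (c i * A k l + A i l * c k) + c j * c l * A i k).

(** The difference of the two sides is symmetric, annihilates y, and is trace free because the Ricci
    curvatures agree, so [curvature_form_eq0] applies to it. *)
Lemma lowered_curvature x y i k : \sum_m a x i m * spray_riemann a m k x y =
  model (a x) (b x ord0) (y ord0) i k.
Proof.
pose c i k j l := (\sum_m a x i m * spray_riemann_coef a m k j l x)
  - coef (a x) (b x ord0) i k j l.
have cE w i' k' : \sum_j \sum_l c i' k' j l * (w j * w l) =
    (\sum_m a x i' m * spray_riemann a m k' x (\row_j w j))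
    - model (a x) (b x ord0) w i' k'.
  have E (A : 'I_3 -> 'I_3 -> R) (d : 'I_3 -> R) (r : 'I_3 -> 'I_3 -> 'I_3 -> R) (rr : 'I_3 -> R) :
    (forall i j, A i j = A j i) ->
    (forall m, rr m = \sum_j \sum_l r m j l * (w j * w l)) ->
    \sum_j \sum_l ((\sum_m A i' m * r m j l) - coef A d i' k' j l) * (w j * w l) =
    (\sum_m A i' m * rr m) - model A d w i' k'.
    move=> As rE; rewrite /coef /model /pair3 /mulv !sum3 !rE !sum3.
    by rewrite ?(As _ i') ?(As _ k') (As o1 o0) (As o2 o0) (As o2 o1); ring.
  apply: (E (a x) (b x ord0) (fun m j l => spray_riemann_coef a m k' j l x)) => // m.
  rewrite spray_riemann_quad; apply: eq_bigr => j _; apply: eq_bigr => l _.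
  by rewrite !mxE.
suff : \sum_j \sum_l c i k j l * (y ord0 j * y ord0 l) = 0.
  rewrite cE => /eqP; rewrite subr_eq0 => /eqP <-.
  apply: eq_bigr => m _; congr (_ * spray_riemann a m k x _).
  by apply/rowP => j; rewrite mxE.
apply: (@curvature_form_eq0 _ (a x) c) => //.
- exact: kc_det K x.
- move=> w i' k'.
  have E : model (a x) (b x ord0) w i' k' = model (a x) (b x ord0) w k' i'.
    by rewrite /model a_sym; ring.
  by rewrite !cE E (spray_riemann_sym (kc_a_smooth K) a_sym a_unit).
- move=> w i'.
  under eq_bigr do rewrite cE.
  have H : \sum_k' (\sum_m a x i' m * spray_riemann a m k' x (\row_j w j)) * w k' = 0.
    have E (A : 'I_3 -> R) (r : 'I_3 -> 'I_3 -> R) :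
      \sum_k' (\sum_m A m * r m k') * w k' = \sum_m A m * \sum_k' r m k' * w k'.
      by rewrite !sum3; ring.
    rewrite (E (a x i') (fun m k' => spray_riemann a m k' x (\row_j w j))).
    apply: big1 => m _; have := spray_riemann_ker a m x (\row_j w j).
    by under eq_bigr do rewrite mxE; move=> ->; rewrite mulr0.
  have E (f g : 'I_3 -> R) : \sum_k' f k' * w k' = 0 -> \sum_k' g k' * w k' = 0 ->
      \sum_k' (f k' - g k') * w k' = 0.
    by rewrite !sum3 !mulrBl => h1 h2; lra.
  apply: E => //.
  rewrite /model /pair3 /mulv; have as' := a_sym x; move: (a x) as' (b x ord0) => A As d.
  by rewrite !sum3 (As o1 o0) (As o2 o0) (As o2 o1); ring.
- move=> w; under eq_bigr do under eq_bigr do rewrite cE.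
  have E1 (A D r : 'I_3 -> 'I_3 -> R) (dt : R) (f : 'I_3 -> 'I_3 -> R) :
    (forall i j, D i j = D j i) ->
    (forall i j, \sum_m D i m * A m j = dt * (i == j)%:R) ->
    \sum_i \sum_k D i k * ((\sum_m A i m * r m k) - f i k) =
    dt * (\sum_m r m m) - \sum_i \sum_k D i k * f i k.
    move=> Ds DA.
    transitivity ((\sum_k \sum_m (\sum_i D k i * A i m) * r m k) - \sum_i \sum_k D i k * f i k).
      by rewrite !sum3 (Ds o1 o0) (Ds o2 o0) (Ds o2 o1); ring.
    congr (_ - _); rewrite mulr_sumr; apply: eq_bigr => k' _.
    under eq_bigr do rewrite DA -mulrA.
    by rewrite -mulr_sumr sum_delta.
  rewrite (E1 (a x) (adj3 (a x)) (fun m k' => spray_riemann a m k' x (\row_j w j)) (det3 (a x))).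
  + rewrite Ric.
    have w_row : (\row_j w j) ord0 = w by apply/funext => j; rewrite mxE.
    rewrite w_row /model.
    have E2 (D : 'I_3 -> 'I_3 -> R) (A : 'I_3 -> 'I_3 -> R) (z d : 'I_3 -> R) (Q B : R) :
      (forall i j, D i j = D j i) ->
      \sum_i \sum_k D i k * ((1 - 4 * C) * (Q * A i k - z i * z k)
        + 4 * (Q * (d i * d k) - B * (d i * z k + z i * d k) + B ^+ 2 * A i k)) =
      ((1 - 4 * C) * Q + 4 * B ^+ 2) * (\sum_i \sum_k D i k * A i k)
      - (1 - 4 * C) * (\sum_i \sum_k D i k * (z i * z k))
      + 4 * (Q * (\sum_i \sum_k D i k * (d i * d k)) - 2 * B * (\sum_i \sum_k D i k * (z i * d k))).
      by move=> Ds; rewrite !sum3 (Ds o1 o0) (Ds o2 o0) (Ds o2 o1); ring.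
    rewrite E2; last by move=> *; apply: adj3_sym.
    rewrite adj3_trace_metric // adj3_trace // (adj3_norm K).
    have -> : \sum_i0 \sum_k0 adj3 (a x) i0 k0 * (mulv (a x) w i0 * b x ord0 k0) =
              det3 (a x) * pair3 (b x ord0) w.
      under eq_bigr do under eq_bigr do rewrite -(sharp_low K x).
      rewrite adj3_trace // /pair3; congr (_ * _); apply: eq_bigr => j _.
      by rewrite (sharp_low K x) mulrC.
    by move: (pair3 _ _) (pair3 _ _) => B Q; ring.
  + by move=> *; apply: adj3_sym.
  + move=> i' j'.
    transitivity (\sum_m a x j' m * adj3 (a x) m i').
      by apply: eq_bigr => m _; rewrite mulrC a_sym (adj3_sym (a_sym x)).
    by rewrite mul_adj3 // eq_sym.
Qed.

Lemma spray_curvature_eq x y i k : spray_riemann a i k x y =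
  (1 - 4 * C) * (q x y * (i == k)%:R - y ord0 i * low x y k)
  + 4 * (q x y * (sharp a b x i * b x ord0 k)
         - be x y * (sharp a b x i * low x y k + y ord0 i * b x ord0 k)
         + be x y ^+ 2 * (i == k)%:R).
Proof.
move: i; apply: (metric_inj K (x := x)) => i.
rewrite {1}/mulv lowered_curvature /model -{1 2}(sharp_low K x i).
have -> : a x i k = \sum_m a x i m * (m == k)%:R.
  by under eq_bigr do rewrite mulrC eq_sym; rewrite sum_delta.
move: (q x y) (be x y) => Q B.
by move: (a x) (b x ord0) (y ord0) (sharp a b x) => A d w h; rewrite /mulv !sum3; ring.
Qed.

End RicciDeterminesCurvature.

Section AlphaBetaCurvature.
Context {R : realType}.
Variables (a : 'rV[R]_3 -> 'M[R]_3) (b : 'rV[R]_3 -> 'rV[R]_3) (C : R).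
Hypothesis K : killing_chart a b C.
Variables (phi : R -> R) (b0 : R) (F : 'rV[R]_3 -> 'rV[R]_3 -> R).
Hypothesis adm : admissible b0 phi.
Implicit Types (x y : 'rV[R]_3) (i j k l m n : 'I_3).

Local Notation q x y := (pair3 (y ord0) (mulv (a x) (y ord0))).
Local Notation be x y := (pair3 (b x ord0) (y ord0)).
Local Notation low x y i := (mulv (a x) (y ord0) i).
Local Notation al x y := (Num.sqrt (q x y)).
Local Notation s x y := (be x y / al x y).
Local Notation U i x y := (mulv (s_up a b x) (y ord0) i).
Local Notation Q := (Qfun phi).

Hypothesis F_eq : forall x y, F x y = al x y * phi (s x y).

Let al_gt0 x y : ab_dom a b b0 x y -> 0 < al x y.
Proof. by move=> [q0 _]; rewrite sqrtr_gt0. Qed.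

Let al_sq x y : ab_dom a b b0 x y -> q x y = al x y ^+ 2.
Proof. by move=> [q0 _]; rewrite sqr_sqrtr // ltW. Qed.

Let ratio_bound x y : ab_dom a b b0 x y -> `|s x y| < b0.
Proof. by move=> [q0 sb]; exact: (@ratio_lt _ b0 _ (fun y => q x y) (fun y => be x y) y). Qed.

Lemma s_up_lower_y x y i : mulv (a x) (fun m => U m x y) i = mulv (s_form a b x) (y ord0) i.
Proof.
rewrite /mulv; under [RHS]eq_bigr do rewrite -(s_up_lower b (kc_unit K)).
by move: (a x) (s_up a b x) (y ord0) => A T w; rewrite !sum3; ring.
Qed.

Lemma gram_up x y i k : mulv (s_form a b x) (y ord0) k * U i x y =
  (i == k)%:R * (C * q x y - be x y ^+ 2) - C * (y ord0 i * low x y k)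
  - q x y * (sharp a b x i * b x ord0 k)
  + be x y * (y ord0 i * b x ord0 k + sharp a b x i * low x y k).
Proof.
move: i; apply: (metric_inj K (x := x)) => i.
transitivity (mulv (s_form a b x) (y ord0) i * mulv (s_form a b x) (y ord0) k).
  have E (A : 'I_3 -> 'I_3 -> R) (u : 'I_3 -> R) (t : R) :
    mulv A (fun m => t * u m) i = mulv A u i * t by rewrite /mulv !sum3; ring.
  by rewrite E s_up_lower_y.
rewrite (s_form_gram K) -{1 2}(sharp_low K x i) /=.
have -> : a x i k = \sum_m a x i m * (m == k)%:R.
  by under eq_bigr do rewrite mulrC eq_sym; rewrite sum_delta.
move: (q x y) (be x y) => qq B.
by move: (a x) (b x ord0) (y ord0) (sharp a b x) => A d w h; rewrite /mulv !sum3; ring.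
Qed.

(** The trace of the curvature correction. The hypothesis P = 2 q Pq + beta Pb is Euler's relation
    for P, which is homogeneous of degree 1 in y. *)
Let trace_sum (T : R) (A : 'I_3 -> R) (z w h d p : 'I_3 -> R) (P Pq Pb qq B : R) :
  (forall i, p i = 2 * Pq * z i + Pb * d i) ->
  pair3 w z = qq -> pair3 d w = B -> pair3 d h = C -> pair3 h z = B ->
  \sum_i A i = C * qq - B ^+ 2 -> P = 2 * qq * Pq + B * Pb ->
  \sum_i (3 * (2 * P * Pq - Pb) * A i + P * (2 * B * 1 - z i * h i - w i * d i)
    - p i * (B * w i - qq * h i) - P * p i * (C * w i - B * h i)
    + P ^+ 2 * (C * 1 - h i * d i)) =
  (4 * P * Pq - 2 * Pb) * (C * qq - B ^+ 2) + 4 * P * B + 2 * C * P ^+ 2.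
Proof.
move=> pE wz dw dh hz HA PE.
transitivity (3 * (2 * P * Pq - Pb) * (\sum_i A i) + P * (6 * B - pair3 h z - pair3 d w)
   - (B * (2 * Pq * pair3 w z + Pb * pair3 d w) - qq * (2 * Pq * pair3 h z + Pb * pair3 d h))
   - P * (C * (2 * Pq * pair3 w z + Pb * pair3 d w) - B * (2 * Pq * pair3 h z + Pb * pair3 d h))
   + P ^+ 2 * (3 * C - pair3 d h)).
  by rewrite /pair3 !sum3 !pE; ring.
by rewrite HA wz dw dh hz PE; ring.
Qed.

Let sharp_lowy x y : pair3 (sharp a b x) (mulv (a x) (y ord0)) = be x y.
Proof. exact: (bil_bu (kc_a_sym K x) (sharp_low K x)). Qed.

Lemma ab_ricci x y : ab_good a b C phi b0 x y ->
  let r := s x y in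
  ricci F x y = \sum_m spray_riemann a m m x y +
   al x y ^+ 2 * ((2 * Q r * (Q r - r * derive1 Q r) - 2 * derive1 Q r) * (C - r ^+ 2)
     + 4 * Q r * r + 2 * C * Q r ^+ 2).
Proof.
move=> g r; have [d _] := g; have A0 := lt0r_neq0 (al_gt0 d).
have qE := al_sq d; have beE : be x y = r * al x y by rewrite /r divfK.
rewrite /ricci; under eq_bigr do rewrite (ab_riemann K adm F_eq) // eqxx.
rewrite big_split /=; congr (_ + _).
under eq_bigr do rewrite -[3 * _ * mulv _ _ _ * _]mulrA.
rewrite (@trace_sum 0 (fun i => mulv (s_form a b x) (y ord0) i * U i x y)
   (mulv (a x) (y ord0)) (y ord0) (sharp a b x) (b x ord0) (fun i => P_fiber a b phi i x y)
   _ (ab_Pq phi (fun w : 'rV[R]_3 => q x w) (fun w : 'rV[R]_3 => be x w) y)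
   (ab_Pb phi (fun w : 'rV[R]_3 => q x w) (fun w : 'rV[R]_3 => be x w) y) (q x y) (be x y)) //.
- rewrite /ab_P /ab_Pq /ab_Pb -/r beE.
  move: (derive1 Q r) (Q r) (al x y) qE A0 => Q1 Q0 A qE A0; rewrite qE.
  by clearbody r; field.
- exact: (sharp_norm K).
- under eq_bigr do rewrite gram_up eqxx.
  have E (z c w h : 'I_3 -> R) : \sum_i (1 * (C * pair3 w z - pair3 c w ^+ 2)
      - C * (w i * z i) - pair3 w z * (h i * c i) + pair3 c w * (w i * c i + h i * z i)) =
    3 * (C * pair3 w z - pair3 c w ^+ 2) - C * pair3 w z - pair3 w z * pair3 c h
    + pair3 c w * (pair3 c w + pair3 h z) by rewrite /pair3 !sum3; ring.
  apply: (etrans (E (mulv (a x) (y ord0)) (b x ord0) (y ord0) (sharp a b x))).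
  by rewrite (sharp_norm K) sharp_lowy; ring.
- rewrite /ab_P /ab_Pq /ab_Pb -/r beE.
  move: (derive1 Q r) (Q r) (al x y) qE A0 => Q1 Q0 A qE A0; rewrite qE.
  by clearbody r; field.
Qed.

Section Einstein.
Variable Kc : R.
Hypothesis Ric : forall x y, \sum_m spray_riemann a m m x y =
  2 * q x y - 4 * (C * q x y - be x y ^+ 2).
Hypothesis ode : forall r, `|r| < b0 ->
  (C - r ^+ 2) * ((1 + r * Q r) * derive1 Q r - Q r ^+ 2 + 2)
  - (2 * r * Q r + C * Q r ^+ 2 + 1) + Kc * phi r ^+ 2 = 0.

Lemma ab_einstein x y : ab_good a b C phi b0 x y -> ricci F x y = 2 * Kc * F x y ^+ 2.
Proof.
move=> g; have [d _] := g; have A0 := lt0r_neq0 (al_gt0 d).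
rewrite ab_ricci // Ric F_eq; have qE := al_sq d.
have beE : be x y = s x y * al x y by rewrite divfK.
have E (qq B A r Q1 Q0 p : R) : qq = A ^+ 2 -> B = r * A ->
    (C - r ^+ 2) * ((1 + r * Q0) * Q1 - Q0 ^+ 2 + 2)
      - (2 * r * Q0 + C * Q0 ^+ 2 + 1) + Kc * p ^+ 2 = 0 ->
    2 * qq - 4 * (C * qq - B ^+ 2) +
      A ^+ 2 * ((2 * Q0 * (Q0 - r * Q1) - 2 * Q1) * (C - r ^+ 2) + 4 * Q0 * r + 2 * C * Q0 ^+ 2) =
    2 * Kc * (A * p) ^+ 2.
  move=> -> -> H; apply/eqP; rewrite -subr_eq0.
  (* The two sides differ by -2 alpha^2 times the left side of the differential equation. *)
  rewrite -[X in _ == X](mulr0 (- 2 * A ^+ 2)) -H; apply/eqP; ring.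
exact: (E _ _ _ _ _ _ _ qE beE (ode (ratio_bound d))).
Qed.

(* At s = 0 the curvature along b^# reads 1 + C Q'(0) = c phi(0)^2; taking the
   trace gives c = Kc, and the Einstein equation evaluates Q'(0). *)
Lemma flag_curvature_obstruction x y c : ab_good a b C phi b0 x y ->
  be x y = 0 -> Q 0 = 0 -> C != 0 ->
  (forall i k, riemann_curv F i k x y =
     c * (F x y ^+ 2 * (i == k)%:R - F x y * dy k F x y * y ord0 i)) ->
  Kc * phi 0 ^+ 2 = 1 - C.
Proof.
move=> g be0 Q0 C0 flag; have [d _] := g; have A0 := lt0r_neq0 (al_gt0 d).
have [q0 sb] := d.
have s0 : s x y = 0 by rewrite be0 mul0r.
have b0_gt0 : 0 < b0 by case: adm.
have sb0 : `|0 : R| < b0 by rewrite normr0.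
have F0 : F x y = al x y * phi 0 by rewrite F_eq s0.
have phi0 := phi_pos adm sb0.
have FF : F x y ^+ 2 != 0 by rewrite expf_neq0 // F0 mulf_neq0 // gt_eqF.
have dF k : dy k F x y = low x y k / al x y * phi 0 + derive1 phi 0 * b x ord0 k.
  apply: der_val; apply: (@der_ext _ _ (fun w : 'rV[R]_3 => al x w * phi (s x w))).
    by move=> w; rewrite F_eq.
  have der_q : is_derive y (delta_mx ord0 k) (fun y => q x y) (2 * low x y k).
    exact: (der_q_y (kc_a_sym K)).
  have der_b : is_derive y (delta_mx ord0 k) (fun y => be x y) (b x ord0 k).
    exact: der_be_y.
  have H := derM (der_al (q := fun w : 'rV[R]_3 => q x w) q0 der_q)
     (der_ratio_comp (q := fun w : 'rV[R]_3 => q x w) (be := fun w : 'rV[R]_3 => be x w)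
        q0 der_q der_b (der_phi adm 0 (ratio_bound d))).
  apply: derE H _; rewrite /ratio_d s0 /= mul0r mul0r subr0.
  by move: (al x y) A0 (derive1 phi 0) (phi 0) => A A0 p1 p; field.
have euler : \sum_k dy k F x y * y ord0 k = F x y.
  under eq_bigr do rewrite dF.
  transitivity (q x y / al x y * phi 0 + derive1 phi 0 * be x y).
    move: (mulv (a x) (y ord0)) (b x ord0) (y ord0) (al x y)^-1 => z c' w A.
    by rewrite /pair3 !sum3; ring.
  have -> : q x y / al x y = al x y by rewrite {1}(al_sq d) expr2 mulfK.
  by rewrite be0 mulr0 addr0 F0.
have cE : c = Kc.
  have := ab_einstein g; rewrite /ricci; under eq_bigr do rewrite flag eqxx.
  have -> : \sum_i c * (F x y ^+ 2 * 1 - F x y * dy i F x y * y ord0 i) =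
     c * (3 * F x y ^+ 2 - F x y * \sum_k dy k F x y * y ord0 k).
    move: (F x y) => f; have E (u w : 'I_3 -> R) : \sum_i c * (f ^+ 2 * 1 - f * u i * w i) =
      c * (3 * f ^+ 2 - f * \sum_k u k * w k) by rewrite !sum3; ring.
    exact: (E (fun i => dy i F x y)).
  rewrite euler => H; apply: (mulIf FF); move: H; move: (F x y) => f H; lra.
have b_s : \sum_i b x ord0 i * U i x y = 0.
  have -> : \sum_i b x ord0 i * U i x y = \sum_n y ord0 n * \sum_m b x ord0 m * s_up a b x m n.
    by move: (s_up a b x) (b x ord0) (y ord0) => T d' w; rewrite /mulv !sum3; ring.
  by apply: big1 => n _; rewrite (form_s_up K) mulr0.
have Q1 : ab_Pb phi (fun w : 'rV[R]_3 => q x w) (fun w : 'rV[R]_3 => be x w) y = derive1 Q 0.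
  by rewrite /ab_Pb s0.
have P0 : ab_P phi (fun w : 'rV[R]_3 => q x w) (fun w : 'rV[R]_3 => be x w) y = 0.
  by rewrite /ab_P s0 Q0 mulr0.
have Pq0 : ab_Pq phi (fun w : 'rV[R]_3 => q x w) (fun w : 'rV[R]_3 => be x w) y = 0.
  by rewrite /ab_Pq s0 Q0 mul0r subrr mul0r.
have E (T : 'I_3 -> 'I_3 -> R) (d' h w z u t f : 'I_3 -> R) (qq F2 Q1' : R) :
    (forall i k, T i k = (1 - 4 * C) * (qq * (i == k)%:R - w i * z k) + 4 * (qq * (h i * d' k))
        + (- 3 * Q1' * t k * u i + Q1' * d' k * (qq * h i))) ->
    (forall i k, T i k = c * (F2 * (i == k)%:R - f k * w i)) ->
    pair3 d' h = C -> pair3 d' u = 0 -> pair3 d' w = 0 ->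
    c * (F2 * C) = qq * C * (1 + C * Q1').
  move=> T1 T2 dh du dw.
  transitivity (\sum_i \sum_k d' i * T i k * h k).
    under [RHS]eq_bigr do under eq_bigr do rewrite T2.
    have -> : \sum_i \sum_k d' i * (c * (F2 * (i == k)%:R - f k * w i)) * h k =
      c * (F2 * pair3 d' h - pair3 f h * pair3 d' w) by rewrite /pair3 !sum3 /=; ring.
    by rewrite dh dw mulr0 subr0.
  under [LHS]eq_bigr do under eq_bigr do rewrite T1.
  have -> : \sum_i \sum_k d' i * ((1 - 4 * C) * (qq * (i == k)%:R - w i * z k) + 4 * (qq * (h i * d' k))
        + (- 3 * Q1' * t k * u i + Q1' * d' k * (qq * h i))) * h k =
     (1 - 4 * C) * (qq * pair3 d' h - pair3 d' w * pair3 z h) + 4 * (qq * (pair3 d' h * pair3 d' h))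
        + (- 3 * Q1' * pair3 t h * pair3 d' u + Q1' * pair3 d' h * (qq * pair3 d' h)).
     by rewrite /pair3 !sum3 /=; ring.
  by rewrite dh du dw; ring.
have T1 i k : riemann_curv F i k x y =
    (1 - 4 * C) * (q x y * (i == k)%:R - y ord0 i * low x y k)
    + 4 * (q x y * (sharp a b x i * b x ord0 k))
    + (- 3 * derive1 Q 0 * mulv (s_form a b x) (y ord0) k * U i x y
       + derive1 Q 0 * b x ord0 k * (q x y * sharp a b x i)).
  rewrite (ab_riemann K adm F_eq i k g) (spray_curvature_eq K Ric).
  rewrite /P_fiber Q1 P0 Pq0 be0.
  have E' (qq Q1' z t u h d' w dl : R) : (1 - 4 * C) * (qq * dl - w * z) + 4 * (qq * (h * d') -
       0 * (h * z + w * d') + 0 ^+ 2 * dl) + (3 * (2 * 0 * 0 - Q1') * t * u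
       + 0 * (2 * 0 * dl - z * h - w * d') - (2 * 0 * z + Q1' * d') * (0 * w - qq * h)
       - 0 * (2 * 0 * z + Q1' * d') * (C * w - 0 * h) + 0 ^+ 2 * (C * dl - h * d')) =
     (1 - 4 * C) * (qq * dl - w * z) + 4 * (qq * (h * d'))
       + (- 3 * Q1' * t * u + Q1' * d' * (qq * h)) by ring.
  exact: E'.
have main : c * (F x y ^+ 2 * C) = q x y * C * (1 + C * derive1 Q 0).
  exact: (E (fun i k => riemann_curv F i k x y) (b x ord0) (sharp a b x) (y ord0)
    (mulv (a x) (y ord0)) (fun i => U i x y) (mulv (s_form a b x) (y ord0))
    (fun k => F x y * dy k F x y) (q x y) (F x y ^+ 2) (derive1 Q 0) T1 flag
    (sharp_norm K x) b_s be0).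
have key : Kc * phi 0 ^+ 2 = 1 + C * derive1 Q 0.
  apply: (mulIf C0); apply: (mulfI (lt0r_neq0 q0)); rewrite -cE.
  have -> : q x y * ((1 + C * derive1 Q 0) * C) = q x y * C * (1 + C * derive1 Q 0) by ring.
  rewrite -main F0; have -> : q x y * (c * phi 0 ^+ 2 * C) = c * (q x y * phi 0 ^+ 2 * C) by ring.
  by rewrite exprMn -al_sq.
have E2 (t : R) : (C - 0 ^+ 2) * ((1 + 0 * 0) * t - 0 ^+ 2 + 2)
    - (2 * 0 * 0 + C * 0 ^+ 2 + 1) + (1 + C * t) = 0 -> 1 + C * t = 1 - C.
  have two : (2 : R) != 0 by rewrite pnatr_eq0.
  move=> H; apply: (mulfI two); apply/eqP; rewrite -subr_eq0 -[X in _ == X]H; apply/eqP.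
  by ring.
by have := ode sb0; rewrite Q0 key; exact: E2.
Qed.

End Einstein.
End AlphaBetaCurvature.

(** * The Randers case phi = 1 + s *)

Section Randers.
Context {R : realType}.
Variables (a : 'rV[R]_3 -> 'M[R]_3) (b : 'rV[R]_3 -> 'rV[R]_3) (C : R).
Hypothesis K : killing_chart a b C.
Variables (phi : R -> R) (b0 : R) (F : 'rV[R]_3 -> 'rV[R]_3 -> R).
Hypothesis adm : admissible b0 phi.
Implicit Types (x y : 'rV[R]_3) (i j k l m n : 'I_3).

Local Notation q x y := (pair3 (y ord0) (mulv (a x) (y ord0))).
Local Notation be x y := (pair3 (b x ord0) (y ord0)).
Local Notation low x y i := (mulv (a x) (y ord0) i).
Local Notation al x y := (Num.sqrt (q x y)).
Local Notation s x y := (be x y / al x y).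

Hypothesis F_eq : forall x y, F x y = al x y * phi (s x y).
Hypothesis Ric : forall x y, \sum_m spray_riemann a m m x y =
  2 * q x y - 4 * (C * q x y - be x y ^+ 2).
Hypothesis phi_eq : forall r, `|r| < b0 -> phi r = 1 + r.

Lemma randers_derive1 r : `|r| < b0 -> derive1 phi r = 1.
Proof.
move=> rb; rewrite derive1E; apply: der_val.
apply: (@der_eq _ _ (fun t : R => 1 + t)).
  by apply: filterS (near_norm_lt rb) => t tb; rewrite phi_eq.
by apply: derE (derD (derC 1 r 1) (derId r)) _; rewrite add0r.
Qed.

Lemma randers_Qfun r : `|r| < b0 -> Qfun phi r = 1.
Proof.
by move=> rb; rewrite /Qfun randers_derive1 // phi_eq // mulr1 addrK divr1.
Qed.

Lemma randers_derive1_Qfun r : `|r| < b0 -> derive1 (Qfun phi) r = 0.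
Proof.
move=> rb; rewrite derive1E; apply: der_val.
apply: (@der_eq _ _ (fun _ : R => 1 : R)).
by apply: filterS (near_norm_lt rb) => t tb; rewrite randers_Qfun.
Qed.

(** Here Q = 1 and P = alpha, so the product s_k0 s^i_0 enters with coefficient 3; once it is
    expanded by [gram_up], the correction cancels all terms with C and b^# in the curvature of
    alpha, and flag curvature 1 remains. *)
Lemma randers_flag_curvature x y i k : ab_good a b C phi b0 x y ->
  riemann_curv F i k x y =
  F x y ^+ 2 * (i == k)%:R - F x y * dy k F x y * y ord0 i.
Proof.
move=> g; have [d _] := g; have [q0 sb] := d.
have A0 : al x y != 0 by rewrite gt_eqF // sqrtr_gt0.
have rb : `|s x y| < b0.
  exact: (@ratio_lt _ b0 _ (fun y => q x y) (fun y => be x y) y).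
(* The equality phi = 1 + s is known only for |s| < b0, hence this formula only on the domain, which
   is open. *)
have FE z : ab_dom a b b0 x z -> F x z = al x z + be x z.
  move=> [q0' sb']; rewrite F_eq phi_eq.
    by rewrite mulrDr mulr1 mulrC divfK // gt_eqF // sqrtr_gt0.
  exact: (@ratio_lt _ b0 _ (fun y => q x y) (fun y => be x y) z).
have dF : dy k F x y = low x y k / al x y + b x ord0 k.
  apply: der_val; apply: (@der_eq _ _ (fun w : 'rV[R]_3 => al x w + be x w)).
    by apply: filterS (ab_dom_y d) => z dz; rewrite FE.
  have der_q : is_derive y (delta_mx ord0 k) (fun y => q x y) (2 * low x y k).
    exact: (der_q_y (kc_a_sym K)).
  have der_b : is_derive y (delta_mx ord0 k) (fun y => be x y) (b x ord0 k).
    exact: der_be_y.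
  apply: derE (derD (der_al (q := fun w : 'rV[R]_3 => q x w) q0 der_q) der_b) _.
  by move: (al x y) A0 => A A0; field.
have P1 : ab_P phi (fun w : 'rV[R]_3 => q x w) (fun w : 'rV[R]_3 => be x w) y = al x y.
  by rewrite /ab_P randers_Qfun // mulr1.
have Pb0 : ab_Pb phi (fun w : 'rV[R]_3 => q x w) (fun w : 'rV[R]_3 => be x w) y = 0.
  by rewrite /ab_Pb randers_derive1_Qfun.
have Pq1 : ab_Pq phi (fun w : 'rV[R]_3 => q x w) (fun w : 'rV[R]_3 => be x w) y =
    1 / (2 * al x y).
  by rewrite /ab_Pq randers_derive1_Qfun // randers_Qfun // mulr0 subr0.
rewrite (ab_riemann K adm F_eq i k g) (spray_curvature_eq K Ric) /P_fiber P1 Pb0 Pq1 dF (FE y d).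
rewrite -[X in _ + (X + _ - _ - _ + _)]mulrA (gram_up K).
have E (A qq B h z w d' dl : R) : A != 0 -> qq = A ^+ 2 ->
   (1 - 4 * C) * (qq * dl - w * z) + 4 * (qq * (h * d') - B * (h * z + w * d') + B ^+ 2 * dl) +
   (3 * (2 * A * (1 / (2 * A)) - 0) * (dl * (C * qq - B ^+ 2) - C * (w * z) - qq * (h * d')
      + B * (w * d' + h * z))
    + A * (2 * B * dl - z * h - w * d') - (2 * (1 / (2 * A)) * z + 0 * d') * (B * w - qq * h)
    - A * (2 * (1 / (2 * A)) * z + 0 * d') * (C * w - B * h) + A ^+ 2 * (C * dl - h * d')) =
   (A + B) ^+ 2 * dl - (A + B) * (z / A + d') * w by move=> A0' ->; field.
apply: E => //; by rewrite sqr_sqrtr // ltW.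
Qed.

End Randers.

(** * Stereographic charts of S^3 *)

Section StereographicChart.
Context {R : realType}.
Implicit Types (x y : 'rV[R]_3) (i j k : 'I_3) (eps : bool).

Lemma dot3 x y : dot x y = \sum_i x ord0 i * y ord0 i.
Proof. by rewrite /dot mxE; apply: eq_bigr => i _; rewrite mxE. Qed.

Lemma dot4 (u v : 'rV[R]_(3 + 1)) : dot u v =
  \sum_(i < 3) u ord0 (lshift 1 i) * v ord0 (lshift 1 i)
  + u ord0 (rshift 3 ord0) * v ord0 (rshift 3 ord0).
Proof.
rewrite /dot mxE big_split_ord /= big_ord1.
by congr (_ + _); [apply: eq_bigr => i _|]; rewrite mxE.
Qed.

(** Conformal factor lambda of the chart: the round metric is lambda^2 times the Euclidean one, and
    the last coordinate of the point is 1 - lambda up to the sign of the pole. *)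
Definition conformal x : R := 2 / (dot x x + 1).

Let sq_ge0 x : 0 <= dot x x.
Proof. by rewrite dot3; apply: sumr_ge0 => i _; rewrite -expr2 sqr_ge0. Qed.

Let sq1_neq0 x : dot x x + 1 != 0.
Proof. by rewrite gt_eqF // ltr_wpDl. Qed.

Lemma conformal_gt0 x : 0 < conformal x.
Proof. by rewrite divr_gt0 // ltr_wpDl. Qed.

Lemma conformal_eq x : conformal x * (dot x x + 1) = 2.
Proof. by rewrite divfK. Qed.

Lemma dot_smooth : smooth (fun x => dot x x).
Proof.
apply: (@smooth_ext _ _ (fun x => \sum_i x ord0 i * x ord0 i)) => [x|]; first by rewrite dot3.
by apply: smooth_sum => i _; apply: smoothM; exact: smooth_coord.
Qed.

Lemma conformal_smooth : smooth conformal.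
Proof.
apply: smoothM; first exact: smooth_cst.
apply: smoothV => //; apply: smoothD; [exact: dot_smooth|exact: smooth_cst].
Qed.

Lemma der_conformal x i :
  is_derive x (delta_mx ord0 i) conformal (- conformal x ^+ 2 * x ord0 i).
Proof.
have D : is_derive x (delta_mx ord0 i) (fun x => dot x x + 1) (2 * x ord0 i).
  apply: (@der_ext _ _ (fun x : 'rV[R]_3 => \sum_i x ord0 i * x ord0 i + 1)) => [w|].
    by rewrite dot3.
  eapply derE.
    apply: derD (derC _ _ _); apply: der_sum => j; apply: derM; exact: der_coord.
  by rewrite addr0 sum3; cases3 i => /=; ring.
apply: (derE (f := fun x : 'rV[R]_3 => 2 / (dot x x + 1))
  (der_scale 2 (derV (f := fun x : 'rV[R]_3 => dot x x + 1) (sq1_neq0 x) D))).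
by rewrite /conformal; move: (sq1_neq0 x) => h; field.
Qed.

Definition sgn_of eps : R := (-1) ^+ eps.

Lemma sgn_of_sq eps : sgn_of eps * sgn_of eps = 1.
Proof. by case: eps; rewrite /sgn_of ?expr1 ?expr0; ring. Qed.

Lemma stereo_l eps x j : stereo eps x ord0 (lshift 1 j) = conformal x * x ord0 j.
Proof. by rewrite /stereo row_mxEl mxE. Qed.

Lemma stereo_r eps x : stereo eps x ord0 (rshift 3 ord0) = sgn_of eps * (1 - conformal x).
Proof.
rewrite /stereo row_mxEr mxE eqxx mulr1n -mulrA; congr (_ * _).
by rewrite /conformal; field.
Qed.

Lemma stereo_differentiable eps x : differentiable (stereo eps) x.
Proof.
pose f (j : 'I_(3 + 1)) x := stereo eps x ord0 j *: (delta_mx ord0 j : 'rV[R]_(3 + 1)).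
rewrite (_ : stereo eps = \sum_j f j); last first.
  apply/funext => z; rewrite fct_sumE; exact: row_sum_delta.
apply: differentiable_sum => j; apply: differentiableZl.
case: (split_ordP j) => k ->.
  rewrite (_ : (fun x => _) = fun x => conformal x * x ord0 k); last first.
    by apply/funext => z; rewrite stereo_l.
  by apply: smooth_diff; apply: smoothM; [exact: conformal_smooth|exact: smooth_coord].
rewrite (_ : (fun x => _) = fun x => sgn_of eps * (1 - conformal x)); last first.
  by apply/funext => z; rewrite (ord1 k) -stereo_r.
apply: smooth_diff; apply: smoothM; first exact: smooth_cst.
by apply: smoothD; [exact: smooth_cst|apply: smoothN; exact: conformal_smooth].
Qed.

(** The Jacobian comes from the total derivative, so differentiability of [stereo] is what turns its
    entries into partial derivatives. *)
Lemma frame_pd eps x i (j : 'I_(3 + 1)) : frame eps x i j =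
  pd i (fun x => stereo eps x ord0 j) x.
Proof.
have D := stereo_differentiable eps x.
have /rowP/(_ j) := deriveEjacobian (delta_mx ord0 i) D.
rewrite -rowE mxE => <-.
by rewrite derive_mx ?mxE //; exact: diff_derivable.
Qed.

Lemma frame_l eps x i j : frame eps x i (lshift 1 j) =
  conformal x * (i == j)%:R - conformal x ^+ 2 * (x ord0 i * x ord0 j).
Proof.
rewrite frame_pd; apply: der_val.
apply: (@der_ext _ _ (fun x => conformal x * x ord0 j)) => [w|]; first by rewrite stereo_l.
apply: derE (derM (der_conformal x i) (der_coord j i x)) _.
by rewrite eq_sym; ring.
Qed.

Lemma frame_r eps x i : frame eps x i (rshift 3 ord0) =
  sgn_of eps * (conformal x ^+ 2 * x ord0 i).
Proof.
rewrite frame_pd; apply: der_val.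
apply: (@der_ext _ _ (fun x => sgn_of eps * (1 - conformal x))) => [w|]; first by rewrite stereo_r.
apply: derE (der_scale _ (derB (derC 1 _ _) (der_conformal x i))) _.
by ring.
Qed.

Lemma stereo_on_sphere eps x : on_sphere (stereo eps x).
Proof.
rewrite /on_sphere dot4; under eq_bigr do rewrite stereo_l.
rewrite !stereo_r.
have := conformal_eq x; rewrite dot3 !sum3 => H.
(* The terms are grouped so that only lambda (|x|^2 + 1) = 2 and the square of the sign remain to be
   inserted; [frame_tangent] and [frame_gram] proceed in the same way. *)
transitivity (conformal x * (conformal x * (x ord0 o0 * x ord0 o0 + x ord0 o1 * x ord0 o1
   + x ord0 o2 * x ord0 o2 + 1)) + (1 - 2 * conformal x)
   + (sgn_of eps * sgn_of eps - 1) * (1 - conformal x) ^+ 2); first by ring.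
by rewrite H sgn_of_sq; ring.
Qed.

Lemma frame_tangent eps x i : dot (stereo eps x) (row i (frame eps x)) = 0.
Proof.
rewrite dot4; under eq_bigr do rewrite stereo_l mxE frame_l.
rewrite stereo_r mxE frame_r.
have := conformal_eq x; rewrite dot3 sum3 => H.
transitivity (conformal x ^+ 2 * x ord0 i * (2 - conformal x * (x ord0 o0 * x ord0 o0
   + x ord0 o1 * x ord0 o1 + x ord0 o2 * x ord0 o2 + 1))
   + (sgn_of eps * sgn_of eps - 1) * ((1 - conformal x) * (conformal x ^+ 2 * x ord0 i))).
  by rewrite sum3; cases3 i => /=; ring.
by rewrite H sgn_of_sq; ring.
Qed.

Lemma frame_gram eps x i j : (frame eps x *m (frame eps x)^T) i j =
  conformal x ^+ 2 * (i == j)%:R.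
Proof.
rewrite mxE big_split_ord /= big_ord1 frame_r [_^T _ _]mxE frame_r.
under eq_bigr do rewrite [_^T _ _]mxE !frame_l.
have := conformal_eq x; rewrite dot3 sum3 => H.
transitivity (conformal x ^+ 2 * (i == j)%:R + conformal x ^+ 3 * (x ord0 i * x ord0 j) *
   (conformal x * (x ord0 o0 * x ord0 o0
   + x ord0 o1 * x ord0 o1 + x ord0 o2 * x ord0 o2 + 1) - 2)
   + (sgn_of eps * sgn_of eps - 1) * (conformal x ^+ 4 * (x ord0 i * x ord0 j))).
  by rewrite sum3; cases3 i; cases3 j => /=; ring.
by rewrite H sgn_of_sq; ring.
Qed.

Lemma frame_inj eps x y : y != 0 -> y *m frame eps x != 0.
Proof.
apply: contraNneq => H; apply/eqP/rowP => j.
have /rowP/(_ j) : y *m frame eps x *m (frame eps x)^T = 0 by rewrite H mul0mx.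
have -> : y *m frame eps x *m (frame eps x)^T = conformal x ^+ 2 *: y.
  apply/rowP => k; rewrite -mulmxA [LHS]mxE [RHS]mxE.
  under eq_bigr do rewrite frame_gram mulrCA.
  rewrite -mulr_sumr; congr (_ * _).
  by under eq_bigr do rewrite mulrC eq_sym; rewrite sum_delta.
rewrite !mxE => /eqP; rewrite mulf_eq0 sqrf_eq0 gt_eqF ?conformal_gt0 //= => /eqP ->.
by [].
Qed.

End StereographicChart.

(** * From pairs on S^3 to coordinate data *)

Section ChartOfPair.
Context {R : realType}.
Variables (A : 'rV[R]_(3 + 1) -> 'M[R]_(3 + 1)) (B : 'rV[R]_(3 + 1) -> 'rV[R]_(3 + 1)).
Implicit Types (x y : 'rV[R]_3) (i j k : 'I_3) (eps : bool).

Local Notation a eps := (metric_coef A eps).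
Local Notation b eps := (form_coef B eps).
Local Notation q eps x y := (pair3 (y ord0) (mulv (a eps x) (y ord0))).
Local Notation be eps x y := (pair3 (b eps x ord0) (y ord0)).

Lemma chart_dot eps x y :
  dot (y *m frame eps x *m A (stereo eps x)) (y *m frame eps x) = q eps x y.
Proof.
have -> : dot (y *m frame eps x *m A (stereo eps x)) (y *m frame eps x) =
  dot (y *m a eps x) y by rewrite /dot trmx_mul !mulmxA.
rewrite dot_mul; move: (a eps x) (y ord0) => M w.
by rewrite /pair3 /mulv !sum3; ring.
Qed.

Lemma in_chart_alpha eps x y : in_chart eps (alpha A) x y = Num.sqrt (q eps x y).
Proof. by rewrite /in_chart /alpha chart_dot. Qed.

Lemma in_chart_beta eps x y : in_chart eps (beta B) x y = be eps x y.
Proof.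
rewrite /in_chart /beta.
have -> : dot (B (stereo eps x)) (y *m frame eps x) = dot (b eps x) y.
  by rewrite /dot trmx_mul !mulmxA.
by rewrite dot3.
Qed.

Lemma in_chart_alpha_beta phi eps x y : in_chart eps (alpha_beta A B phi) x y =
  Num.sqrt (q eps x y) * phi (be eps x y / Num.sqrt (q eps x y)).
Proof. by rewrite -in_chart_alpha -in_chart_beta. Qed.

Section Metric.
Hypothesis A_riem : riemannian_metric A.

(** [A] is known to be symmetric on tangent vectors only, so the coefficients are first written as
    values on rows of the frame, which are tangent. *)
Lemma metric_coef_sym eps x i j : a eps x i j = a eps x j i.
Proof.
have [S _ _] := A_riem.
have E k l : a eps x k l = dot (row k (frame eps x) *m A (stereo eps x)) (row l (frame eps x)).
  rewrite /metric_coef /dot -row_mul mxE [RHS]mxE; apply: eq_bigr => m _.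
  by rewrite [_^T _ _]mxE [_^T _ _]mxE [row k _ _ _]mxE [row l _ _ _]mxE.
rewrite !E; apply: S; [exact: stereo_on_sphere|exact: frame_tangent..].
Qed.

Lemma metric_coef_pos eps x (v : 'I_3 -> R) : (exists i, v i != 0) -> 0 < bil (a eps x) v v.
Proof.
have [_ P _] := A_riem; move=> [i vi].
pose w : 'rV[R]_3 := \row_j v j.
have -> : bil (a eps x) v v = q eps x w.
  by have -> : w ord0 = v by apply/funext => j; rewrite mxE.
have w0 : w != 0 by apply/matrix0Pn; exists ord0, i; rewrite mxE.
rewrite -chart_dot; apply: P; first exact: stereo_on_sphere; last exact: frame_inj.
have -> : w *m frame eps x = \sum_j w ord0 j *: row j (frame eps x) by rewrite mulmx_sum_row.
rewrite /dot linear_sum /= mulmx_sumr summxE big1 // => j _.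
rewrite linearZ /= -scalemxAr mxE.
by have := frame_tangent eps x j; rewrite /dot => ->; rewrite mulr0.
Qed.

Lemma chart_q_gt0 eps x y : y != 0 -> 0 < q eps x y.
Proof.
move=> /matrix0Pn[i [j H]]; apply: metric_coef_pos; exists j.
by move: H; rewrite [i]ord1.
Qed.

Lemma chart_q_ge0 eps x y : 0 <= q eps x y.
Proof.
have [->|y0] := eqVneq y 0; last exact/ltW/chart_q_gt0.
by rewrite /pair3 big1 // => i _; rewrite mxE mul0r.
Qed.

Lemma chart_alpha_sq eps x y : sq (in_chart eps (alpha A)) x y = q eps x y.
Proof. by rewrite /sq in_chart_alpha sqr_sqrtr // chart_q_ge0. Qed.

(** [Num.sqrt] sends negative numbers to 0, so removing it requires a nonnegative argument; writing
    b = h a shows that the argument is a(h, h). *)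
Lemma chart_form_norm eps c : (forall x, form_norm (a eps) (b eps) x = c) ->
  forall x, dot (b eps x *m invmx (a eps x)) (b eps x) = c ^+ 2.
Proof.
move=> H x; rewrite -(H x) /form_norm sqr_sqrtr //.
have U : a eps x \in unitmx by apply: pos_unitmx; exact: metric_coef_pos.
pose h := b eps x *m invmx (a eps x).
have bE : b eps x = h *m a eps x by rewrite /h mulmxKV.
rewrite {2}bE -/h.
have -> : dot h (h *m a eps x) = q eps x h.
  rewrite /dot mxE; under eq_bigr do rewrite [_^T _ _]mxE [(h *m _) _ _]mxE.
  have as' := metric_coef_sym eps x; move: (a eps x) as' (h ord0) => M Ms w.
  by rewrite /pair3 /mulv !sum3 (Ms o1 o0) (Ms o2 o0) (Ms o2 o1); ring.
exact: chart_q_ge0.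
Qed.

End Metric.

Section Pair.
Variable c : R.
Hypothesis AB : alpha_beta_pair A B c.

Lemma pair_killing_chart eps : killing_chart (a eps) (b eps) (c ^+ 2).
Proof.
have [A_riem B_smooth killing len eqs] := AB; split.
- by have [_ _] := A_riem; exact.
- exact: metric_coef_sym.
- exact: metric_coef_pos.
- exact: B_smooth.
- exact: killing.
- by apply: chart_form_norm; [|exact: len].
- move=> x y; have [_ E _] := eqs eps x y; rewrite E in_chart_beta.
  by have := chart_alpha_sq A_riem eps x y; rewrite /sq => ->.
Qed.

Lemma pair_spray_ricci eps x y : \sum_m spray_riemann (a eps) m m x y =
  2 * q eps x y - 4 * (c ^+ 2 * q eps x y - be eps x y ^+ 2).
Proof.
have [A_riem _ _ _ eqs] := AB; have [E _ _] := eqs eps x y.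
have K := pair_killing_chart eps.
have AS := chart_alpha_sq A_riem eps.
move: E; rewrite /ricci in_chart_beta.
under eq_bigr do rewrite (alpha_riemann (kc_a_smooth K) (kc_a_sym K) (kc_unit K) AS).
by move=> ->; have := AS x y; rewrite /sq => ->.
Qed.

Variables (b0 : R) (phi : R -> R).
Hypothesis adm : admissible b0 phi.

Lemma domain_ab_dom eps x y : domain A B b0 eps x y -> ab_dom (a eps) (b eps) b0 x y.
Proof.
have [A_riem _ _ _ _] := AB.
by move=> [y0]; rewrite in_chart_alpha in_chart_beta => H; split=> //; exact: chart_q_gt0.
Qed.

Lemma pair_einstein Kc : einstein_ode Kc c b0 phi -> einstein_const A B b0 phi Kc.
Proof.
move=> ode eps x y d F fins.
have K := pair_killing_chart eps.
have F_eq : forall x y, F x y = Num.sqrt (q eps x y) * phi (be eps x y / Num.sqrt (q eps x y)).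
  by move=> x' y'; exact: in_chart_alpha_beta.
have g := finsler_ab_good K adm F_eq (domain_ab_dom d) fins.
rewrite (ab_einstein K adm F_eq (Kc := Kc) (pair_spray_ricci eps)) //.
Qed.

Lemma pair_finsler_on_domain :
  (forall r, `|r| < b0 -> 0 < ab_delta phi (c ^+ 2) r) -> finsler_on_domain A B b0 phi.
Proof.
move=> dl eps x y d.
have K := pair_killing_chart eps.
have [q0 sb] := domain_ab_dom d.
apply: (ab_good_finsler K adm (in_chart_alpha_beta phi eps)); split; first exact: domain_ab_dom.
apply: dl; exact: (@ratio_lt _ b0 _ (fun y => q eps x y) (fun y => be eps x y) y).
Qed.

Lemma pair_randers : (forall s, `|s| < b0 -> phi s = 1 + s) ->
  (forall eps x y, domain A B b0 eps x y ->
     in_chart eps (alpha_beta A B phi) x y =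
     in_chart eps (alpha A) x y + in_chart eps (beta B) x y)
  /\ constant_flag_curvature A B b0 phi.
Proof.
move=> phi_eq; split=> [eps x y d|].
  have [q0 sb] := domain_ab_dom d.
  rewrite in_chart_alpha_beta in_chart_alpha in_chart_beta phi_eq.
    by rewrite mulrDr mulr1 mulrC divfK // gt_eqF // sqrtr_gt0.
  exact: (@ratio_lt _ b0 _ (fun y => q eps x y) (fun y => be eps x y) y).
exists 1 => eps x y d F fins i k; rewrite mul1r.
have K := pair_killing_chart eps.
have F_eq : forall x y, F x y = Num.sqrt (q eps x y) * phi (be eps x y / Num.sqrt (q eps x y)).
  by move=> x' y'; exact: in_chart_alpha_beta.
have g := finsler_ab_good K adm F_eq (domain_ab_dom d) fins.
exact: (randers_flag_curvature K adm F_eq (pair_spray_ricci eps) phi_eq).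
Qed.

Lemma pair_not_constant_flag Kc : einstein_ode Kc c b0 phi -> 0 < c ->
  (forall r, `|r| < b0 -> 0 < ab_delta phi (c ^+ 2) r) -> Qfun phi 0 = 0 ->
  Kc * phi 0 ^+ 2 != 1 - c ^+ 2 -> ~ constant_flag_curvature A B b0 phi.
Proof.
move=> ode c0 dl Q0 ne [f flag]; move/negP: ne; apply; apply/eqP.
have [A_riem _ _ _ _] := AB.
have K := pair_killing_chart true.
have b00 : 0 < b0 by case: adm.
pose v := b true 0 ord0.
have r3 (u1 u2 u3 : R) : [/\ row3 u1 u2 u3 ord0 o0 = u1, row3 u1 u2 u3 ord0 o1 = u2
    & row3 u1 u2 u3 ord0 o2 = u3] by rewrite !mxE.
(* A nonzero vector on which beta vanishes, at the centre of one chart; the curvature there already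
   excludes constancy. *)
have [y [y0 by0]] : exists y : 'rV[R]_3, y != 0 /\ be true 0 y = 0.
  have [v0|v0] := eqVneq (v o0) 0.
    exists (row3 1 0 0); split.
      by apply/matrix0Pn; exists ord0, o0; rewrite mxE oner_neq0.
    by rewrite /pair3 sum3; have [-> -> ->] := r3 1 0 0; rewrite -/v v0; ring.
  exists (row3 (v o1) (- v o0) 0); split.
    by apply/matrix0Pn; exists ord0, o1; rewrite mxE /= oppr_eq0.
  by rewrite /pair3 sum3; have [-> -> ->] := r3 (v o1) (- v o0) 0; rewrite -/v; ring.
have q0 := chart_q_gt0 A_riem true 0 y0.
have d : domain A B b0 true 0 y.
  by split=> //; rewrite in_chart_alpha in_chart_beta by0 normr0 mulr_gt0 // sqrtr_gt0.
have F_eq := in_chart_alpha_beta phi true.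
have fins := pair_finsler_on_domain dl d.
have g := finsler_ab_good K adm F_eq (domain_ab_dom d) fins.
apply: (flag_curvature_obstruction K adm F_eq (pair_spray_ricci true) ode g by0 Q0) => [|i k].
  by rewrite sqrf_eq0 gt_eqF.
exact: flag.
Qed.

End Pair.
End ChartOfPair.

(** * The Hopf form and the Berger metrics *)

Local Opaque pd christoffel cov_form s_form s_up cov_s_up.

(** The Lie derivative of [a] along xi equals b_{i;j} + b_{j;i} for the lowered form b. *)
Lemma lie_killing {R : realType} (a : 'rV[R]_3 -> 'M[R]_3) (b : 'rV[R]_3 -> 'rV[R]_3)
    (xi : 'I_3 -> 'rV[R]_3 -> R) :
  (forall i j, smooth (fun x => a x i j)) -> (forall x i j, a x i j = a x j i) ->
  (forall x, a x \in unitmx) -> (forall l, smooth (xi l)) ->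
  (forall x i, b x ord0 i = \sum_l a x i l * xi l x) ->
  (forall x i j, \sum_l (xi l x * pd l (fun z => a z i j) x
     + a x i l * pd j (xi l) x + a x j l * pd i (xi l) x) = 0) ->
  forall x, r_form a b x = 0.
Proof.
move=> a_smooth a_sym a_unit xi_smooth bE lie x; apply/matrixP => i j; rewrite mxE [RHS]mxE.
have db k m : pd k (fun z => b z ord0 m) x =
    \sum_l (pd k (fun z => a z m l) x * xi l x + a x m l * pd k (xi l) x).
  apply: der_val; apply: (@der_ext _ _ (fun z => \sum_l a z m l * xi l z)).
    by move=> w; rewrite bE.
  by apply: der_sum => l; apply: derM; apply: der_pd.
have Gb m p : \sum_k christoffel a k m p x * b x ord0 k =
    \sum_l xi l x * (2^-1 * (pd m (fun z => a z l p) x + pd p (fun z => a z l m) x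
      - pd l (fun z => a z m p) x)).
  under eq_bigr do rewrite bE.
  under [RHS]eq_bigr do rewrite -(christoffel_lower a_unit).
  have E (A : 'I_3 -> 'I_3 -> R) (G u : 'I_3 -> R) : (forall i j, A i j = A j i) ->
    \sum_k G k * (\sum_l A k l * u l) = \sum_l u l * (\sum_k A l k * G k).
    by move=> As; rewrite !sum3 (As o1 o0) (As o2 o0) (As o2 o1); ring.
  exact: (E (a x) (fun k => christoffel a k m p x) (fun l => xi l x)).
rewrite !cov_formE !Gb !db.
have as1 k l m : pd k (fun z => a z l m) x = pd k (fun z => a z m l) x.
  by congr (pd k _ x); apply/funext => z.
have E (X D1 D2 L1 L2 A1 A2 : 'I_3 -> R) :
  \sum_l (X l * L1 l + A1 l * D1 l + A2 l * D2 l) = 0 ->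
  forall e1 e2 f1 f2 : 'I_3 -> R, (forall l, f1 l = e1 l) -> (forall l, f2 l = e2 l) ->
  (forall l, L2 l = L1 l) ->
  2^-1 * (\sum_l (e1 l * X l + A1 l * D1 l) - \sum_l X l * (2^-1 * (f2 l + f1 l - L1 l))
   + (\sum_l (e2 l * X l + A2 l * D2 l) - \sum_l X l * (2^-1 * (f1 l + f2 l - L2 l)))) = 0.
  move=> H e1 e2 f1 f2 /funext -> /funext -> /funext ->.
  by rewrite -[RHS](mulr0 2^-1) -[X in _ = _ * X]H !sum3; field.
apply: (E (fun l => xi l x) (fun l => pd j (xi l) x) (fun l => pd i (xi l) x)
  (fun l => pd l (fun z => a z i j) x) (fun l => pd l (fun z => a z j i) x)
  (fun l => a x i l) (fun l => a x j l) (lie x i j)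
  (fun l => pd j (fun z => a z i l) x) (fun l => pd i (fun z => a z j l) x)
  (fun l => pd j (fun z => a z l i) x) (fun l => pd i (fun z => a z l j) x)) => l;
  exact: as1.
Qed.

Section HopfForm.
Context {R : realType}.
Variable eps : bool.
Implicit Types (x y : 'rV[R]_3) (i j k l : 'I_3).

Local Notation lam := (@conformal R).
Local Notation e := (@sgn_of R eps).
Local Notation r2 x := (x ord0 o0 * x ord0 o0 + x ord0 o1 * x ord0 o1 + x ord0 o2 * x ord0 o2).

(* The Hopf field p |-> i p of S^3 in C^2, lowered with the round metric and
   divided by the squared conformal factor of a stereographic chart. *)
Definition hopf x i : R :=
  - x ord0 o1 * (i == o0)%:R + x ord0 o0 * (i == o1)%:R
  + e * (x ord0 i * x ord0 o2 - (r2 x - 1) / 2 * (i == o2)%:R).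

Definition hopf_d i j x : R :=
  - (j == o1)%:R * (i == o0)%:R + (j == o0)%:R * (i == o1)%:R
  + e * ((i == j)%:R * x ord0 o2 + x ord0 i * (j == o2)%:R - x ord0 j * (i == o2)%:R).

Lemma der_hopf x i j : is_derive x (delta_mx ord0 j) (fun x => hopf x i) (hopf_d i j x).
Proof.
have D k : is_derive x (delta_mx ord0 j) (fun x : 'rV[R]_3 => x ord0 k) (k == j)%:R.
  exact: der_coord.
have DD k l : is_derive x (delta_mx ord0 j) (fun x : 'rV[R]_3 => x ord0 k * x ord0 l)
    ((k == j)%:R * x ord0 l + x ord0 k * (l == j)%:R) := derM (D k) (D l).
have H := derD (derD (der_scaler (i == o0)%:R (derN (D o1))) (der_scaler (i == o1)%:R (D o0)))
  (der_scale e (derB (DD i o2) (der_scaler (i == o2)%:R (der_scaler 2^-1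
    (derB (derD (derD (DD o0 o0) (DD o1 o1)) (DD o2 o2)) (derC 1 _ _)))))).
by apply: derE H _; rewrite /hopf_d; cases3 i; cases3 j => /=; field.
Qed.

Lemma hopf_smooth i : smooth (fun x => hopf x i).
Proof.
have c (t : R) : smooth (fun _ : 'rV[R]_3 => t) by exact: smooth_cst.
have X k : smooth (fun x : 'rV[R]_3 => x ord0 k) by exact: smooth_coord.
have XX k l : smooth (fun x : 'rV[R]_3 => x ord0 k * x ord0 l) by exact: smoothM.
apply: smoothD.
  by apply: smoothD; apply: smoothM => //; exact: smoothN.
apply: smoothM => //; apply: smoothD => //; apply: smoothN; apply: smoothM => //.
apply: smoothM => //; apply: smoothD => //.
by apply: smoothD => //; exact: smoothD.
Qed.

Lemma lam_r2 x : lam x * (r2 x + 1) = 2.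
Proof. by rewrite -(conformal_eq x) dot3 sum3. Qed.

Let e_sq : e * e = 1. Proof. exact: sgn_of_sq. Qed.

(** [hopf] is a conformal Killing field of the Euclidean metric. With [hopf_radial], which governs
    the change of the conformal factor along it, this makes it Killing for the round metric. *)
Lemma hopf_conformal x i j : hopf_d i j x + hopf_d j i x = 2 * e * x ord0 o2 * (i == j)%:R.
Proof. by rewrite /hopf_d; cases3 i; cases3 j => /=; ring. Qed.

Lemma hopf_radial x : lam x * \sum_l hopf x l * x ord0 l = e * x ord0 o2.
Proof.
transitivity (e * x ord0 o2 * (lam x * (r2 x + 1)) / 2); last by rewrite lam_r2; field.
by rewrite sum3 /hopf /=; field.
Qed.

Lemma hopf_norm x : lam x ^+ 2 * \sum_l hopf x l * hopf x l = 1.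
Proof.
transitivity ((lam x * (r2 x + 1)) ^+ 2 / 4
   + (e * e - 1) * lam x ^+ 2 * (r2 x - 1 - 2 * x ord0 o2 ^+ 2) ^+ 2 / 4
   + (e * e - 1) * lam x ^+ 2 * (x ord0 o0 ^+ 2 + x ord0 o1 ^+ 2) * x ord0 o2 ^+ 2).
  by rewrite sum3 /hopf /=; field.
by rewrite lam_r2 e_sq; field.
Qed.

(** The components (d_j eta_i - d_i eta_j) / 2 of the Hopf form eta = lambda^2 w, that is s_ij for
    the round pair. *)
Definition hopf_curl x i j : R :=
  lam x ^+ 2 * (hopf_d i j x - hopf_d j i x) / 2
  - lam x ^+ 3 * (x ord0 j * hopf x i - x ord0 i * hopf x j).

Lemma hopf_curl_anti x i j : hopf_curl x i j = - hopf_curl x j i.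
Proof. by rewrite /hopf_curl; ring. Qed.

Let lamE x : lam x = 2 / (r2 x + 1).
Proof. by rewrite /conformal dot3 sum3. Qed.

Let r21 x : r2 x + 1 != 0.
Proof.
have := conformal_eq x; rewrite dot3 sum3 => H; apply/eqP => H0.
by move: H; rewrite H0 mulr0 => /eqP; rewrite eq_sym pnatr_eq0.
Qed.

Lemma hopf_curl_ker x i : \sum_l hopf_curl x i l * hopf x l = 0.
Proof.
rewrite sum3 /hopf_curl lamE; have := r21 x.
rewrite /hopf_d /hopf /sgn_of.
move: (x ord0) => X h.
by cases3 i; case: eps; rewrite ?expr1 ?expr0 /=; field.
Qed.

(** With one index raised, that is after division by lambda^2, [hopf_curl] is a rotation by a right
    angle of the planes orthogonal to the Hopf fibres: its square is -1 there and 0 along the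
    fibre. *)
Lemma hopf_curl_sq x i j : \sum_l hopf_curl x i l * hopf_curl x l j =
  - (lam x ^+ 4 * (i == j)%:R - lam x ^+ 6 * (hopf x i * hopf x j)).
Proof.
rewrite sum3 /hopf_curl lamE; have := r21 x.
rewrite /hopf_d /hopf /sgn_of.
move: (x ord0) => X h.
by cases3 i; cases3 j; case: eps; rewrite ?expr1 ?expr0 /=; field.
Qed.

End HopfForm.

Local Transparent pd christoffel cov_form s_form s_up cov_s_up.

Section HopfChart.
Context {R : realType}.
Variables (eps : bool) (c c3 : R).
Hypothesis c_ge1 : 1 <= c.
Implicit Types (x y : 'rV[R]_3) (i j k l : 'I_3).

Local Notation lam := (@conformal R).
Local Notation w := (hopf eps).

(** c h + (c^2 - c) eta^2, with h round and eta the unit Hopf form: c = 1 is the round metric, and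
    in general h is scaled by c^2 along the fibre and by c across it. *)
Definition hopf_metric x : 'M[R]_3 :=
  \matrix_(i, j) (c * lam x ^+ 2 * (i == j)%:R
                  + (c ^+ 2 - c) * lam x ^+ 4 * (w x i * w x j)).

Definition hopf_form x : 'rV[R]_3 := \row_i (c3 * (lam x ^+ 2 * w x i)).

Let c_gt0 : 0 < c. Proof. exact: lt_le_trans c_ge1. Qed.

Let lam_neq0 x : lam x != 0. Proof. by rewrite gt_eqF // conformal_gt0. Qed.

Let smooth_lamX n : smooth (fun x => lam x ^+ n).
Proof.
elim: n => [|n IH]; first by apply: smooth_ext (smooth_cst 1) => x; rewrite expr0.
apply: smooth_ext (smoothM conformal_smooth IH) => x; by rewrite exprS.
Qed.

Lemma hopf_metric_smooth i j : smooth (fun x => hopf_metric x i j).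
Proof.
apply: (@smooth_ext _ _ (fun x => c * lam x ^+ 2 * (i == j)%:R
                  + (c ^+ 2 - c) * lam x ^+ 4 * (w x i * w x j))).
  by move=> x; rewrite mxE.
apply: smoothD; apply: smoothM.
- by apply: smoothM => //; exact: smooth_cst.
- exact: smooth_cst.
- by apply: smoothM => //; exact: smooth_cst.
- by apply: smoothM; exact: hopf_smooth.
Qed.

Lemma hopf_form_smooth i : smooth (fun x => hopf_form x ord0 i).
Proof.
apply: (@smooth_ext _ _ (fun x => c3 * (lam x ^+ 2 * w x i))) => [x|]; first by rewrite mxE.
apply: smoothM; first exact: smooth_cst.
by apply: smoothM => //; exact: hopf_smooth.
Qed.

Lemma hopf_metric_sym x i j : hopf_metric x i j = hopf_metric x j i.
Proof. by rewrite !mxE eq_sym [w x i * _]mulrC. Qed.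

Lemma hopf_metric_bil x (u v : 'I_3 -> R) : bil (hopf_metric x) u v =
  c * lam x ^+ 2 * pair3 u v
  + (c ^+ 2 - c) * lam x ^+ 4 * (pair3 (w x) u * pair3 (w x) v).
Proof.
rewrite /bil /mulv /pair3 !sum3 !mxE /=.
by move: (w x) => w'; ring.
Qed.

Lemma hopf_metric_pos x v : (exists i, v i != 0) -> 0 < bil (hopf_metric x) v v.
Proof.
move=> [i vi]; rewrite hopf_metric_bil.
have vv : 0 < pair3 v v.
  rewrite /pair3 (bigD1 i) //= ltr_pwDl //; last by apply: sumr_ge0 => j _; rewrite -expr2 sqr_ge0.
  by rewrite -expr2 exprn_even_gt0.
apply: ltr_pwDl; first by rewrite mulr_gt0 // mulr_gt0 // exprn_gt0 // conformal_gt0.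
rewrite -expr2 mulr_ge0 ?sqr_ge0 // mulr_ge0 //.
  by rewrite subr_ge0 expr2 ler_peMl // ltW.
by rewrite exprn_ge0 // ltW // conformal_gt0.
Qed.

Lemma hopf_metric_unit x : hopf_metric x \in unitmx.
Proof. by apply: pos_unitmx; exact: hopf_metric_pos. Qed.

Let w_norm x : lam x ^+ 2 * pair3 (w x) (w x) = 1. Proof. exact: hopf_norm. Qed.

Lemma hopf_form_sharp x i : hopf_form x ord0 i = \sum_l hopf_metric x i l * (c3 / c ^+ 2 * w x l).
Proof.
have c0 : c != 0 by rewrite gt_eqF.
have E : \sum_l hopf_metric x i l * (c3 / c ^+ 2 * w x l) =
    c3 / c ^+ 2 * (c * lam x ^+ 2 * w x i
      + (c ^+ 2 - c) * lam x ^+ 2 * w x i * (lam x ^+ 2 * pair3 (w x) (w x))).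
  by rewrite /pair3 !sum3 !mxE; cases3 i => /=; ring.
by rewrite E w_norm mxE; field.
Qed.

Let der_lam2 x k : is_derive x (delta_mx ord0 k) (fun x => lam x ^+ 2)
  (- 2 * lam x ^+ 3 * x ord0 k).
Proof. by apply: derE (derX 2 (der_conformal x k)) _ => /=; ring. Qed.

Let der_lam4 x k : is_derive x (delta_mx ord0 k) (fun x => lam x ^+ 4)
  (- 4 * lam x ^+ 5 * x ord0 k).
Proof. by apply: derE (derX 4 (der_conformal x k)) _ => /=; ring. Qed.

Lemma pd_hopf_metric x i j k : pd k (fun z => hopf_metric z i j) x =
  c * (- 2 * lam x ^+ 3 * x ord0 k) * (i == j)%:R
  + (c ^+ 2 - c) * (- 4 * lam x ^+ 5 * x ord0 k * (w x i * w x j)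
     + lam x ^+ 4 * (hopf_d eps i k x * w x j + w x i * hopf_d eps j k x)).
Proof.
apply: der_val; apply: (@der_ext _ _ (fun x => c * lam x ^+ 2 * (i == j)%:R
     + (c ^+ 2 - c) * (lam x ^+ 4 * (w x i * w x j)))).
  by move=> z; rewrite mxE mulrA.
apply: derD; first by apply: der_scaler; apply: der_scale; exact: der_lam2.
apply: der_scale; apply: derM; first exact: der_lam4.
by apply: derM; exact: der_hopf.
Qed.

Lemma hopf_lie x i j : \sum_l (w x l * pd l (fun z => hopf_metric z i j) x
  + hopf_metric x i l * hopf_d eps l j x + hopf_metric x j l * hopf_d eps l i x) = 0.
Proof.
under eq_bigr do rewrite pd_hopf_metric !mxE.
have H1 := hopf_radial eps x; have H2 := hopf_conformal eps x.
have E (L e2 : R) (X v : 'I_3 -> R) (W : 'I_3 -> 'I_3 -> R) :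
    L * (\sum_l v l * X l) = e2 ->
    (forall i j, W i j + W j i = 2 * e2 * (i == j)%:R) ->
    \sum_l (v l * (c * (- 2 * L ^+ 3 * X l) * (i == j)%:R
      + (c ^+ 2 - c) * (- 4 * L ^+ 5 * X l * (v i * v j)
         + L ^+ 4 * (W i l * v j + v i * W j l)))
      + (c * L ^+ 2 * (i == l)%:R + (c ^+ 2 - c) * L ^+ 4 * (v i * v l)) * W l j
      + (c * L ^+ 2 * (j == l)%:R + (c ^+ 2 - c) * L ^+ 4 * (v j * v l)) * W l i) = 0.
  move=> h1 h2.
  (* The Lie derivatives of h and of eta^2 appear with the factors c and c^2 - c, and vanish
     separately. *)
  transitivity (c * L ^+ 2 * (W i j + W j i - 2 * (L * \sum_l v l * X l) * (i == j)%:R)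
    + (c ^+ 2 - c) * L ^+ 4 * (v j * (\sum_l v l * (W i l + W l i))
       + v i * (\sum_l v l * (W j l + W l j)) - 4 * (L * \sum_l v l * X l) * (v i * v j))).
    by rewrite !sum3; cases3 i; cases3 j => /=; ring.
  have S m : \sum_l v l * (W m l + W l m) = 2 * e2 * v m.
    by under eq_bigr do rewrite h2; rewrite sum3; cases3 m => /=; ring.
  by rewrite h1 h2 !S; ring.
apply: (E (lam x) (sgn_of eps * x ord0 o2) (x ord0) (w x) (fun i j => hopf_d eps i j x) H1).
by move=> i' j'; rewrite H2 mulrA.
Qed.

Lemma hopf_killing x : r_form hopf_metric hopf_form x = 0.
Proof.
apply: (@lie_killing _ hopf_metric hopf_form (fun l x => c3 / c ^+ 2 * w x l)).
- exact: hopf_metric_smooth.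
- exact: hopf_metric_sym.
- exact: hopf_metric_unit.
- by move=> l; apply: smoothM; [exact: smooth_cst|exact: hopf_smooth].
- exact: hopf_form_sharp.
- move=> x' i j.
  have pdxi l k : pd k (fun x => c3 / c ^+ 2 * w x l) x' = c3 / c ^+ 2 * hopf_d eps l k x'.
    by apply: der_val; apply: der_scale; exact: der_hopf.
  under eq_bigr do rewrite !pdxi.
  apply: (etrans _ (etrans (congr1 ( *%R (c3 / c ^+ 2)) (hopf_lie x' i j)) (mulr0 _))).
  rewrite mulr_sumr.
  apply: eq_bigr => l _; move: (pd l _ x') (hopf_metric x' i l) (hopf_metric x' j l).
  by move: (w x' l) (hopf_d eps l j x') (hopf_d eps l i x') => *; ring.
Qed.

Lemma hopf_norm_eq x :
  dot (hopf_form x *m invmx (hopf_metric x)) (hopf_form x) = c3 ^+ 2 / c ^+ 2.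
Proof.
have c0 : c != 0 by rewrite gt_eqF.
pose h : 'rV[R]_3 := \row_l (c3 / c ^+ 2 * w x l).
have -> : hopf_form x = h *m hopf_metric x.
  apply/rowP => i; rewrite hopf_form_sharp [RHS]mxE; apply: eq_bigr => l _.
  by rewrite hopf_metric_sym [h _ _]mxE mulrC.
rewrite mulmxK ?hopf_metric_unit // dot3.
have -> : h *m hopf_metric x = hopf_form x.
  apply/rowP => i; rewrite hopf_form_sharp [LHS]mxE; apply: eq_bigr => l _.
  by rewrite hopf_metric_sym [h _ _]mxE mulrC.
transitivity (c3 ^+ 2 / c ^+ 2 * (lam x ^+ 2 * pair3 (w x) (w x))).
  by rewrite /pair3 !sum3 !mxE; move: (w x) (lam x) => w' L; ring.
by rewrite w_norm mulr1.
Qed.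

Lemma hopf_s_form x i j : s_form hopf_metric hopf_form x i j = c3 * hopf_curl eps x i j.
Proof.
have db k m : pd k (fun z => hopf_form z ord0 m) x =
    c3 * (- 2 * lam x ^+ 3 * x ord0 k * w x m + lam x ^+ 2 * hopf_d eps m k x).
  apply: der_val; apply: (@der_ext _ _ (fun x => c3 * (lam x ^+ 2 * w x m))) => [z|].
    by rewrite mxE.
  by apply: der_scale; apply: derM; [exact: der_lam2|exact: der_hopf].
rewrite mxE !cov_formE !db.
under [X in _ - X - _]eq_bigr do rewrite (christoffel_sym hopf_metric_sym).
move: (\sum_k _) => t; rewrite /hopf_curl.
move: (hopf_d eps i j x) (hopf_d eps j i x) (w x i) (w x j) (lam x) => W1 W2 w1 w2 L.
by field.
Qed.

(** The fibre direction is in the kernel of [hopf_curl], so the eta^2 part of the metric does not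
    contribute and raising the index divides by c lambda^2. *)
Lemma hopf_s_up x i j : s_up hopf_metric hopf_form x i j =
  c3 / (c * lam x ^+ 2) * hopf_curl eps x i j.
Proof.
have c0 : c != 0 by rewrite gt_eqF.
pose X : 'M[R]_3 := \matrix_(i, j) (c3 / (c * lam x ^+ 2) * hopf_curl eps x i j).
suff -> : s_up hopf_metric hopf_form x = X by rewrite mxE.
have -> : X = invmx (hopf_metric x) *m (hopf_metric x *m X).
  by rewrite mulmxA mulVmx ?hopf_metric_unit // mul1mx.
rewrite /s_up; congr (_ *m _); apply/matrixP => k l; rewrite hopf_s_form [RHS]mxE.
have ker : \sum_m w x m * hopf_curl eps x m l = 0.
  transitivity (- \sum_m hopf_curl eps x l m * w x m); last by rewrite hopf_curl_ker oppr0.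
  by rewrite -sumrN; apply: eq_bigr => m _; rewrite hopf_curl_anti mulrN mulrC.
transitivity (c3 * (\sum_m (k == m)%:R * hopf_curl eps x m l)
   + (c ^+ 2 - c) * lam x ^+ 4 * w x k * (c3 / (c * lam x ^+ 2)) *
     (\sum_m w x m * hopf_curl eps x m l)).
  by rewrite ker mulr0 addr0 sum_delta.
have L0 := lam_neq0 x.
rewrite !sum3 ![hopf_metric x _ _]mxE ![X _ _]mxE.
by move: (hopf_curl eps x) (w x) (lam x) L0 => T w' L L0; cases3 k => /=; field; rewrite L0 c0.
Qed.

Lemma hopf_ss x y : s0s0 hopf_metric hopf_form x y =
  - (c3 ^+ 2 / c ^+ 2 * bil (hopf_metric x) (y ord0) (y ord0)
     - pair3 (hopf_form x ord0) (y ord0) ^+ 2).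
Proof.
have c0 : c != 0 by rewrite gt_eqF.
have L0 := lam_neq0 x.
rewrite /s0s0 dot_mul hopf_metric_bil.
have SS i j : (s_form hopf_metric hopf_form x *m s_up hopf_metric hopf_form x) i j =
   c3 ^+ 2 / (c * lam x ^+ 2) * - (lam x ^+ 4 * (i == j)%:R - lam x ^+ 6 * (w x i * w x j)).
  rewrite mxE -hopf_curl_sq mulr_sumr; apply: eq_bigr => l _.
  by rewrite hopf_s_form hopf_s_up; move: (hopf_curl _ _ _ _) (hopf_curl _ _ _ _) => t t'; field; rewrite L0 c0.
under eq_bigr do under eq_bigr do rewrite SS.
rewrite /pair3 !sum3 !mxE /=.
by move: (w x) (lam x) L0 (y ord0) => w' L L0 y'; field; rewrite L0 c0.
Qed.

Lemma hopf_killing_chart : killing_chart hopf_metric hopf_form (c3 ^+ 2 / c ^+ 2).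
Proof.
split.
- exact: hopf_metric_smooth.
- exact: hopf_metric_sym.
- exact: hopf_metric_pos.
- exact: hopf_form_smooth.
- exact: hopf_killing.
- exact: hopf_norm_eq.
- exact: hopf_ss.
Qed.

End HopfChart.

(** * Ricci curvature of the round sphere *)

Section RoundSphere.
Context {R : realType}.
Variable eps : bool.
Implicit Types (x y : 'rV[R]_3) (i j k l m : 'I_3).

Local Notation lam := (@conformal R).
Local Notation g0 := (@hopf_metric R eps 1).

Lemma round_metricE x i j : g0 x i j = lam x ^+ 2 * (i == j)%:R.
Proof. by rewrite mxE; ring. Qed.

Lemma round_christoffel i j k x : christoffel g0 i j k x =
  - (lam x * (x ord0 j * (i == k)%:R + x ord0 k * (i == j)%:R - x ord0 i * (j == k)%:R)).
Proof.
have L0 : lam x ^+ 2 != 0 by rewrite expf_neq0 // gt_eqF // conformal_gt0.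
have := christoffel_lower (hopf_metric_unit eps (lexx 1)) x i j k.
under eq_bigr do rewrite round_metricE -mulrA.
rewrite -mulr_sumr sum_delta !pd_hopf_metric => H.
apply: (mulfI L0); rewrite H.
by field.
Qed.

Lemma pd_round_christoffel i j k m x : pd m (christoffel g0 i j k) x =
  lam x ^+ 2 * x ord0 m * (x ord0 j * (i == k)%:R + x ord0 k * (i == j)%:R - x ord0 i * (j == k)%:R)
  - lam x * ((j == m)%:R * (i == k)%:R + (k == m)%:R * (i == j)%:R - (i == m)%:R * (j == k)%:R).
Proof.
apply: der_val; apply: (@der_ext _ _ (fun x => - (lam x * (x ord0 j * (i == k)%:R
   + x ord0 k * (i == j)%:R - x ord0 i * (j == k)%:R)))).
  by move=> z; rewrite round_christoffel.
apply: derE.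
  apply: derN; apply: derM; first exact: der_conformal.
  apply: derB; last by apply: der_scaler; exact: der_coord.
  by apply: derD; apply: der_scaler; exact: der_coord.
by cbv beta; ring.
Qed.

Lemma round_ricci x y : \sum_m spray_riemann g0 m m x y =
  2 * (lam x ^+ 2 * pair3 (y ord0) (y ord0)).
Proof.
have H := lam_r2 x.
have E (D : 'I_3 -> 'I_3 -> 'I_3 -> 'I_3 -> R) (G : 'I_3 -> 'I_3 -> 'I_3 -> R) (L : R) (X w : 'I_3 -> R) :
  L * (X o0 * X o0 + X o1 * X o1 + X o2 * X o2 + 1) = 2 ->
  (forall m i j k, D m i j k =
     L ^+ 2 * X m * (X j * (i == k)%:R + X k * (i == j)%:R - X i * (j == k)%:R)
     - L * ((j == m)%:R * (i == k)%:R + (k == m)%:R * (i == j)%:R - (i == m)%:R * (j == k)%:R)) ->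
  (forall i j k, G i j k = - (L * (X j * (i == k)%:R + X k * (i == j)%:R - X i * (j == k)%:R))) ->
  \sum_k (2 * (2^-1 * \sum_n (\sum_l D k k n l * w l) * w n)
    - \sum_m 2^-1 * (\sum_n (D m k k n + D m k n k) * w n) * w m
    + 2 * \sum_m (2^-1 * \sum_n (\sum_l G m n l * w l) * w n) * G k m k
    - \sum_m (\sum_l G k m l * w l) * (\sum_l G m k l * w l)) =
  2 * (L ^+ 2 * pair3 w w).
  move=> h hD hG.
  transitivity (2 * (2 * L - L * (L * (X o0 * X o0 + X o1 * X o1 + X o2 * X o2 + 1)) + L ^+ 2) * pair3 w w).
    by rewrite /pair3 !sum3 !hD !hG /=; field.
  by rewrite h; ring.
rewrite /spray_riemann /spray_dx /spray_dy /spray.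
apply: (E (fun m i j k => pd m (christoffel g0 i j k) x) (fun i j k => christoffel g0 i j k x)
   (lam x) (x ord0) (y ord0) H).
- by move=> m i j k; exact: pd_round_christoffel.
- by move=> i j k; exact: round_christoffel.
Qed.

End RoundSphere.

(** * Smoothness in one variable on the interval |s| < b0 *)

Section SmoothOnInterval.
Context {R : realType}.
Variable b0 : R.
Implicit Types (f g : R -> R) (s : R).

Local Notation I s := (`|s| < b0).

(** The grading of [smoothn], for functions that matter only on |s| < b0; through [smooth_on_der] a
    formula for the derivative raises the order by one. *)
Fixpoint smooth_on (n : nat) f : Prop :=
  (forall s, I s -> derivable f s 1) /\
  (if n is n'.+1 then smooth_on n' (derive1 f) else True).

Let near_I s : I s -> \forall t \near s, I t.
Proof.
move=> sb; have H : `|t| @[t --> s] --> `|s| by apply: norm_continuous.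
exact: (cvgr_lt _ H).
Qed.

Lemma smooth_on_derivable n f : (forall m, smooth_on m f) ->
  forall s, I s -> derivable (derive1n n f) s 1.
Proof.
elim: n f => [|n IH] f H s sb; first by have [fd _] := H 0%N; exact: fd.
by rewrite derive1Sn; apply: IH => // m; have [_] := H m.+1.
Qed.

Lemma smooth_on_ext n f g : (forall s, I s -> f s = g s) -> smooth_on n f -> smooth_on n g.
Proof.
elim: n f g => [|n IH] f g fg [fd fn].
  split=> // s sb; have E : \near s, f s = g s by apply: filterS (near_I sb) => t; exact: fg.
  by case: (der_eq E (derivableP (fd s sb))).
split=> [s sb|].
  have E : \near s, f s = g s by apply: filterS (near_I sb) => t; exact: fg.
  by case: (der_eq E (derivableP (fd s sb))).
apply: IH fn => s sb; rewrite !derive1E; apply: near_eq_derive.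
by apply: filterS (near_I sb) => t; exact: fg.
Qed.

Lemma smooth_on_der n f f' : (forall s, I s -> is_derive s 1 f (f' s)) ->
  smooth_on n f' -> smooth_on n.+1 f.
Proof.
move=> H fn; split=> [s sb|]; first by have [] := H s sb.
by apply: smooth_on_ext fn => s sb; rewrite derive1E (der_val (H s sb)).
Qed.

Lemma smooth_onW n f : smooth_on n.+1 f -> smooth_on n f.
Proof.
elim: n f => [|n IH] f [fd fk]; first by split.
by split=> //; exact: IH.
Qed.

Lemma smooth_on_is_derive n f s : I s -> smooth_on n f -> is_derive s 1 f (derive1 f s).
Proof. by move=> sb; case: n => [|n] [fd _]; rewrite derive1E; apply: derivableP; exact: fd. Qed.

Lemma smooth_on_cst n (c : R) : smooth_on n (fun=> c).
Proof.
elim: n c => [|n IH] c; first by split=> // s _; case: (derC c s 1).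
by apply: (@smooth_on_der _ _ (fun=> 0)) (IH 0) => s _; exact: derC.
Qed.

Lemma smooth_on_id n : smooth_on n (fun s => s).
Proof.
case: n => [|n]; first by split=> // s _; case: (derId s).
by apply: (@smooth_on_der _ _ (fun=> 1)) (smooth_on_cst _ _) => s _; exact: derId.
Qed.

Lemma smooth_onD n f g : smooth_on n f -> smooth_on n g -> smooth_on n (fun s => f s + g s).
Proof.
elim: n f g => [|n IH] f g Hf Hg.
  split=> // s sb.
  by case: (derD (smooth_on_is_derive sb Hf) (smooth_on_is_derive sb Hg)).
apply: (@smooth_on_der _ _ (fun s => derive1 f s + derive1 g s)).
  by move=> s sb; exact: derD (smooth_on_is_derive sb Hf) (smooth_on_is_derive sb Hg).
by have [_ f'] := Hf; have [_ g'] := Hg; exact: IH.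
Qed.

Lemma smooth_onM n f g : smooth_on n f -> smooth_on n g -> smooth_on n (fun s => f s * g s).
Proof.
elim: n f g => [|n IH] f g Hf Hg.
  split=> // s sb.
  by case: (derM (smooth_on_is_derive sb Hf) (smooth_on_is_derive sb Hg)).
apply: (@smooth_on_der n (fun s => f s * g s) (fun s => derive1 f s * g s + f s * derive1 g s)).
  by move=> s sb; exact: derM (smooth_on_is_derive sb Hf) (smooth_on_is_derive sb Hg).
have [_ f'] := Hf; have [_ g'] := Hg.
by apply: smooth_onD; apply: IH => //; exact: smooth_onW.
Qed.

Lemma smooth_onX n f k : smooth_on n f -> smooth_on n (fun s => f s ^+ k).
Proof.
move=> Hf; elim: k => [|k IH].
  by apply: smooth_on_ext (smooth_on_cst n 1) => s _; rewrite expr0.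
by apply: smooth_on_ext (smooth_onM Hf IH) => s _; rewrite exprS.
Qed.

End SmoothOnInterval.

(** * The function expressing a Berger metric over the round sphere *)

Section BergerFunction.
Context {R : realType}.
Variables (c1 c2 : R).
Hypothesis c1_gt0 : 0 < c1.
Hypothesis c2_ge0 : 0 <= c2.

Definition berger_fun (s : R) : R := Num.sqrt (c1 + c2 * s ^+ 2).

Let arg_gt0 s : 0 < c1 + c2 * s ^+ 2.
Proof. by rewrite ltr_pwDl // mulr_ge0 // sqr_ge0. Qed.

Lemma berger_fun_gt0 s : 0 < berger_fun s. Proof. by rewrite sqrtr_gt0. Qed.

Let bf_neq0 s : berger_fun s != 0. Proof. by rewrite gt_eqF // berger_fun_gt0. Qed.

Lemma berger_fun_sq s : berger_fun s ^+ 2 = c1 + c2 * s ^+ 2.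
Proof. by rewrite sqr_sqrtr // ltW. Qed.

Lemma der_berger_fun (s : R) : is_derive s 1 berger_fun (c2 * s * (berger_fun s)^-1).
Proof.
have D : is_derive s 1 (fun s : R => c1 + c2 * s ^+ 2) (2 * c2 * s).
  apply: derE (derD (derC c1 s 1) (der_scale c2 (derX 2 (derId s)))) _.
  by rewrite add0r /=; ring.
apply: derE (der_sqrt (g := fun s : R => c1 + c2 * s ^+ 2) (arg_gt0 s) D) _.
rewrite -/(berger_fun s).
by have := bf_neq0 s; move: (berger_fun s) => t t0; field.
Qed.

Lemma der_berger_inv (s : R) :
  is_derive s 1 (fun s => (berger_fun s)^-1) (- (c2 * s) * (berger_fun s)^-1 ^+ 3).
Proof.
apply: derE (derV (f := berger_fun) (bf_neq0 s) (der_berger_fun s)) _.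
by have := bf_neq0 s; move: (berger_fun s) => t t0; field.
Qed.

Lemma berger_derive1 s : derive1 berger_fun s = c2 * s / berger_fun s.
Proof. by rewrite derive1E (der_val (der_berger_fun s)). Qed.

Lemma berger_derive2 s : derive1n 2 berger_fun s = c1 * c2 / berger_fun s ^+ 3.
Proof.
have -> : derive1n 2 berger_fun = derive1 (fun s => c2 * s * (berger_fun s)^-1).
  by congr derive1; apply/funext => t; rewrite berger_derive1.
have H := derM (der_scale c2 (derId s)) (der_berger_inv s).
rewrite derive1E (der_val H).
have := berger_fun_sq s; have := bf_neq0 s; move: (berger_fun s) => t t0 tE.
have -> : c1 * c2 = (t ^+ 2 - c2 * s ^+ 2) * c2 by rewrite tE; ring.
by field.
Qed.

Lemma berger_den s : berger_fun s - s * derive1 berger_fun s = c1 / berger_fun s.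
Proof.
rewrite berger_derive1; have := berger_fun_sq s; have := bf_neq0 s.
move: (berger_fun s) => t t0 tE; have -> : c1 = t ^+ 2 - c2 * s ^+ 2 by rewrite tE; ring.
by field.
Qed.

(** Since Q is linear, Q - s Q' vanishes and the trace formula becomes a quadratic polynomial in s,
    as it must for a Riemannian metric. *)
Lemma berger_Qfun s : Qfun berger_fun s = c2 / c1 * s.
Proof.
rewrite /Qfun berger_den berger_derive1.
have := bf_neq0 s; move: (berger_fun s) => t t0.
by field; rewrite t0 gt_eqF.
Qed.

Lemma berger_derive1_Qfun s : derive1 (Qfun berger_fun) s = c2 / c1.
Proof.
have -> : Qfun berger_fun = fun s => c2 / c1 * s by apply/funext => t; exact: berger_Qfun.
by rewrite derive1E (der_val (der_scale (c2 / c1) (derId s))) mulr1.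
Qed.

Lemma berger_delta (C s : R) : s ^+ 2 <= C ->
  0 < berger_fun s - s * derive1 berger_fun s + (C - s ^+ 2) * derive1n 2 berger_fun s.
Proof.
move=> sC; rewrite berger_den berger_derive2.
have t0 := berger_fun_gt0 s; rewrite ltr_pwDl // ?divr_gt0 //.
rewrite mulr_ge0 ?subr_ge0 // divr_ge0 ?exprn_ge0 ?mulr_ge0 // ltW //.
Qed.

Lemma berger_admissible b0 : 0 < b0 -> admissible b0 berger_fun.
Proof.
move=> b00; split=> // [k s sb|s _|s c sc _]; last first.
- apply: berger_delta; rewrite -[s ^+ 2]real_normK ?num_real //.
  by rewrite ler_sqr ?nnegrE // (le_trans _ sc).
- exact: berger_fun_gt0.
apply: (smooth_on_derivable (b0 := b0)) => // n.
(* The function and its inverse are treated together: the derivative of each is a polynomial in s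
   and the inverse. *)
suff [] : smooth_on b0 n berger_fun /\ smooth_on b0 n (fun s => (berger_fun s)^-1) by [].
elim: n => [|n [H1 H2]].
  split; split=> // t _; first by case: (der_berger_fun t).
  by case: (der_berger_inv t).
split.
  apply: smooth_on_der; first by move=> t _; exact: der_berger_fun.
  by apply: smooth_onM => //; apply: smooth_onM; [exact: smooth_on_cst|exact: smooth_on_id].
apply: smooth_on_der; first by move=> t _; exact: der_berger_inv.
apply: smooth_onM; last exact: smooth_onX.
apply: (@smooth_on_ext _ _ _ (fun s => (- c2) * s)) => [t _|]; first by rewrite mulNr.
by apply: smooth_onM; [exact: smooth_on_cst|exact: smooth_on_id].
Qed.

End BergerFunction.

Section BergerPair.
Context {R : realType}.
Variable bb : R.
Hypothesis bb_gt0 : 0 < bb.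
Hypothesis bb_lt1 : bb < 1.
Implicit Types (x y : 'rV[R]_3) (i j k l m : 'I_3) (p u v : 'rV[R]_(3 + 1)).

Definition kap : R := 1 - bb ^+ 2.

Lemma kap_gt0 : 0 < kap.
Proof. by rewrite subr_gt0 expr_lt1 // ltW. Qed.

Let k0 : kap != 0. Proof. by rewrite gt_eqF // kap_gt0. Qed.

Local Notation c := (kap^-1).
Local Notation c3 := (bb / kap).

Let c_ge1 : 1 <= c.
Proof. by rewrite invf_ge1 ?kap_gt0 // /kap gerBl sqr_ge0. Qed.

Let c2E : c ^+ 2 - c = bb ^+ 2 / kap ^+ 2.
Proof. by rewrite /kap; have := k0; rewrite /kap => h; field. Qed.

Let CE : c3 ^+ 2 / c ^+ 2 = bb ^+ 2.
Proof. by field. Qed.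

(* Multiplication by i on C^2 = R^4, with complex coordinates (p0 + i p1, p2 + i p3). *)
Definition mul_i p : 'rV[R]_(3 + 1) :=
  row_mx (row3 (- p ord0 (lshift 1 o1)) (p ord0 (lshift 1 o0)) (- p ord0 (rshift 3 ord0)))
         (p ord0 (lshift 1 o2))%:M.

Definition berger_metric p : 'M[R]_(3 + 1) :=
  kap^-1 *: 1%:M + (bb ^+ 2 / kap ^+ 2) *: ((mul_i p)^T *m mul_i p).

Definition berger_form p : 'rV[R]_(3 + 1) := (bb / kap) *: mul_i p.

Lemma dotC n (u v : 'rV[R]_n) : dot u v = dot v u.
Proof. by rewrite /dot -[in LHS](trmxK u) -trmx_mul mxE. Qed.

Lemma berger_metric_dot p u v : dot (u *m berger_metric p) v =
  kap^-1 * dot u v + bb ^+ 2 / kap ^+ 2 * (dot (mul_i p) u * dot (mul_i p) v).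
Proof.
rewrite /dot /berger_metric mulmxDr mulmxDl mxE -!scalemxAr -!scalemxAl mulmx1.
rewrite [in X in X + _]mxE [in X in _ + X]mxE; congr (_ + _ * _).
rewrite !mulmxA -[u *m _ *m _ *m _]mulmxA mxE big_ord1; congr (_ * _).
exact: dotC.
Qed.

Lemma mul_i_l p : mul_i p ord0 (lshift 1 o0) = - p ord0 (lshift 1 o1)
  /\ mul_i p ord0 (lshift 1 o1) = p ord0 (lshift 1 o0)
  /\ mul_i p ord0 (lshift 1 o2) = - p ord0 (rshift 3 ord0)
  /\ mul_i p ord0 (rshift 3 ord0) = p ord0 (lshift 1 o2).
Proof. by rewrite /mul_i row_mxEr !row_mxEl /row3 ![(\row_j _) _ _]mxE mxE /=. Qed.

(** Identifies the ambient field p -> i p with the coordinate expression [hopf] in both charts;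
    through it [berger_metric] and [berger_form] become [hopf_metric] and [hopf_form]. *)
Lemma mul_i_frame eps x i : dot (mul_i (stereo eps x)) (row i (frame eps x)) =
  conformal x ^+ 2 * hopf eps x i.
Proof.
have [m0 [m1 [m2 m3]]] := mul_i_l (stereo eps x).
rewrite dot4 sum3 m0 m1 m2 m3 !stereo_l stereo_r ![row i _ _ _]mxE !frame_l frame_r.
have := conformal_eq x; rewrite dot3 sum3 => H.
have := sgn_of_sq (R := R) eps; rewrite /hopf; move: (sgn_of eps) => e ee.
move: (conformal x) H => L H.
move: (x ord0) H => X H.
transitivity (L ^+ 2 * (- X o1 * (i == o0)%:R + X o0 * (i == o1)%:R
     + e * (X i * X o2)) - e * (L - L ^+ 2) * (i == o2)%:R).
  by cases3 i => /=; ring.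
transitivity (L ^+ 2 * (- X o1 * (i == o0)%:R + X o0 * (i == o1)%:R
     + e * (X i * X o2)) - e * (L * (L * (X o0 * X o0 + X o1 * X o1 + X o2 * X o2 + 1)) / 2 - L ^+ 2) * (i == o2)%:R).
  by rewrite H mulfK.
by field.
Qed.

Lemma berger_metric_coef eps x : metric_coef berger_metric eps x = hopf_metric eps c x.
Proof.
apply/matrixP => i j.
transitivity (dot (row i (frame eps x) *m berger_metric (stereo eps x)) (row j (frame eps x))).
  rewrite /metric_coef /dot -row_mul mxE [RHS]mxE; apply: eq_bigr => m _.
  by rewrite [_^T _ _]mxE [_^T _ _]mxE [row i _ _ _]mxE [row j _ _ _]mxE.
rewrite berger_metric_dot !mul_i_frame.
have -> : dot (row i (frame eps x)) (row j (frame eps x)) = conformal x ^+ 2 * (i == j)%:R.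
  rewrite -(frame_gram eps) /dot mxE [RHS]mxE; apply: eq_bigr => m _.
  by rewrite [_^T _ _]mxE [_^T _ _]mxE [row i _ _ _]mxE [row j _ _ _]mxE.
by rewrite [hopf_metric _ _ _ _ _]mxE c2E; ring.
Qed.

Lemma berger_form_coef eps x : form_coef berger_form eps x = hopf_form eps c3 x.
Proof.
apply/rowP => i; rewrite [hopf_form _ _ _ _ _]mxE -mul_i_frame.
rewrite /form_coef /berger_form -scalemxAl mxE; congr (_ * _).
rewrite /dot mxE [RHS]mxE; apply: eq_bigr => m _.
by rewrite [_^T _ _]mxE [_^T _ _]mxE [row i _ _ _]mxE.
Qed.

Lemma berger_riemannian : riemannian_metric berger_metric.
Proof.
split.
- move=> p u v _ _ _; rewrite !berger_metric_dot dotC; congr (_ + _ * _); exact: mulrC.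
- move=> p v _ _ v0; rewrite berger_metric_dot; apply: ltr_pwDl.
    rewrite mulr_gt0 ?invr_gt0 ?kap_gt0 //.
    rewrite lt_neqAle eq_sym; apply/andP; split; last first.
      by rewrite /dot mxE; apply: sumr_ge0 => i _; rewrite mxE -expr2 sqr_ge0.
    apply: contraNneq v0 => H; apply/eqP/rowP => i; rewrite [RHS]mxE; apply/eqP.
    rewrite -sqrf_eq0 expr2; apply/eqP.
    move: H; rewrite /dot mxE => /psumr_eq0P H.
    have := H _ i isT; rewrite mxE; apply => j _; by rewrite mxE -expr2 sqr_ge0.
  by rewrite -expr2 mulr_ge0 ?sqr_ge0 // divr_ge0 ?sqr_ge0.
- move=> eps i j.
  apply: (@smooth_ext _ _ (fun x => hopf_metric eps c x i j)); last exact: hopf_metric_smooth.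
  by move=> x; rewrite berger_metric_coef.
Qed.

Lemma berger_form_smooth : smooth_form berger_form.
Proof.
move=> eps i; apply: (@smooth_ext _ _ (fun x => hopf_form eps c3 x ord0 i)); last exact: hopf_form_smooth.
by move=> x; rewrite berger_form_coef.
Qed.

Let coefs eps : metric_coef berger_metric eps = hopf_metric eps c
  /\ form_coef berger_form eps = hopf_form eps c3.
Proof. by split; apply/funext => x; rewrite ?berger_metric_coef ?berger_form_coef. Qed.

Let KB eps : killing_chart (hopf_metric eps c) (hopf_form eps c3) (bb ^+ 2).
Proof. rewrite -CE; exact: hopf_killing_chart. Qed.

Lemma berger_killing : killing_form berger_metric berger_form.
Proof. by move=> eps x; have [-> ->] := coefs eps; exact: (kc_killing (KB eps)). Qed.

Lemma berger_length : constant_length berger_metric berger_form bb.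
Proof.
move=> eps x; have [-> ->] := coefs eps.
by rewrite /form_norm (kc_norm (KB eps)) sqrtr_sqr gtr0_norm.
Qed.

Section RoundToBerger.
Variable eps : bool.
Local Notation q1 x y := (pair3 (y ord0) (mulv (hopf_metric eps 1 x) (y ord0))).
Local Notation be1 x y := (pair3 (hopf_form eps 1 x ord0) (y ord0)).
Local Notation qB x y := (pair3 (y ord0) (mulv (metric_coef berger_metric eps x) (y ord0))).
Local Notation beB x y := (pair3 (form_coef berger_form eps x ord0) (y ord0)).
Local Notation psi := (berger_fun c (c ^+ 2 - c)).

Let K1 : killing_chart (hopf_metric eps 1) (hopf_form eps 1) (1 : R).
Proof.
have := hopf_killing_chart eps (1 : R) (lexx (1 : R)).
by rewrite expr1n divr1.
Qed.

Let q1E x y : q1 x y = conformal x ^+ 2 * pair3 (y ord0) (y ord0).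
Proof.
by have := hopf_metric_bil eps 1 x (y ord0) (y ord0); rewrite /bil => ->; rewrite expr1n; ring.
Qed.

Let be1E x y : be1 x y = conformal x ^+ 2 * pair3 (hopf eps x) (y ord0).
Proof. by rewrite /pair3 !sum3 ![hopf_form _ _ _ _ _]mxE; ring. Qed.

Let qBE x y : qB x y = c * q1 x y + (c ^+ 2 - c) * be1 x y ^+ 2.
Proof.
rewrite berger_metric_coef q1E be1E.
by have := hopf_metric_bil eps c x (y ord0) (y ord0); rewrite /bil => ->; ring.
Qed.

Let beBE x y : beB x y = c3 * be1 x y.
Proof. by rewrite berger_form_coef be1E /pair3 !sum3 ![hopf_form _ _ _ _ _]mxE; ring. Qed.

Let q1_ge0 x y : 0 <= q1 x y.
Proof. exact: (bil_ge0 (kc_a_pos K1 x)). Qed.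

Let be1_le x y : be1 x y ^+ 2 <= q1 x y.
Proof.
have H := bil_cauchy (kc_a_sym K1 x) (kc_a_pos K1 x)
  (sharp (hopf_metric eps 1) (hopf_form eps 1) x) (y ord0).
have E := bil_bu (kc_a_sym K1 x) (sharp_low K1 x).
by move: H; rewrite !E (sharp_norm K1) mul1r.
Qed.

Let c_gt0 : 0 < c. Proof. by rewrite invr_gt0 kap_gt0. Qed.

Let cc_ge0 : 0 <= c ^+ 2 - c. Proof. by rewrite c2E divr_ge0 ?sqr_ge0. Qed.

Lemma berger_alpha_ratio x y : in_chart eps (alpha berger_metric) x y =
  Num.sqrt (q1 x y) * psi (be1 x y / Num.sqrt (q1 x y)).
Proof.
rewrite in_chart_alpha qBE /berger_fun -sqrtrM //; congr Num.sqrt.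
rewrite expr_div_n sqr_sqrtr //.
have := be1_le x y; have := q1_ge0 x y; move: (be1 x y) (q1 x y) => b q q0 bq.
(* If the round length is 0, the quotient is 0 by convention, and [be1_le] makes the Hopf form
   vanish too. *)
have [E|q_neq0] := eqVneq q 0; last by field; rewrite k0 q_neq0.
have -> : b = 0 by apply/eqP; rewrite -sqrf_eq0 eq_le sqr_ge0 -E bq.
by rewrite E; ring.
Qed.

Lemma berger_ricci x y : ricci (in_chart eps (alpha berger_metric)) x y =
  2 * qB x y - 4 * (bb ^+ 2 * qB x y - beB x y ^+ 2).
Proof.
(* The trace formula needs y nonzero; at y = 0 the curvature is a quadratic form evaluated at 0. *)
have [->|y0] := eqVneq y 0.
  have Z (h : 'I_3 -> R) : pair3 h ((0 : 'rV[R]_3) ord0) = 0.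
    by rewrite /pair3 big1 // => i _; rewrite mxE mulr0.
  rewrite qBE beBE q1E !Z !(mulr0, expr0n, addr0, subr0) /=.
  have [kA kb] := coefs eps.
  have kA_smooth := kc_a_smooth (KB eps); have kA_sym := kc_a_sym (KB eps).
  have kA_unit := kc_unit (KB eps); rewrite -kA in kA_smooth kA_sym kA_unit.
  rewrite /ricci big1 // => m _.
  rewrite (alpha_riemann kA_smooth kA_sym kA_unit (chart_alpha_sq berger_riemannian eps)).
  rewrite spray_riemann_quad big1 // => j _; rewrite big1 // => l _.
  by rewrite [X in _ * (X * _)]mxE mul0r mulr0.
have q1_gt0 : 0 < q1 x y.
  apply: (kc_a_pos K1 x); have /rV0Pn[i yi] := y0; by exists i.
have sq : Num.sqrt (q1 x y) ^+ 2 = q1 x y by rewrite sqr_sqrtr.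
have al0 : 0 < Num.sqrt (q1 x y) by rewrite sqrtr_gt0.
have r_le : (be1 x y / Num.sqrt (q1 x y)) ^+ 2 <= 1.
  by rewrite expr_div_n sq ler_pdivrMr // mul1r.
(* Any bound above 1, the length of eta, would do: [berger_fun] is defined on the whole line, and
   the strict inequality of the domain has to hold along the fibre as well. *)
have good : ab_good (hopf_metric eps 1) (hopf_form eps 1) 1 psi 2 x y.
  split; last exact: (berger_delta c_gt0 cc_ge0 r_le).
  split=> //; apply: (@le_lt_trans _ _ (Num.sqrt (q1 x y))).
    by rewrite -sqrtr_sqr ler_sqrt.
  by rewrite mulr_natl mulr2n ltrDl.
rewrite (ab_ricci K1 (berger_admissible c_gt0 cc_ge0 (ltr0n R 2)) berger_alpha_ratio good).
cbv zeta.
rewrite round_ricci -q1E (berger_derive1_Qfun c_gt0 cc_ge0) !(berger_Qfun c_gt0 cc_ge0) qBE beBE sq.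
have -> : (c3 * be1 x y) ^+ 2 = c3 ^+ 2 * be1 x y ^+ 2 by rewrite exprMn.
have -> : be1 x y ^+ 2 = (be1 x y / Num.sqrt (q1 x y)) ^+ 2 * q1 x y.
  by rewrite expr_div_n sq divfK // gt_eqF.
move: (be1 x y / Num.sqrt (q1 x y)) => r; move: (q1 x y) => q.
have E (k b : R) : k != 0 -> b ^+ 2 = 1 - k ->
  2 * q + q * ((2 * ((k^-1 ^+ 2 - k^-1) / k^-1 * r) * ((k^-1 ^+ 2 - k^-1) / k^-1 * r
     - r * ((k^-1 ^+ 2 - k^-1) / k^-1)) - 2 * ((k^-1 ^+ 2 - k^-1) / k^-1)) * (1 - r ^+ 2)
    + 4 * ((k^-1 ^+ 2 - k^-1) / k^-1 * r) * r
    + 2 * 1 * ((k^-1 ^+ 2 - k^-1) / k^-1 * r) ^+ 2) =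
  2 * (k^-1 * q + (k^-1 ^+ 2 - k^-1) * (r ^+ 2 * q)) -
  4 * (b ^+ 2 * (k^-1 * q + (k^-1 ^+ 2 - k^-1) * (r ^+ 2 * q)) - (b / k) ^+ 2 * (r ^+ 2 * q)).
  move=> kn bE; rewrite (expr_div_n b) bE; field; exact: kn.
by apply: (E kap bb k0); rewrite /kap; ring.
Qed.

End RoundToBerger.

Lemma berger_equations : alpha_beta_equations berger_metric berger_form bb.
Proof.
move=> eps x y al be a b.
have [kA kb] := coefs eps.
have alE : al x y ^+ 2 = pair3 (y ord0) (mulv (a x) (y ord0)) := chart_alpha_sq berger_riemannian eps x y.
have beE : be x y = pair3 (b x ord0) (y ord0) := in_chart_beta berger_form eps x y.
have K : killing_chart a b (bb ^+ 2) by rewrite /a /b kA kb; exact: KB.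
split.
- by rewrite alE beE; exact: berger_ricci.
- by rewrite alE beE; exact: (kc_ss K).
- rewrite beE /div_s0.
  (* Contracting [cov_s_up_killing] gives 3 b_j - b_j. *)
  have E j : \sum_m cov_s_up a b m j m x = 2 * b x ord0 j.
    under eq_bigr do rewrite (cov_s_up_killing K).
    have S := sharp_low K x j; rewrite /mulv in S.
    rewrite big_split sumrN /= S sum3 !eqxx /=.
    by ring.
  under eq_bigr do rewrite E.
  by rewrite /pair3 !sum3; ring.
Qed.

Lemma berger_pair : alpha_beta_pair berger_metric berger_form bb.
Proof.
split; [exact: berger_riemannian|exact: berger_form_smooth|exact: berger_killing
  |exact: berger_length|exact: berger_equations].
Qed.

End BergerPair.

(** * Solutions of the differential equation *)

(** The integral from [a] is used as a primitive only to the right of [a]; the lower limit is later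
    placed to the left of every point that matters. *)
Lemma exists_primitive {R : realType} (f : R -> R) (a : R) : continuous f ->
  exists F : R -> R, forall x, a < x -> is_derive x 1 F (f x).
Proof.
move=> fc; pose mu := @lebesgue_measure R.
exists (fun x => (\int[mu]_(t in [set` Interval (BLeft a) (BRight x)]) (f t))%R) => x ax.
have xu : x < x + 1 by rewrite ltrDl.
have fi : mu.-integrable [set` Interval (BLeft a) (BRight (x + 1))] (EFin \o f).
  apply: continuous_compact_integrable; first exact: segment_compact.
  exact: continuous_subspaceT.
have [D E] := continuous_FTC1_closed xu fi ax (fc x).
by apply: DeriveDef; [exact: D|rewrite -derive1E; exact: E].
Qed.

Section Profile.
Context {R : realType}.
Variables (N M : R).
Hypothesis N_gt0 : 0 < N.
Hypothesis NM : N < M.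
Implicit Types t : R.

Local Notation mu := (M - N).
Let mu_gt0 : 0 < mu. Proof. by rewrite subr_gt0. Qed.
Local Notation g t := (Num.sqrt (N - t ^+ 2)).
Local Notation k t := (Num.sqrt (mu + g t ^+ 2)).

(* The square root of (N - t^2) / (M - t^2), extended by 0 beyond its zeros. *)
Definition profile_slope t : R := g t / k t.

Local Notation zeta := profile_slope.

Let k_gt0 t : 0 < k t.
Proof. by rewrite sqrtr_gt0 ltr_pwDl // sqr_ge0. Qed.

Lemma profile_slope_ge0 t : 0 <= zeta t.
Proof. by rewrite divr_ge0 // sqrtr_ge0. Qed.

Lemma profile_slope_gt0 t : t ^+ 2 < N -> 0 < zeta t.
Proof. by move=> tN; rewrite divr_gt0 // sqrtr_gt0 subr_gt0. Qed.

Lemma profile_slope_sq t : t ^+ 2 < N -> 1 - zeta t ^+ 2 = mu / (M - t ^+ 2).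
Proof.
move=> tN; have M_gt0 : 0 < M - t ^+ 2 by rewrite subr_gt0 (lt_trans tN).
rewrite expr_div_n sqr_sqrtr ?subr_ge0 ?ltW // sqr_sqrtr; last first.
  by rewrite addr_ge0 ?subr_ge0 ?ltW.
have -> : mu + (N - t ^+ 2) = M - t ^+ 2 by ring.
by field; rewrite gt_eqF.
Qed.

Lemma profile_slope_continuous : continuous zeta.
Proof.
have gc : continuous (fun t : R => g t).
  move=> t; apply: (@continuous_comp _ _ _ (fun t : R => N - t ^+ 2) Num.sqrt); last exact: sqrt_continuous.
  apply: continuousB; [exact: cst_continuous|exact: exprn_continuous].
move=> t; apply: (@cvgM _ _ _ _ (fun t : R => g t) (fun t : R => (k t)^-1)); first exact: gc.
apply: cvgV; first by rewrite gt_eqF.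
apply: (@continuous_comp _ _ _ (fun t : R => mu + g t ^+ 2) Num.sqrt); last exact: sqrt_continuous.
apply: continuousD; first exact: cst_continuous.
apply: (@continuous_comp _ _ _ (fun t : R => g t) (fun u : R => u ^+ 2)); first exact: gc.
exact: exprn_continuous.
Qed.

(** Written in t and zeta alone, without radicals, so that the system of derivatives in
    [smooth_on_profile] closes up. *)
Lemma der_profile_slope t : t ^+ 2 < N ->
  is_derive t 1 zeta (- t * (1 - zeta t ^+ 2) ^+ 2 / (mu * zeta t)).
Proof.
move=> tN; have g_gt0 : 0 < g t by rewrite sqrtr_gt0 subr_gt0.
have h_gt0 : 0 < N - t ^+ 2 by rewrite subr_gt0.
have Dg : is_derive t 1 (fun t : R => g t) (- t / g t).
  apply: derE (der_sqrt (g := fun t : R => N - t ^+ 2) h_gt0 (derB (derC N t 1) (derX 2 (derId t)))) _.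
  by move: (g t) g_gt0 => G G0; field; rewrite gt_eqF.
have k2_gt0 : 0 < mu + g t ^+ 2 by rewrite -sqrtr_gt0.
have Dk : is_derive t 1 (fun t : R => k t) (- t / k t).
  apply: derE (der_sqrt (g := fun t : R => mu + g t ^+ 2) k2_gt0 (derD (derC mu t 1) (derX 2 Dg))) _.
  have := k_gt0 t; move: (k t) => K K0; move: (g t) g_gt0 => G G0.
  by field; rewrite !gt_eqF.
apply: derE (derM Dg (derV (f := fun t : R => k t) (lt0r_neq0 (k_gt0 t)) Dk)) _.
have kE : k t ^+ 2 = mu + g t ^+ 2 by rewrite sqr_sqrtr // ltW.
rewrite /zeta; have := k_gt0 t; move: (k t) kE => K kE K0; move: (g t) g_gt0 kE => G G0 kE.
have E : M = K ^+ 2 - G ^+ 2 + N by rewrite kE; ring.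
have kk : K ^+ 2 - G ^+ 2 != 0 by rewrite kE addrK gt_eqF.
rewrite E addrK; field.
by rewrite kk !gt_eqF.
Qed.

End Profile.

Section Reparametrization.
Context {R : realType}.
Variables (N M kap bb : R) (z : R -> R).
Hypothesis N_gt0 : 0 < N.
Hypothesis NM : N < M.
Hypothesis kap_gt0 : 0 < kap.
Hypothesis bb_gt0 : 0 < bb.
Local Notation T := (Num.sqrt N).
Local Notation zeta := (profile_slope N M).
Hypothesis z_der : forall t, - (T + 1) < t -> is_derive t 1 z (zeta t).
Hypothesis z_0 : z 0 = 0.
Implicit Types t : R.

Let T_gt0 : 0 < T. Proof. by rewrite sqrtr_gt0. Qed.
Let T_sq : T ^+ 2 = N. Proof. by rewrite sqr_sqrtr // ltW. Qed.

Let norm_T t : (t ^+ 2 < N) = (`|t| < T).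
Proof. by rewrite -[in LHS]T_sq -[t ^+ 2]real_normK ?num_real // ltr_pXn2r // ?nnegrE. Qed.

Let norm_leT t : (t ^+ 2 <= N) = (`|t| <= T).
Proof. by rewrite -[in LHS]T_sq -[t ^+ 2]real_normK ?num_real // ler_pXn2r // ?nnegrE. Qed.

(** The primitive starts one unit to the left of -T, so that z is differentiable also at the
    endpoints of |t| <= T. *)
Let T1 t : t ^+ 2 <= N -> - (T + 1) < t.
Proof.
rewrite norm_leT ler_norml => /andP[H _]; apply: lt_le_trans H.
by rewrite ltrN2 ltrDl.
Qed.

Let der_continuous (f : R -> R) (d t : R) : is_derive t 1 f d -> {for t, continuous f}.
Proof. by case=> H _; apply: differentiable_continuous; exact/derivable1_diffP. Qed.

(** Mean value theorem between 0 and [t]; that [c] lies strictly between them makes zeta(c) positive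
    even when t^2 = N. *)
Lemma primitive_mvt t : - (T + 1) < t -> t != 0 ->
  exists c, [/\ 0 < c * t, c ^+ 2 < t ^+ 2 & z t = zeta c * t].
Proof.
move=> tT; rewrite neq_lt => /orP[t0|t0].
  have [||c] := @MVT R z zeta t 0 t0.
  - by move=> x; rewrite in_itv /= => /andP[tx _]; apply: z_der; exact: lt_trans tx.
  - apply: continuous_in_subspaceT => x; rewrite inE /= in_itv /= => /andP[tx _].
    by apply: der_continuous; apply: z_der; exact: lt_le_trans tx.
  rewrite in_itv /= z_0 => /andP[tc c0] E; exists c; split.
  - by rewrite nmulr_rgt0.
  - by rewrite -sqrrN -[ltRHS]sqrrN ltr_pXn2r ?ltrN2 // ?nnegrE oppr_ge0 ltW.
  - by apply: oppr_inj; rewrite -[LHS]add0r E; ring.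
have [||c] := @MVT R z zeta 0 t t0.
- move=> x; rewrite in_itv /= => /andP[tx _]; apply: z_der; apply: lt_trans tx.
  by rewrite oppr_lt0 addr_gt0.
- apply: continuous_in_subspaceT => x; rewrite inE /= in_itv /= => /andP[tx _].
  apply: der_continuous; apply: z_der; apply: lt_le_trans tx.
  by rewrite oppr_lt0 addr_gt0.
rewrite in_itv /= z_0 !subr0 => /andP[c0 ct] E; exists c; split=> //.
- by rewrite mulr_gt0.
- by rewrite ltr_pXn2r // ?nnegrE ltW.
Qed.

Lemma primitive_mul_ge0 t : - (T + 1) < t -> 0 <= t * z t.
Proof.
move=> tT; have [->|t0] := eqVneq t 0; first by rewrite mul0r.
have [c [_ _ ->]] := primitive_mvt tT t0.
by rewrite mulrCA -expr2 mulr_ge0 ?sqr_ge0 // profile_slope_ge0.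
Qed.

Lemma primitive_mul_gt0 t : t ^+ 2 <= N -> t != 0 -> 0 < t * z t.
Proof.
move=> tN t0; have [c [_ ct ->]] := primitive_mvt (T1 tN) t0.
rewrite mulrCA -expr2 mulr_gt0 ?exprn_even_gt0 //.
by apply: profile_slope_gt0 => //; exact: lt_le_trans tN.
Qed.

(* s = bb z / rad, phi = kap / rad parametrizes a solution of the equation by t. *)
Definition rad t : R := Num.sqrt (kap * (N - t ^+ 2) + z t ^+ 2).

(** (N - t^2)^(1/2) times the Wronskian of (N - t^2)^(1/2) and z; up to positive factors it is
    ds/dt. *)
Definition wronskian t : R := (N - t ^+ 2) * zeta t + t * z t.

Definition s_of t : R := bb * z t / rad t.

Lemma rad_arg_gt0 t : t ^+ 2 <= N -> 0 < kap * (N - t ^+ 2) + z t ^+ 2.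
Proof.
move=> tN; have [t0|t0] := eqVneq t 0.
  by rewrite t0 z_0 expr0n subr0 addr0 mulr_gt0.
rewrite ltr_wpDl // ?mulr_ge0 ?subr_ge0 ?(ltW kap_gt0) //.
rewrite exprn_even_gt0 //; apply: contraTneq (primitive_mul_gt0 tN t0) => ->.
by rewrite mulr0 ltxx.
Qed.

Lemma rad_gt0 t : t ^+ 2 <= N -> 0 < rad t.
Proof. by move=> tN; rewrite sqrtr_gt0 rad_arg_gt0. Qed.

Lemma rad_sq t : t ^+ 2 <= N -> rad t ^+ 2 = kap * (N - t ^+ 2) + z t ^+ 2.
Proof. by move=> tN; rewrite sqr_sqrtr // ltW // rad_arg_gt0. Qed.

Lemma wronskian_gt0 t : t ^+ 2 < N -> 0 < wronskian t.
Proof.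
move=> tN; rewrite ltr_pwDl //; last exact: primitive_mul_ge0 (T1 (ltW tN)).
by rewrite mulr_gt0 ?subr_gt0 // profile_slope_gt0.
Qed.

Lemma der_rad t : t ^+ 2 <= N -> is_derive t 1 rad ((z t * zeta t - kap * t) / rad t).
Proof.
move=> tN; have D := z_der (T1 tN).
apply: derE (der_sqrt (g := fun t : R => kap * (N - t ^+ 2) + z t ^+ 2) (rad_arg_gt0 tN)
  (derD (der_scale kap (derB (derC N t 1) (derX 2 (derId t)))) (derX 2 D))) _.
have := rad_gt0 tN; rewrite -/(rad t); move: (rad t) (zeta t) => r w r0 /=.
by field; rewrite gt_eqF.
Qed.

Lemma der_s_of_le t : t ^+ 2 <= N ->
  is_derive t 1 s_of (bb * kap * wronskian t / rad t ^+ 3).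
Proof.
move=> tN; have D := z_der (T1 tN); have r0 := rad_gt0 tN.
apply: derE (derM (der_scale bb D) (derV (f := rad) (lt0r_neq0 r0) (der_rad tN))) _.
rewrite /wronskian; move: (rad_sq tN) r0; move: (rad t) (zeta t) (z t) => r w y rE r0.
have e : kap * (N - t ^+ 2) = r ^+ 2 - y ^+ 2 by rewrite rE; ring.
have -> : bb * kap * ((N - t ^+ 2) * w + t * y) / r ^+ 3 =
  bb * (kap * (N - t ^+ 2) * w + kap * t * y) / r ^+ 3 by congr (_ / _); ring.
by rewrite e; field; rewrite gt_eqF.
Qed.

Lemma s_of_inj t t' : t ^+ 2 < N -> t' ^+ 2 < N -> s_of t = s_of t' -> t = t'.
Proof.
have inc u v : u ^+ 2 < N -> v ^+ 2 < N -> u < v -> s_of u <> s_of v.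
  move=> uN vN uv E.
  have in_N x : x \in `[u, v]%R -> x ^+ 2 < N.
    move: uN vN; rewrite !norm_T !ltr_norml in_itv /= => /andP[Tu _] /andP[_ vT] /andP[ux xv].
    by rewrite (lt_le_trans Tu) ?(le_lt_trans xv).
  have [||c cuv] := @MVT R s_of (fun t => bb * kap * wronskian t / rad t ^+ 3) u v uv.
  - move=> x /subset_itv_oo_cc xuv; apply: der_s_of_le; exact/ltW/in_N.
  - apply: continuous_in_subspaceT => x; rewrite inE /= => xuv.
    by apply: der_continuous; apply: der_s_of_le; exact/ltW/in_N.
  rewrite E subrr => /esym/eqP; rewrite gt_eqF // mulr_gt0 ?subr_gt0 //.
  have cN := in_N _ (subset_itv_oo_cc cuv).
  by rewrite divr_gt0 ?exprn_gt0 ?rad_gt0 ?(ltW cN) // !mulr_gt0 // wronskian_gt0.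
move=> tN t'N E; have [tt|tt|//] := ltgtP t t'; first by case: (inc _ _ tN t'N tt).
by case: (inc _ _ t'N tN tt).
Qed.

(** At t^2 = N the radius reduces to |z|, so s is b times the sign of z. *)
Let s_of_T : s_of T = bb /\ s_of (- T) = - bb.
Proof.
have H t : t ^+ 2 = N -> s_of t = bb * (z t / `|z t|).
  by move=> tN; rewrite /s_of /rad tN subrr mulr0 add0r sqrtr_sqr mulrA.
have zT : 0 < z T.
  by rewrite -(pmulr_rgt0 _ T_gt0); apply: primitive_mul_gt0; rewrite ?T_sq // gt_eqF.
have zT' : z (- T) < 0.
  have := @primitive_mul_gt0 (- T); rewrite sqrrN T_sq lexx oppr_eq0 gt_eqF // => /(_ isT isT).
  by rewrite nmulr_rgt0 // oppr_lt0.
rewrite !H ?sqrrN ?T_sq // gtr0_norm // ltr0_norm // invrN mulrN !divff ?mulr1 ?mulrN1 //.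
  by rewrite lt_eqF.
by rewrite gt_eqF.
Qed.

Lemma s_of_surj (s : R) : `|s| < bb -> exists t, t ^+ 2 < N /\ s_of t = s.
Proof.
move=> sb; have [sT sT'] := s_of_T.
have [|||t tT E] := @IVT R s_of (- T) T s.
- by rewrite ge0_cp // ltW.
- apply: continuous_in_subspaceT => x; rewrite inE /= in_itv /= => xT.
  by apply: der_continuous; apply: der_s_of_le; rewrite norm_leT ler_norml.
- rewrite sT sT' ge_min le_max.
  move: sb; rewrite ltr_norml => /andP[/ltW -> /ltW ->]; by rewrite orbT.
exists t; split=> //; move: tT; rewrite norm_T in_itv /= -ler_norml le_eqVlt => /orP[|//].
rewrite eqr_norml => /andP[/orP[]/eqP tE _]; move: sb; rewrite -E tE.
  by rewrite sT gtr0_norm // ltxx.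
by rewrite sT' normrN gtr0_norm // ltxx.
Qed.

Section Inverse.
Variable tau : R -> R.
Hypothesis tauP : forall s, `|s| < bb -> tau s ^+ 2 < N /\ s_of (tau s) = s.

(** [tau] is chosen only as a right inverse of [s_of] with values in t^2 < N; by injectivity it is
    also a left inverse near the point, as differentiating an inverse function requires. *)
Lemma der_tau (s : R) : `|s| < bb ->
  is_derive s 1 tau (rad (tau s) ^+ 3 / (bb * kap * wronskian (tau s))).
Proof.
move=> sb; have [tN E] := tauP sb.
have D := der_s_of_le (ltW tN).
have nearN : \forall t \near tau s, t ^+ 2 < N.
  have C : {for tau s, continuous (fun t : R => t ^+ 2)} by exact: exprn_continuous.
  exact: (cvgr_lt _ C).
have c1 : {near tau s, cancel s_of tau}.
  have C : {for tau s, continuous (fun t : R => `|s_of t|)}.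
    by apply: cvg_norm; exact: der_continuous D.
  have nb : \forall t \near tau s, `|s_of t| < bb by apply: (cvgr_lt _ C); rewrite E.
  apply: filterS2 nearN nb => t t_N tb; have [uN uE] := tauP tb.
  exact: s_of_inj.
have c2 : {near tau s, continuous s_of}.
  by apply: filterS nearN => t /ltW t_N; exact: der_continuous (der_s_of_le t_N).
have w0 := wronskian_gt0 tN; have r0 := rad_gt0 (ltW tN).
have l0 : bb * kap * wronskian (tau s) / rad (tau s) ^+ 3 != 0.
  by rewrite gt_eqF // divr_gt0 ?exprn_gt0 // !mulr_gt0.
have := is_derive_inverse c1 c2 D l0; rewrite E => H.
by apply: derE H _; rewrite invf_div.
Qed.

End Inverse.
End Reparametrization.

Section SmoothOnInverse.
Context {R : realType}.
Variable b0 : R.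
Implicit Types (f g : R -> R).

Lemma smooth_onN n f : smooth_on b0 n f -> smooth_on b0 n (fun s => - f s).
Proof.
move=> H; apply: smooth_on_ext (smooth_onM (smooth_on_cst b0 n (-1)) H) => s _.
by rewrite mulN1r.
Qed.

Lemma smooth_onV n f : (forall s, `|s| < b0 -> f s != 0) -> smooth_on b0 n f ->
  smooth_on b0 n (fun s => (f s)^-1).
Proof.
move=> f0; elim: n f f0 => [|n IH] f f0 H.
  by split=> // s sb; case: (derV (f0 s sb) (smooth_on_is_derive sb H)).
apply: (@smooth_on_der _ b0 n (fun s => (f s)^-1) (fun s => - derive1 f s * (f s)^-1 ^+ 2)).
  move=> s sb; apply: derE (derV (f0 s sb) (smooth_on_is_derive sb H)) _.
  by rewrite exprVn.
apply: smooth_onM; first by apply: smooth_onN; case: H.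
by apply: smooth_onX; apply: IH => //; exact: smooth_onW.
Qed.

Lemma smooth_on_sqrt n f : (forall s, `|s| < b0 -> 0 < f s) -> smooth_on b0 n f ->
  smooth_on b0 n (fun s => Num.sqrt (f s)).
Proof.
move=> f0; elim: n f f0 => [|n IH] f f0 H.
  by split=> // s sb; case: (der_sqrt (f0 s sb) (smooth_on_is_derive sb H)).
apply: (@smooth_on_der _ b0 n (fun s => Num.sqrt (f s)) (fun s => (2 * Num.sqrt (f s))^-1 * derive1 f s)).
  by move=> s sb; exact: der_sqrt (f0 s sb) (smooth_on_is_derive sb H).
apply: smooth_onM; last by case: H.
apply: smooth_onV; first by move=> s sb; rewrite mulf_neq0 // gt_eqF // sqrtr_gt0 f0.
apply: smooth_onM; first exact: smooth_on_cst.
by apply: IH => //; exact: smooth_onW.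
Qed.

End SmoothOnInverse.

(** * Rational identities behind the profile *)

Section ProfileAlgebra.
Context {F : realFieldType}.
Variables t y w m r kap bb : F.
Hypothesis w0 : w != 0.
Hypothesis m0 : m != 0.
Hypothesis r0 : r != 0.
Hypothesis bb0 : bb != 0.
Hypothesis kap0 : kap != 0.
Hypothesis w1 : 1 - w ^+ 2 != 0.
Local Notation N := (t ^+ 2 + w ^+ 2 * m).
Local Notation M := (t ^+ 2 + m).
Local Notation E := ((N - t ^+ 2) * w + t * y).
Local Notation W := (y * w - kap * t).
Local Notation dw := (- t * (1 - w ^+ 2) ^+ 2 / ((M - N) * w)).
Local Notation dW := (w * w + y * dw - kap).
Local Notation dE := (- (2 * t) * w + (N - t ^+ 2) * dw + (y + t * w)).
Local Notation p0 := (kap / r).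
Local Notation s := (bb * y / r).
Local Notation p1 := (- (W / (bb * E))).
Local Notation p2 := (- ((dW * E - W * dE) / (bb * E ^+ 2) * (r ^+ 3 / (bb * kap * E)))).
Local Notation P := (w * r / E).
Local Notation L := (2 * N - M + 2 * N * (M - N) / (N - t ^+ 2)).
Hypothesis E0 : E != 0.
Hypothesis rE : r ^+ 2 = kap * (N - t ^+ 2) + y ^+ 2.

Let MN : M - N = m * (1 - w ^+ 2). Proof. by ring. Qed.
Let Nt : N - t ^+ 2 = w ^+ 2 * m. Proof. by ring. Qed.

(** With m = M - t^2 the square of zeta is (N - t^2) / m, so N and M become polynomials in t, w, m
    and no radical is left; besides this parametrization only [rE] is used. *)
Lemma profile_den : p0 - s * p1 = P.
Proof.
(* Naming the Wronskian keeps it an atom for [field]. *)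
have [e eE e0] : exists2 e, E = e & e != 0 by exists E.
have k : kap * e = kap * (N - t ^+ 2) * w + kap * (t * y) by rewrite -eE; ring.
have k' : kap * (N - t ^+ 2) = r ^+ 2 - y ^+ 2 by rewrite rE; ring.
rewrite eE; transitivity ((kap * e + y * W) / (r * e)); first by field; rewrite r0 e0 bb0.
by rewrite k k'; field; rewrite r0 e0.
Qed.

(** The use is twofold: the sign of [L] decides strong convexity, and the identity supplies (b^2 -
    s^2) phi'' for the differential equation. *)
Lemma profile_delta : p0 - s * p1 + (bb ^+ 2 - s ^+ 2) * p2 = P ^+ 3 * L.
Proof.
rewrite profile_den.
have [e eE e0] : exists2 e, E = e & e != 0 by exists E.
have k' : r ^+ 2 - y ^+ 2 = kap * (N - t ^+ 2) by rewrite rE; ring.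
have -> : (bb ^+ 2 - s ^+ 2) * p2 = - ((N - t ^+ 2) * r * (dW * E - W * dE) / E ^+ 3).
  have -> : bb ^+ 2 - s ^+ 2 = bb ^+ 2 * (r ^+ 2 - y ^+ 2) / r ^+ 2 by field.
  rewrite k' eE; move: dW dE W => a b c; move: (N - t ^+ 2) => d.
  by field; rewrite kap0 bb0 r0 e0.
have -> : P ^+ 3 * L = w ^+ 3 * r * (r ^+ 2 * L) / E ^+ 3.
  by rewrite eE; move: L => l; field; rewrite e0.
have -> : P = w * r * E ^+ 2 / E ^+ 3 by rewrite eE; field; rewrite e0.
rewrite -mulrBl; congr (_ / _); rewrite rE Nt MN.
by field; rewrite w0 m0 w1.
Qed.

(** Since 1 + s Q = phi / P, the term (b^2 - s^2) (1 + s Q) Q_s equals phi^2 L - (1 + s Q)^2 by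
    [profile_delta]. What remains involves first derivatives only and is a rational identity once
    r^2 and b^2 = 1 - kap are inserted. *)
Lemma profile_ode : bb ^+ 2 = 1 - kap ->
  (bb ^+ 2 - s ^+ 2) * ((1 + s * (p1 / P)) * (p0 * p2 / P ^+ 2) - (p1 / P) ^+ 2 + 2)
  - (2 * s * (p1 / P) + bb ^+ 2 * (p1 / P) ^+ 2 + 1) + (2 * N - M) * p0 ^+ 2 = 0.
Proof.
move=> bE.
have [e eE e0] : exists2 e, E = e & e != 0 by exists E.
have H : (bb ^+ 2 - s ^+ 2) * p2 = P ^+ 3 * L - P.
  by rewrite -profile_delta profile_den; ring.
have S : 1 + s * (p1 / P) = p0 / P.
  have -> : p0 = P + s * p1 by rewrite -profile_den; ring.
  by field; rewrite E0 w0 r0 bb0.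
have Q : p1 / P = - (W / (bb * r * w)).
  by rewrite eE; field; rewrite e0 w0 r0 bb0.
have sQ : s * (p1 / P) = - (y * W / (r ^+ 2 * w)).
  by rewrite Q; field; rewrite w0 r0 bb0.
have P0 : P != 0 by rewrite eE !mulf_neq0 ?invr_eq0.
transitivity ((1 + s * (p1 / P)) * p0 / P ^+ 2 * ((bb ^+ 2 - s ^+ 2) * p2)
  + (s * (p1 / P)) ^+ 2 - 2 * (bb * (p1 / P)) ^+ 2 + 2 * (bb ^+ 2 - s ^+ 2)
  - 2 * (s * (p1 / P)) - 1 + (2 * N - M) * p0 ^+ 2).
  by move: p2 (p1 / P) (2 * N - M) => a b c; ring.
transitivity (p0 ^+ 2 * (L + (2 * N - M)) - 2 - 4 * (s * (p1 / P)) - 2 * (bb * (p1 / P)) ^+ 2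
  + 2 * (bb ^+ 2 - s ^+ 2)).
  have -> : (1 + s * (p1 / P)) * p0 / P ^+ 2 * ((bb ^+ 2 - s ^+ 2) * p2)
    = p0 ^+ 2 * L - (1 + s * (p1 / P)) ^+ 2.
    by rewrite H S; move: P P0 L p0 => p p_0 l q; field.
  by move: (s * (p1 / P)) (bb * (p1 / P)) (bb ^+ 2 - s ^+ 2) (2 * N - M) L => a b c d l; ring.
have -> : bb ^+ 2 - s ^+ 2 = (1 - kap) * (r ^+ 2 - y ^+ 2) / r ^+ 2 by rewrite -bE; field.
have -> : (bb * (p1 / P)) ^+ 2 = W ^+ 2 / (r ^+ 2 * w ^+ 2).
  by rewrite Q; field; rewrite w0 r0 bb0.
rewrite sQ expr_div_n.
transitivity ((kap ^+ 2 * (L + (2 * N - M)) - 2 * r ^+ 2 + 4 * (y * W / w) - 2 * (W ^+ 2 / w ^+ 2)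
   + 2 * (1 - kap) * (r ^+ 2 - y ^+ 2)) / r ^+ 2).
  by move: L => l; move: (2 * N - M) W => k v; field; rewrite w0 r0.
rewrite rE Nt MN; apply/eqP; rewrite mulf_eq0; apply/orP; left; apply/eqP.
by field; rewrite w0 m0.
Qed.

End ProfileAlgebra.

Section ProfileFunction.
Context {R : realType}.
Variables (N M kap bb : R) (z tau : R -> R).
Hypothesis N_gt0 : 0 < N.
Hypothesis NM : N < M.
Hypothesis kap_gt0 : 0 < kap.
Hypothesis bb_gt0 : 0 < bb.
Hypothesis bbE : bb ^+ 2 = 1 - kap.
Local Notation zeta := (profile_slope N M).
Hypothesis z_der : forall t, - (Num.sqrt N + 1) < t -> is_derive t 1 z (zeta t).
Hypothesis z_0 : z 0 = 0.
Hypothesis tauP : forall s, `|s| < bb -> tau s ^+ 2 < N /\ s_of N kap bb z (tau s) = s.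
Implicit Types s : R.

Local Notation t s := (tau s).
Local Notation y s := (z (tau s)).
Local Notation w s := (zeta (tau s)).
Local Notation r s := (rad N kap z (tau s)).
Local Notation E s := (wronskian N M z (tau s)).
Local Notation dtau s := (r s ^+ 3 / (bb * kap * E s)).
Local Notation dw s := (- t s * (1 - w s ^+ 2) ^+ 2 / ((M - N) * w s)).

Let tN s : `|s| < bb -> t s ^+ 2 < N. Proof. by case/tauP. Qed.
Let sE s : `|s| < bb -> bb * y s / r s = s. Proof. by case/tauP. Qed.
Let w_gt0 s : `|s| < bb -> 0 < w s. Proof. by move=> /tN; exact: profile_slope_gt0. Qed.
Let r_gt0 s : `|s| < bb -> 0 < r s.
Proof. by move=> /tN /ltW; exact: rad_gt0 N_gt0 NM kap_gt0 z_der z_0 _. Qed.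
Let E_gt0 s : `|s| < bb -> 0 < E s.
Proof. by move=> /tN; exact: wronskian_gt0 N_gt0 NM z_der z_0 _. Qed.

Let der_t s : `|s| < bb -> is_derive s 1 tau (dtau s).
Proof. exact: der_tau N_gt0 NM kap_gt0 bb_gt0 z_der z_0 _ tauP _. Qed.

Let der_y s : `|s| < bb -> is_derive s 1 (fun s : R => y s) (w s * dtau s).
Proof.
move=> sb; apply: (der_comp (f := z) (g := tau)) (der_t sb); apply: z_der.
have := tN sb; rewrite -{1}[N]sqr_sqrtr ?(ltW N_gt0) // => H.
have : `|t s| < Num.sqrt N.
  by move: H; rewrite -[t s ^+ 2]real_normK ?num_real // ltr_pXn2r // ?nnegrE ?sqrtr_ge0.
rewrite ltr_norml => /andP[+ _]; apply: le_lt_trans; by rewrite lerN2 lerDl.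
Qed.

Let der_w s : `|s| < bb -> is_derive s 1 (fun s : R => w s) (dw s * dtau s).
Proof.
move=> sb; apply: (der_comp (f := zeta) (g := tau)) (der_t sb).
by apply: der_profile_slope => //; exact: tN.
Qed.

Let der_r s : `|s| < bb ->
  is_derive s 1 (fun s : R => r s) ((y s * w s - kap * t s) / r s * dtau s).
Proof.
move=> sb; apply: (der_comp (f := rad N kap z) (g := tau)) (der_t sb).
exact: (der_rad N_gt0 NM kap_gt0 z_der z_0 (ltW (tN sb))).
Qed.

(** Bootstrap: the derivatives of tau, z(tau) and zeta(tau) are built from these same three
    functions by sums, products, inverses and the square root of a positive function, so order n
    gives order n + 1. *)
Lemma smooth_on_profile n : [/\ smooth_on bb n tau, smooth_on bb n (fun s => y s)
  & smooth_on bb n (fun s => w s)].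
Proof.
elim: n => [|n [St Sy Sw]].
  by split; split=> // s sb; [case: (der_t sb)|case: (der_y sb)|case: (der_w sb)].
have c a := smooth_on_cst bb n a.
have Sr : smooth_on bb n (fun s => r s).
  apply: smooth_on_sqrt => [s sb|].
    exact: rad_arg_gt0 N_gt0 NM kap_gt0 z_der z_0 _ (ltW (tN sb)).
  apply: smooth_onD; last exact: smooth_onX.
  apply: smooth_onM => //; apply: smooth_onD => //; apply: smooth_onN; exact: smooth_onX.
have SE : smooth_on bb n (fun s => E s).
  apply: smooth_onD; last exact: smooth_onM.
  apply: smooth_onM => //; apply: smooth_onD => //; apply: smooth_onN; exact: smooth_onX.
have Sd : smooth_on bb n (fun s => dtau s).
  apply: smooth_onM; first exact: smooth_onX.
  apply: smooth_onV; last exact: smooth_onM.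
  by move=> s sb; rewrite gt_eqF // mulr_gt0 ?mulr_gt0 ?E_gt0.
split.
- exact: smooth_on_der der_t Sd.
- by apply: smooth_on_der der_y _; exact: smooth_onM.
- apply: smooth_on_der der_w _; apply: smooth_onM => //; apply: smooth_onM; last first.
    apply: smooth_onV; last exact: smooth_onM.
    by move=> s sb; rewrite gt_eqF // mulr_gt0 ?w_gt0 ?subr_gt0.
  apply: smooth_onM; first exact: smooth_onN.
  by apply: smooth_onX; apply: smooth_onD => //; apply: smooth_onN; exact: smooth_onX.
Qed.

Definition profile_phi s : R := kap / r s.

Local Notation phi := profile_phi.
Local Notation W s := (y s * w s - kap * t s).
Local Notation dW s := (w s * w s + y s * dw s - kap).
Local Notation dE s := (- (2 * t s) * w s + (N - t s ^+ 2) * dw s + (y s + t s * w s)).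
Local Notation p1 s := (- (W s / (bb * E s))).
Local Notation p2 s := (- ((dW s * E s - W s * dE s) / (bb * E s ^+ 2) * dtau s)).

Lemma profile_phi_smooth n : smooth_on bb n phi.
Proof.
have [St Sy Sw] := smooth_on_profile n; have c a := smooth_on_cst bb n a.
apply: smooth_onM => //; apply: smooth_onV => [s sb|]; first by rewrite gt_eqF // r_gt0.
apply: smooth_on_sqrt => [s sb|].
  exact: rad_arg_gt0 N_gt0 NM kap_gt0 z_der z_0 _ (ltW (tN sb)).
apply: smooth_onD; last exact: smooth_onX.
apply: smooth_onM => //; apply: smooth_onD => //; apply: smooth_onN; exact: smooth_onX.
Qed.

Lemma profile_phi_d1 s : `|s| < bb -> derive1 phi s = p1 s.
Proof.
move=> sb; have r0 := lt0r_neq0 (r_gt0 sb); have E0 := lt0r_neq0 (E_gt0 sb).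
have D := der_scale kap (derV (f := fun s : R => r s) r0 (der_r sb)).
rewrite derive1E (der_val D); move: (r s) (E s) r0 E0 (W s) => a e a0 e0 v.
by field; rewrite a0 e0 !gt_eqF.
Qed.

Lemma profile_phi_d2 s : `|s| < bb -> derive1n 2 phi s = p2 s.
Proof.
move=> sb; have r0 := lt0r_neq0 (r_gt0 sb); have E0 := lt0r_neq0 (E_gt0 sb).
have Dt := der_t sb; have Dy := der_y sb; have Dw := der_w sb.
have DW : is_derive s 1 (fun s : R => W s) (dW s * dtau s).
  by apply: derE (derB (derM Dy Dw) (der_scale kap Dt)) _; ring.
have DE : is_derive s 1 (fun s : R => E s) (dE s * dtau s).
  apply: derE (derD (derM (derB (derC N s 1) (derX 2 Dt)) Dw) (derM Dt Dy)) _.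
  by move: (dtau s) (dw s) => a b /=; ring.
have D : is_derive s 1 (fun s : R => p1 s) (p2 s).
  have bE0 : bb * E s != 0 by rewrite mulf_neq0 // gt_eqF.
  apply: derE (derN (derM DW (derV (f := fun s : R => bb * E s) bE0 (der_scale bb DE)))) _.
  move: (dtau s) => d; move: (dE s) => b; move: (dW s) => a; move: (W s) => v.
  move: (E s) E0 => e e0.
  by field; rewrite e0 gt_eqF.
transitivity (derive1 (derive1 phi) s) => //; rewrite derive1E.
apply: der_val; apply: der_eq D.
have C : {for s, continuous (fun s : R => `|s|)} by exact: norm_continuous.
by apply: filterS (cvgr_lt _ C _ sb) => u ub; rewrite profile_phi_d1.
Qed.

Local Notation Lam s := (2 * N - M + 2 * N * (M - N) / (N - t s ^+ 2)).

Let algebra s : `|s| < bb ->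
  [/\ phi s - s * p1 s = w s * r s / E s,
      phi s - s * p1 s + (bb ^+ 2 - s ^+ 2) * p2 s = (w s * r s / E s) ^+ 3 * Lam s
    & (bb ^+ 2 - s ^+ 2) * ((1 + s * (p1 s / (w s * r s / E s))) *
        (phi s * p2 s / (w s * r s / E s) ^+ 2) - (p1 s / (w s * r s / E s)) ^+ 2 + 2)
      - (2 * s * (p1 s / (w s * r s / E s)) + bb ^+ 2 * (p1 s / (w s * r s / E s)) ^+ 2 + 1)
      + (2 * N - M) * phi s ^+ 2 = 0].
Proof.
move=> sb; have m0 : M - t s ^+ 2 != 0 by rewrite gt_eqF // subr_gt0 (lt_trans (tN sb)).
have w1 := profile_slope_sq NM (tN sb).
have w1_neq0 : 1 - w s ^+ 2 != 0.
  by rewrite w1 mulf_neq0 ?invr_eq0 // gt_eqF // subr_gt0.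
have mE : t s ^+ 2 + (M - t s ^+ 2) = M by ring.
have nE : t s ^+ 2 + w s ^+ 2 * (M - t s ^+ 2) = N.
  have -> : w s ^+ 2 = 1 - (1 - w s ^+ 2) by ring.
  by rewrite w1; field.
have rE := rad_sq N_gt0 NM kap_gt0 z_der z_0 (ltW (tN sb)).
have w0 := lt0r_neq0 (w_gt0 sb); have r0 := lt0r_neq0 (r_gt0 sb).
have E0 := lt0r_neq0 (E_gt0 sb); have b0 := lt0r_neq0 bb_gt0; have k0 := lt0r_neq0 kap_gt0.
have A1 := @profile_den _ (t s) (y s) (w s) (M - t s ^+ 2) (r s) kap bb.
have A2 := @profile_delta _ (t s) (y s) (w s) (M - t s ^+ 2) (r s) kap bb.
have A3 := @profile_ode _ (t s) (y s) (w s) (M - t s ^+ 2) (r s) kap bb.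
rewrite !nE !mE in A1 A2 A3. rewrite sE // in A1 A2 A3.
by split; [apply: A1|apply: A2|apply: A3].
Qed.

Let P_gt0 s : `|s| < bb -> 0 < w s * r s / E s.
Proof. by move=> sb; exact: divr_gt0 (mulr_gt0 (w_gt0 sb) (r_gt0 sb)) (E_gt0 sb). Qed.

Let Lam_gt0 s : `|s| < bb -> 0 < Lam s.
Proof.
move=> /tN; rewrite -subr_gt0 => h.
(* In this form every summand is nonnegative, although K = 2 N - M may be zero or negative. *)
have -> : Lam s = M + 2 * (M - N) * t s ^+ 2 / (N - t s ^+ 2) by field; rewrite gt_eqF.
rewrite ltr_pwDl //; first exact: lt_trans NM.
by rewrite divr_ge0 ?(ltW h) // mulr_ge0 ?sqr_ge0 // mulr_ge0 // subr_ge0 ltW.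
Qed.

Lemma profile_delta_gt0 s : `|s| < bb -> 0 < ab_delta phi (bb ^+ 2) s.
Proof.
move=> sb; rewrite /ab_delta profile_phi_d1 // profile_phi_d2 //.
by have [_ -> _] := algebra sb; rewrite mulr_gt0 ?exprn_gt0 ?P_gt0 ?Lam_gt0.
Qed.

Lemma profile_admissible : admissible bb phi.
Proof.
split=> //.
- by move=> k s sb; exact: (smooth_on_derivable profile_phi_smooth sb).
- by move=> s sb; rewrite divr_gt0 // r_gt0.
move=> s c sc cb; have sb : `|s| < bb by exact: le_lt_trans cb.
have D := profile_delta_gt0 sb; rewrite /ab_delta in D.
have [A _ _] := algebra sb; have P0 := P_gt0 sb; rewrite -A -profile_phi_d1 // in P0.
have c0 : 0 <= c := le_trans (normr_ge0 s) sc.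
have s2 : s ^+ 2 <= c ^+ 2 by rewrite -[s ^+ 2]real_normK ?num_real // ler_pXn2r // ?nnegrE.
have c2 : c ^+ 2 <= bb ^+ 2 by rewrite ler_pXn2r // ?nnegrE ltW.
(* The quantity is affine in c^2 with slope phi'': it is bounded below by its value at c^2 = s^2 or
   at c^2 = b^2, according to the sign of the slope. *)
have [p0|p0] := leP 0 (derive1n 2 phi s).
  by rewrite ltr_wpDr // mulr_ge0 // subr_ge0.
by apply: lt_le_trans D _; rewrite lerD2l ler_wnM2r ?(ltW p0) // lerD2r.
Qed.

Lemma profile_einstein_ode : einstein_ode (2 * N - M) bb bb phi.
Proof.
move=> s sb Q Qs; rewrite /Qs /Q (derive1_Qfun profile_admissible sb) /Qfun' /Qfun.
rewrite profile_phi_d1 // profile_phi_d2 //.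
by have [-> _ ->] := algebra sb.
Qed.

Let tau_0 : tau 0 = 0.
Proof.
have [|t0 s0] := tauP (s := 0); first by rewrite normr0.
apply: (s_of_inj N_gt0 NM kap_gt0 bb_gt0 z_der z_0) => //; first by rewrite expr0n.
by rewrite s0 /s_of z_0 mulr0 mul0r.
Qed.

(** s = 0 corresponds to t = 0, where z vanishes and with it z zeta - kap t, the numerator of
    phi'. *)
Lemma profile_Qfun_0 : Qfun phi 0 = 0.
Proof.
by rewrite /Qfun profile_phi_d1 ?normr0 // tau_0 z_0 mul0r mulr0 subrr mul0r oppr0 mul0r.
Qed.

Lemma profile_phi_0 : phi 0 ^+ 2 = kap / N.
Proof.
rewrite /profile_phi expr_div_n rad_sq // tau_0 ?expr0n ?(ltW N_gt0) // z_0 expr0n /= subr0 addr0.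
by field; rewrite !gt_eqF.
Qed.

End ProfileFunction.

Lemma exists_profile {R : realType} (N M kap bb : R) :
  0 < N -> N < M -> 0 < kap -> 0 < bb -> bb ^+ 2 = 1 - kap ->
  exists phi : R -> R, [/\ admissible bb phi, einstein_ode (2 * N - M) bb bb phi,
    (forall s, `|s| < bb -> 0 < ab_delta phi (bb ^+ 2) s), Qfun phi 0 = 0
    & phi 0 ^+ 2 = kap / N].
Proof.
move=> N0 NM k0 b0 bE.
have [Z ZD] := exists_primitive (- (Num.sqrt N + 1)) (profile_slope_continuous NM).
pose z t := Z t - Z 0.
have z_der t : - (Num.sqrt N + 1) < t -> is_derive t 1 z (profile_slope N M t).
  by move=> tT; apply: derE (derB (ZD t tT) (derC (Z 0) t 1)) _; rewrite subr0.
have z_0 : z 0 = 0 by rewrite /z subrr.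
have /choice[tau tauP] : forall s : R, exists t : R, `|s| < bb ->
    t ^+ 2 < N /\ s_of N kap bb z t = s.
  move=> s; have [sb|sb] := ltP `|s| bb; last by exists 0.
  by have [t [tN tE]] := s_of_surj N0 NM k0 b0 z_der z_0 sb; exists t.
exists (profile_phi N kap z tau); split.
- exact: profile_admissible N0 NM k0 b0 bE z_der z_0 tauP.
- exact: profile_einstein_ode N0 NM k0 b0 bE z_der z_0 tauP.
- exact: profile_delta_gt0 N0 NM k0 b0 bE z_der z_0 tauP.
- exact: profile_Qfun_0 N0 NM k0 b0 z_der z_0 tauP.
- exact: profile_phi_0 N0 NM k0 b0 z_der z_0 tauP.
Qed.

(** * Existence *)

(** The bound b0 is b itself, the profile being constructed for |s| < b only: these metrics are
    almost regular, with the directions of b^# and -b^# outside the domain. *)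
Lemma berger_einstein_not_flag {R : realType} (b K N M : R) : 0 < b -> b < 1 ->
  0 < N -> N < M -> K = 2 * N - M ->
  exists phi : R -> R,
    [/\ in_family (berger_metric b) (berger_form b) K b b phi,
        finsler_on_domain (berger_metric b) (berger_form b) b phi,
        einstein_const (berger_metric b) (berger_form b) b phi K
      & ~ constant_flag_curvature (berger_metric b) (berger_form b) b phi].
Proof.
move=> b0 b1 N0 NM KE.
have k0 := kap_gt0 b0 b1.
have [|phi [adm ode delta Q0 phi0]] := exists_profile N0 NM k0 b0.
  by rewrite /kap opprB addrC subrK.
rewrite -KE in ode.
have AB := berger_pair b0 b1.
exists phi.
have [_ _ _ len _] := AB.
split=> //.
- by split=> //; split=> // eps x; rewrite len.
- exact (pair_finsler_on_domain AB adm delta).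
- exact (pair_einstein AB adm ode).
apply: (pair_not_constant_flag AB adm ode) => //.
(* The claim is that K kap / N differs from kap, that is K / N from 1, and K = 2 N - M < N. *)
rewrite phi0 -/(kap _) mulrCA -subr_eq0 -[X in _ - X]mulr1 -mulrBr mulf_neq0 //.
  by rewrite gt_eqF.
rewrite subr_eq0 KE lt_eqF // ltr_pdivrMr // mul1r ltrBlDr.
by rewrite mulr_natl mulr2n ltrD2l.
Qed.

(** With b0 = 1 > b the function 1 + s is positive on the interval and F is regular; Q = 1 turns the
    differential equation with K = 1 into an identity. *)
Lemma berger_randers {R : realType} (b : R) : 0 < b -> b < 1 ->
  in_family (berger_metric b) (berger_form b) 1 b 1 (fun s => 1 + s)
  /\ finsler_on_domain (berger_metric b) (berger_form b) 1 (fun s => 1 + s).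
Proof.
move=> b0 b1; have AB := berger_pair b0 b1.
have d1 (s : R) : derive1 (fun s : R => 1 + s) s = 1.
  by rewrite derive1E (der_val (derD (derC 1 s 1) (derId s))) add0r.
have d2 (s : R) : derive1n 2 (fun s : R => 1 + s) s = 0.
  transitivity (derive1 (fun _ : R => 1 : R) s); last exact: derive1_cst.
  by congr derive1; apply/funext => u; exact: d1.
have delta (C s : R) : ab_delta (fun s : R => 1 + s) C s = 1.
  by rewrite /ab_delta d1 d2; ring.
have Q (s : R) : Qfun (fun s : R => 1 + s) s = 1 by rewrite /Qfun d1 mulr1 addrK divr1.
have Qs (s : R) : derive1 (Qfun (fun s : R => 1 + s)) s = 0.
  by rewrite (_ : Qfun _ = fun=> 1) ?derive1_cst //; apply/funext.
have adm : admissible 1 (fun s : R => 1 + s).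
  split=> //.
  - move=> k s sb; apply: (smooth_on_derivable _ sb) => n.
    apply: smooth_onD; [exact: smooth_on_cst|exact: smooth_on_id].
  - by move=> s; rewrite ltr_norml -ltrBlDl sub0r => /andP[].
  - by move=> s c _ _; have := delta (c ^+ 2) s; rewrite /ab_delta => ->.
split; last by apply: (pair_finsler_on_domain AB adm) => r _; rewrite delta.
split=> //.
  by have [_ _ _ len _] := AB; split=> // eps x; rewrite len ltW.
by move=> s sb; cbv zeta; rewrite Q Qs; ring.
Qed.

Theorem theorem1p1 (R : realType) :
  (forall K : R, [\/ K = 1, K = 0 | K = -1] ->
     (forall (A : 'rV[R]_(3 + 1) -> 'M[R]_(3 + 1))
             (B : 'rV[R]_(3 + 1) -> 'rV[R]_(3 + 1)) (b b0 : R) (phi : R -> R),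
        in_family A B K b b0 phi -> einstein_const A B b0 phi K)
     /\
     (exists (A : 'rV[R]_(3 + 1) -> 'M[R]_(3 + 1))
             (B : 'rV[R]_(3 + 1) -> 'rV[R]_(3 + 1)) (b b0 : R) (phi : R -> R),
        [/\ 0 < b,
            in_family A B K b b0 phi,
            finsler_on_domain A B b0 phi,
            einstein_const A B b0 phi K
          & ~ constant_flag_curvature A B b0 phi]))
  /\
  (exists (A : 'rV[R]_(3 + 1) -> 'M[R]_(3 + 1))
          (B : 'rV[R]_(3 + 1) -> 'rV[R]_(3 + 1)) (b b0 : R),
     [/\ 0 < b,
         in_family A B 1 b b0 (fun s => 1 + s)
       & finsler_on_domain A B b0 (fun s => 1 + s)])
  /\
  (forall (A : 'rV[R]_(3 + 1) -> 'M[R]_(3 + 1))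
          (B : 'rV[R]_(3 + 1) -> 'rV[R]_(3 + 1)) (b b0 : R) (phi : R -> R),
     in_family A B 1 b b0 phi ->
     (forall s, `|s| < b0 -> phi s = 1 + s) ->
     (forall eps x y, domain A B b0 eps x y ->
        in_chart eps (alpha_beta A B phi) x y =
        in_chart eps (alpha A) x y + in_chart eps (beta B) x y)
     /\ constant_flag_curvature A B b0 phi).
Proof.
(* Any length b strictly between 0 and 1 would serve. *)
have b0 : 0 < 2^-1 :> R by rewrite invr_gt0.
have b1 : 2^-1 < 1 :> R by rewrite invf_lt1 // ltr1n.
move: (2^-1 : R) b0 b1 => b b0 b1.
split; [|split].
- move=> K K_eq; split; first by move=> A B c c0 phi [AB [adm _] ode]; exact (pair_einstein AB adm ode).
  (* For M = 2 N - K the condition N < M says K < N, so any N above both 0 and K is allowed; small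
     integers are taken below. *)
  suff [N [M [N0 [NM KE]]]] : exists N M : R, 0 < N /\ N < M /\ K = 2 * N - M.
    have [phi [fam fins ein flag]] := berger_einstein_not_flag b0 b1 N0 NM KE.
    by exists (berger_metric b), (berger_form b), b, b, phi.
  case: K_eq => ->.
  + by exists 2, 3; split; [|split; [rewrite ltr_nat|ring]].
  + by exists 1, 2; split; [|split; [rewrite ltr1n|ring]].
  + by exists 1, 3; split; [|split; [rewrite ltr1n|ring]].
- have [fam fins] := berger_randers b0 b1.
  by exists (berger_metric b), (berger_form b), b, 1.
- by move=> A B c c0 phi [AB [adm _] ode] phi_eq; exact (pair_randers AB adm phi_eq).
Qed.
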